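(* Let $\mathbb H$ be the upper half-plane. On $\mathbb C\times\mathbb H$ with coordinates $(z,\tau)$ consider the functions $\tilde\vartheta_1(z;\tau):=\vartheta_1(\pi z/2;\tau)$, $\zeta(z;\tau)$ and $\wp(z;\tau)$. Let $\Omega$ be a domain whose closure is compact and contained in $$(\mathbb C\times\mathbb H)\setminus\{(z,\tau): z\in 2\mathbb Z+2\tau\mathbb Z\}.$$ Then $\tilde\vartheta_1$, $\zeta$ and $\wp$, as functions of both variables $(z,\tau)$, are complex Noetherian functions on $\Omega$.
   Context: Theta functions: $\vartheta_4(z;\tau)=\sum_{n\in\mathbb Z}(-1)^n e^{\pi i n^2\tau+2inz}$ and $\vartheta_1(z;\tau)=-ie^{iz+\frac14\pi i\tau}\vartheta_4(z+\tfrac12\pi\tau;\tau)$. $\wp(z;\tau)$ is the Weierstrass elliptic function for the lattice $2\mathbb Z+2\tau\mathbb Z$ (periods $2$ and $2\tau$). The Weierstrass function $\zeta(z;\tau)$ is determined by $\partial_z\zeta(z;\tau)=-\wp(z;\tau)$ and $\lim_{z\to0}(\zeta(z;\tau)-z^{-1})=0$. Complex Noetherian functions: for a bounded domain $\Omega\subset\mathbb C^n$ with coordinates $x$, a tuple of holomorphic functions $\phi=(\phi_1,\ldots,\phi_\ell):\Omega\to\mathbb C^\ell$ is a complex Noetherian chain if $\partial\phi_i/\partial x_j=P_{i,j}(x,\phi)$ for all $i,j$, with $P_{i,j}$ complex polynomials. A function on $\Omega$ is a complex Noetherian function if it has the form $P(x,\phi)$ for some complex Noetherian chain $\phi$ on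 $\Omega$ and some complex polynomial $P$. *)

(* Defs.v *)
From HB Require Import structures.
From mathcomp Require Import all_boot all_order all_algebra complex.
From mathcomp Require Import all_classical all_reals all_analysis.
(* The notations of mpoly clash with those of MathComp-Analysis. *)
From mathcomp Require Import -(notations) mpoly.
From mathcomp Require summability.
Set Implicit Arguments.
Unset Strict Implicit.
Unset Printing Implicit Defensive.
Import Order.TTheory GRing.Theory Num.Theory.
Import numFieldNormedType.Exports.
Local Open Scope classical_set_scope.
Local Open Scope ring_scope.
Local Open Scope complex_scope.

(* R[i] is a one-dimensional normed space over itself, so that derivable,
   is_derive and differentiable at R[i] mean complex differentiability. *)
HB.instance Definition _ (R : rcfType) := NormedModule.copy R[i] R[i]^o.

Section SpecialFunctions.
Variable R : realType.
Local Notation C := R[i].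
Implicit Types z tau : C.

Definition cexp z : C :=
  (expR (complex.Re z))%:C * (cos (complex.Im z) +i* sin (complex.Im z)).

Definition upper_half_plane : set C := [set tau | 0 < complex.Im tau].

(* The infinite sums below are unconditional: summability.sum is the limit of
   the finite partial sums along the directed set of finite subsets. *)

Definition theta4 z tau : C :=
  summability.sum (fun n : int =>
    (-1) ^ n * cexp ((pi : R)%:C * 'i * n%:~R ^+ 2 * tau + 2 * 'i * n%:~R * z)).

Definition theta1 z tau : C :=
  - 'i * cexp ('i * z + 4^-1 * (pi : R)%:C * 'i * tau)
       * theta4 (z + 2^-1 * (pi : R)%:C * tau) tau.

Definition theta1_tilde z tau : C := theta1 ((pi : R)%:C * z / 2) tau.

Definition period tau (p : int * int) : C :=
  2 * p.1%:~R + 2 * tau * p.2%:~R.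

Definition lattice tau : set C := range (period tau).

Definition wp z tau : C :=
  z ^- 2 + summability.sum (fun p : int * int =>
    if p == (0, 0) then 0
    else (z - period tau p) ^- 2 - period tau p ^- 2).

Definition is_weierstrass_zeta tau (f : C -> C) : Prop :=
  (forall z, ~ lattice tau z -> is_derive z 1 f (- wp z tau)) /\
  f z - z^-1 @[z --> (0 : C)^'] --> (0 : C).

(* For tau in the upper half-plane the two conditions determine the function
   off the lattice; its values at the poles are irrelevant. *)
Definition weierstrass_zeta z tau : C :=
  xget (fun=> 0) [set f | is_weierstrass_zeta tau f] z.

End SpecialFunctions.

Section Noetherian.
Variable R : realType.
Local Notation C := R[i].

Definition domain n (Omega : set 'rV[C]_n) : Prop :=
  [/\ open Omega, connected Omega & Omega !=set0].

(* P(x, v) for a polynomial P in n + l variables *)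
Definition eval2 n l (P : mpoly (n + l) C) (x : 'rV[C]_n) (v : 'rV[C]_l) : C :=
  meval (fun k => row_mx x v 0 k) P.

(* The functions are total, but only their restrictions to Omega matter;
   Omega is meant to be a bounded domain. *)
Definition noetherian_chain n l (Omega : set 'rV[C]_n)
    (phi : 'I_l -> 'rV[C]_n -> C) : Prop :=
  (forall i x, Omega x -> differentiable (phi i) x) /\
  exists P : 'I_l -> 'I_n -> mpoly (n + l) C,
    forall i j x, Omega x ->
      'D_(delta_mx 0 j) (phi i) x = eval2 (P i j) x (\row_k phi k x).

Definition noetherian_function n (Omega : set 'rV[C]_n)
    (f : 'rV[C]_n -> C) : Prop :=
  exists l (phi : 'I_l -> 'rV[C]_n -> C), noetherian_chain Omega phi /\
  exists P : mpoly (n + l) C,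
    forall x, Omega x -> f x = eval2 P x (\row_k phi k x).

End Noetherian.

(* Main.v *)
Require Import Defs.
From HB Require Import structures.
From mathcomp Require Import all_boot all_order all_algebra complex.
From mathcomp Require Import all_classical all_reals all_analysis.
From mathcomp Require Import ring lra zify finmap.
From mathcomp Require Import -(notations) mpoly.
From mathcomp Require summability.
Set Implicit Arguments.
Unset Strict Implicit.
Unset Printing Implicit Defensive.
Import Order.TTheory GRing.Theory Num.Theory.
Import numFieldNormedType.Exports.
Local Open Scope classical_set_scope.
Local Open Scope ring_scope.
Local Open Scope complex_scope.

(** Write f for theta1_tilde and f_k for its z-derivatives. Termwise, f solves the
    heat equation: its tau-derivative is (pi i)^-1 f_2. Put L = f_1 / f, P = - L'
    and c = f_1(0), and let a = - f_3(0) / (3 c) and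
    b = (c f_5(0) - f_3(0)^2) / c^2, which depend on tau only. The chain consists
    of f, L, P, P', a and b. It is closed under d/dz because
    P'' = 6 P^2 - 12 a P + b, and under d/dtau because the heat equation turns
    tau-derivatives into z-derivatives, which this differential equation reduces
    (heat_L, heat_P, heat_P1). The tau-derivative of b comes from differentiating
    the differential equation itself in tau (b_heat). Finally wp = P - a (wp_ell)
    and zeta = L + a z (zeta_ell) off the lattice.

    The differential equation follows from the addition formula
    f(x+y) f(x-y) = O(y) E(x) - E(y) O(x) (thf_add): its Taylor coefficients in y
    span a space of dimension two, so the fourth one is a combination of f^2 and
    f f_2 - f_1^2 (hirota).

    The zeros of f are the lattice points (f_zeros). By the addition formula they
    form a discrete group, and for a zero w the ratio f(x+w) / f(x) is the
    exponential of an affine function of x; comparing its values under the two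
    quasi-periods shows that w is a period.

    Neither Liouville's theorem nor contour integration enters the identification
    of P with wp. Both P' and minus twice the sum Q of all (z - w)^-3, w a period,
    satisfy 8 F(2z) = F(z) + F(z+1) + F(z+tau) + F(z+1+tau): for Q by sorting the
    periods modulo 2 (cubeQ_half), for P' by differentiating the logarithm of
    f(2z)^2 = K f(z)^2 times the product of f(w+z) f(w-z) over the half-periods w
    (f_dup2, P1_halves). Their difference is bounded because the poles cancel,
    and the relation halves every bound, so it vanishes (P1_cubeQ). *)

(** * The norm of a complex number as a real number *)

(** The norm of R[i] takes its values in R[i] itself; estimates are carried out
    in the ordered field R. *)
Notation nrm := ComplexField.Normc.normc.

Section Norm.
Variable R : realType.
Local Notation C := R[i].
Implicit Types x y z : C.

Lemma normE z : `|z| = (nrm z)%:C.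
Proof. by rewrite normc_def; case: z => a b; reflexivity. Qed.

Lemma nrm_ge0 z : 0 <= nrm z.
Proof. by rewrite -lecR -normE; exact: normr_ge0. Qed.

Lemma nrm0 : nrm (0 : C) = 0.
Proof. by apply: complexI; rewrite -normE normr0. Qed.

Lemma nrm1 : nrm (1 : C) = 1.
Proof. by apply: complexI; rewrite -normE normr1. Qed.

Lemma nrm_eq0 z : (nrm z == 0) = (z == 0).
Proof. by rewrite -(inj_eq (@complexI R)) -normE normr_eq0. Qed.

Lemma nrm_gt0 z : (0 < nrm z) = (z != 0).
Proof. by rewrite lt_neqAle nrm_ge0 eq_sym nrm_eq0 andbT. Qed.

Lemma nrmM x y : nrm (x * y) = nrm x * nrm y.
Proof. by apply: complexI; rewrite -normE normrM rmorphM. Qed.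

Lemma nrmV x : nrm x^-1 = (nrm x)^-1.
Proof. by apply: complexI; rewrite -normE normfV fmorphV. Qed.

Lemma nrmX x n : nrm (x ^+ n) = nrm x ^+ n.
Proof. by apply: complexI; rewrite -normE normrX rmorphXn. Qed.

Lemma nrmN x : nrm (- x) = nrm x.
Proof. by apply: complexI; rewrite -!normE normrN. Qed.

Lemma nrmB x y : nrm (x - y) = nrm (y - x).
Proof. by rewrite -nrmN opprB. Qed.

Lemma nrmD x y : nrm (x + y) <= nrm x + nrm y.
Proof. by rewrite -lecR rmorphD /= -!normE ler_normD. Qed.

Lemma nrmBD x y : nrm (x - y) <= nrm x + nrm y.
Proof. by rewrite -(nrmN y) nrmD. Qed.

Lemma nrm_sub x y : nrm x - nrm y <= nrm (x - y).
Proof. by rewrite lerBlDr -{1}(subrK y x) nrmD. Qed.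

Lemma nrmR (r : R) : nrm r%:C = `|r|.
Proof. by rewrite /= expr0n /= addr0 sqrtr_sqr. Qed.

Lemma nrmn (n : nat) : nrm (n%:R : C) = n%:R.
Proof. by rewrite -(rmorph_nat (real_complex R)) nrmR ger0_norm. Qed.

Lemma nrmi : nrm ('i : C) = 1.
Proof. by apply: complexI; rewrite -normE normCi. Qed.

Lemma nrmz (n : int) : nrm (n%:~R : C) = `|n%:~R|.
Proof. by rewrite -(rmorph_int (real_complex R)) nrmR. Qed.

Lemma Re_le z : `|complex.Re z| <= nrm z.
Proof. by rewrite -lecR; apply: normc_ge_Re. Qed.

Lemma Im_le z : `|complex.Im z| <= nrm z.
Proof.
have -> : complex.Im z = - complex.Re (z * 'i%C) by rewrite ReiNIm opprK.
by rewrite normrN (le_trans (Re_le _)) // nrmM /= expr0n expr1n /= add0r sqrtr1 mulr1.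
Qed.

Lemma nrm_le_ReIm z : nrm z <= `|complex.Re z| + `|complex.Im z|.
Proof.
rewrite {1}(complexE z) (le_trans (nrmD _ _)) // nrmM !nrmR.
by rewrite /= expr0n expr1n /= add0r sqrtr1 mul1r.
Qed.

Lemma nrm_sum (I : Type) (s : seq I) (P : pred I) (f : I -> C) :
  nrm (\sum_(i <- s | P i) f i) <= \sum_(i <- s | P i) nrm (f i).
Proof.
elim/big_rec2: _ => [|i y x _ h]; first by rewrite nrm0.
by rewrite (le_trans (nrmD _ _)) // lerD2l.
Qed.

Lemma nbhsCP (T : Type) (F : set_system T) {FF : Filter F} (f : T -> C) (l : C) :
  (f @ F --> l) <-> forall e : R, 0 < e -> \forall x \near F, nrm (l - f x) < e.
Proof.
split=> [h e e0|h].
  move/cvgrPdist_lt: h => /(_ e%:C); rewrite ltcR => /(_ e0).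
  by apply: filterS => x; rewrite normE ltcR.
apply/cvgrPdist_lt => -[a b]; rewrite ltcE /= => /andP[/eqP -> a0].
apply: filterS (h _ a0) => x hx; rewrite normE.
by rewrite -[_ +i* _]/(a%:C) ltcR.
Qed.
End Norm.

(** * Unconditional sums *)

#[local] Existing Instance summability.totally_filter.

(** A wrapped convergence statement, so that unification does not unfold it. *)
Variant hassum (R : realType) (I : choiceType) (f : I -> R[i]) (s : R[i]) : Prop :=
  HasSum of summability.partial_sum f @ summability.totally --> s.

(** Absolute summability in the form that passes to subfamilies and products
    without a limit. *)
Definition absum (R : realType) (I : choiceType) (f : I -> R[i]) : Prop :=
  exists M : R, forall A : {fset I}, \sum_(i <- A) nrm (f i) <= M.

Section Sums.
Variable R : realType.
Local Notation C := R[i].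

Section OneIndex.
Variable I : choiceType.
Implicit Types (f g : I -> C) (s t : C) (A B : {fset I}).

Lemma psumE f A : summability.partial_sum f A = \sum_(i <- A) f i.
Proof. by rewrite /summability.partial_sum big_seq_fsetE. Qed.

Lemma hassumP f s : hassum f s <-> forall e : R, 0 < e -> exists A : {fset I},
  forall B, (A `<=` B)%fset -> nrm (s - \sum_(i <- B) f i) < e.
Proof.
split=> [[/nbhsCP h] e e0|h].
  have [A _ hA] := h e e0; exists A => B AB.
  by rewrite -psumE; apply: hA.
split; apply/nbhsCP => e e0; have [A hA] := h e e0.
by exists A => // B /= AB; rewrite psumE; apply: hA.
Qed.

Lemma hassum_unique f s t : hassum f s -> hassum f t -> s = t.
Proof. move=> [hs] [ht]; exact: (cvg_unique (@norm_hausdorff _ C) hs ht). Qed.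

Lemma hassum_sum f s : hassum f s -> summability.sum f = s.
Proof. move=> [hs]; exact: (cvg_lim (@norm_hausdorff _ C) hs). Qed.

Lemma eq_hassum f g s : f =1 g -> hassum f s -> hassum g s.
Proof. by move=> /funext ->. Qed.

Lemma hassumD f g s t : hassum f s -> hassum g t -> hassum (fun i => f i + g i) (s + t).
Proof.
move=> [hf] [hg]; split; have := cvgD hf hg.
suff -> : summability.partial_sum (fun i => f i + g i) =
  (summability.partial_sum f + summability.partial_sum g) by apply.
by apply/funext => A; rewrite psumE big_split /= -!psumE.
Qed.

Lemma hassumZ f s c : hassum f s -> hassum (fun i => c * f i) (c * s).
Proof.
move=> /hassumP hf; apply/hassumP => e e0.
have c0 : 0 < nrm c + 1 by rewrite ltr_wpDl ?nrm_ge0.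
have [A hA] := hf (e / (nrm c + 1)) (divr_gt0 e0 c0); exists A => B AB.
rewrite -big_distrr /= -mulrBr nrmM.
have := hA B AB; rewrite ltr_pdivlMr // => h.
by apply: le_lt_trans h; rewrite mulrC ler_wpM2l ?nrm_ge0 // lerDl.
Qed.

Lemma hassumN f s : hassum f s -> hassum (fun i => - f i) (- s).
Proof.
by move=> /(hassumZ (-1)); rewrite mulN1r; apply: eq_hassum => i; rewrite mulN1r.
Qed.

Lemma hassumB f g s t : hassum f s -> hassum g t -> hassum (fun i => f i - g i) (s - t).
Proof. by move=> hf hg; apply: hassumD => //; apply: hassumN. Qed.

Lemma hassumMr f s c : hassum f s -> hassum (fun i => f i * c) (s * c).
Proof. by move=> /(hassumZ c); rewrite mulrC; apply: eq_hassum => i; rewrite mulrC. Qed.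

Lemma fsub_sum (g : I -> R) A B : (forall i, 0 <= g i) -> (A `<=` B)%fset ->
  \sum_(i <- A) g i <= \sum_(i <- B) g i.
Proof.
move=> g0 AB; rewrite [leRHS](big_fsetID _ (mem A)) /=.
have -> : [fset x in B | x \in A]%fset = A.
  apply/fsetP => i; rewrite !inE /= andbC.
  by case: (boolP (i \in A)) => //= iA; rewrite (fsubsetP AB).
by rewrite lerDl sumr_ge0.
Qed.

Lemma hassum_nonneg (g : I -> R) (M : R) : (forall i, 0 <= g i) ->
  (forall A, \sum_(i <- A) g i <= M) ->
  exists s : R, hassum (fun i => (g i)%:C) s%:C.
Proof.
move=> g0 gM; pose S := [set \sum_(i <- A) g i | A in [set: {fset I}]].
have hS : has_sup S.
  split; first by exists 0, fset0 => //; rewrite big_nil.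
  by exists M => _ [A _ <-]; apply: gM.
exists (sup S); apply/hassumP => e e0.
have [_ [A _ <-] hA] := sup_adherent e0 hS.
exists A => B AB; rewrite -rmorph_sum -rmorphB nrmR /=.
have h1 : \sum_(i <- B) g i <= sup S by apply: ub_le_sup; [exact: hS.2|exists B].
have h2 := fsub_sum g0 AB.
by rewrite ger0_norm; lra.
Qed.

Lemma absum_dom (f g : I -> C) (c : R) : absum g ->
  (forall i, nrm (f i) <= c * nrm (g i)) -> absum f.
Proof.
move=> [M hM] h; exists (`|c| * M) => A.
apply: (@le_trans _ _ (\sum_(i <- A) `|c| * nrm (g i))).
  apply: ler_sum => i _; apply: le_trans (h i) _.
  by rewrite ler_wpM2r ?nrm_ge0 ?ler_norm.
by rewrite -big_distrr /= ler_wpM2l.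
Qed.

Lemma absumD f g : absum f -> absum g -> absum (fun i => f i + g i).
Proof.
move=> [M hM] [N hN]; exists (M + N) => A.
by rewrite (le_trans _ (lerD (hM A) (hN A))) // -big_split ler_sum // => i _; apply: nrmD.
Qed.

Lemma absumZ f c : absum f -> absum (fun i => c * f i).
Proof. by move=> h; apply: (absum_dom (c := nrm c)) h _ => i; rewrite nrmM. Qed.

(** The real and imaginary parts u of f satisfy |u| <= |f|, so u is the
    difference of the nonnegative families u + |f| and |f|, both with bounded
    partial sums. *)
Lemma absum_hassum f : absum f -> hassum f (summability.sum f).
Proof.
move=> [M hM].
suff [s hs] : exists s, hassum f s by rewrite (hassum_sum hs).
have [n hn] := hassum_nonneg (fun i => nrm_ge0 (f i)) hM.
have aux (u : I -> R) : (forall i, `|u i| <= nrm (f i)) ->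
    exists s : C, hassum (fun i => (u i)%:C) s.
  move=> hu.
  have h0 i : 0 <= u i + nrm (f i).
    by have := hu i; rewrite ler_norml => /andP[]; lra.
  have [|s hs] := hassum_nonneg h0 (M := M + M).
    move=> A; rewrite big_split lerD //= (le_trans _ (hM A)) // ler_sum // => i _.
    by rewrite (le_trans (ler_norm _)).
  exists (s%:C - n%:C); have := hassumB hs hn.
  by apply: eq_hassum => i; rewrite rmorphD addrK.
have [s1 h1] := aux (fun i => complex.Re (f i)) (fun i => Re_le _).
have [s2 h2] := aux (fun i => complex.Im (f i)) (fun i => Im_le _).
exists (s1 + 'i%C * s2); have := hassumD h1 (hassumZ 'i%C h2).
by apply: eq_hassum => i; rewrite -complexE.
Qed.

Lemma hassum_nrm f s M : hassum f s -> (forall A, \sum_(i <- A) nrm (f i) <= M) ->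
  nrm s <= M.
Proof.
move=> /hassumP hf hM; apply/ler_addgt0Pr => e e0.
have [A /(_ A (fsubset_refl _)) hA] := hf e e0.
have := nrm_sub s (\sum_(i <- A) f i); have := nrm_sum A xpredT f; have := hM A; lra.
Qed.

End OneIndex.

Section TwoIndex.
Variables I J : choiceType.

Lemma sum_inj_le (h : J -> I) (g : I -> R) M : injective h ->
  (forall A : {fset I}, \sum_(i <- A) g i <= M) ->
  forall A : {fset J}, \sum_(j <- A) g (h j) <= M.
Proof.
move=> hinj hM A; rewrite -(big_map h xpredT g).
have -> : \sum_(i <- map h A) g i = \sum_(i <- [fset h j | j in A]%fset) g i.
  apply: perm_big; apply: uniq_perm.
  - by rewrite map_inj_uniq.
  - exact: fset_uniq.
  move=> i; apply/mapP/imfsetP => /=.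
    by move=> [j jA ->]; exists j.
  by move=> [j jA ->]; exists j.
exact: hM.
Qed.

Lemma absum_inj (h : J -> I) (f : I -> C) : injective h -> absum f ->
  absum (fun j => f (h j)).
Proof.
by move=> hinj [M hM]; exists M => A; apply: (sum_inj_le hinj hM A).
Qed.

End TwoIndex.

(** The partial sum over a finite set B is the sum of the partial sums over the
    preimages of B under h1 and h2. *)
Lemma hassum_split (I I1 I2 : choiceType) (h1 : I1 -> I) (h2 : I2 -> I)
    (f : I -> C) s1 s2 :
  injective h1 -> injective h2 ->
  (forall i, (exists j, i = h1 j) \/ (exists k, i = h2 k)) ->
  (forall j k, h1 j <> h2 k) ->
  hassum (fun j => f (h1 j)) s1 -> hassum (fun k => f (h2 k)) s2 ->
  hassum f (s1 + s2).
Proof.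
move=> i1 i2 cov dis /hassumP H1 /hassumP H2; apply/hassumP => e e0.
have e2 : 0 < e / 2 by rewrite divr_gt0.
have [A1 hA1] := H1 _ e2; have [A2 hA2] := H2 _ e2.
exists ([fset h1 j | j in A1] `|` [fset h2 k | k in A2])%fset => B /fsubsetP AB.
have key (K : choiceType) (h : K -> I) : injective h ->
   exists2 B' : {fset K}, (forall k, (k \in B') = (h k \in B)) &
     [fset h k | k in B']%fset = [fset i in B | `[< exists k, i = h k >]]%fset.
  move=> hi.
  have [g hg] : exists g : I -> option K, forall i,
     if g i is Some k then i = h k else ~ exists k, i = h k.
    suff : forall i, exists o : option K, if o is Some k then i = h k else ~ exists k, i = h k.
      by move=> h'; have [g hg] := boolp.choice h'; exists g.
    move=> i; by case: (pselect (exists k, i = h k)) => [[k ->]|nk]; [exists (Some k)|exists None].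
  pose B' : {fset K} := [fset k in pmap g B]%fset.
  have hB' k : (k \in B') = (h k \in B).
    rewrite !inE /= mem_pmap; apply/mapP/idP => [[i iB gi]|kB].
      by have := hg i; rewrite -gi => <-.
    exists (h k) => //; have := hg (h k); case: (g (h k)) => [k' /hi -> //|[]].
    by exists k.
  exists B' => //; apply/fsetP => i; rewrite !inE /=; apply/imfsetP/andP => /=.
    by move=> [k kB ->]; rewrite -hB' kB; split=> //; apply/asboolP; exists k.
  by move=> [iB /asboolP[k ik]]; exists k => //; rewrite hB' -ik.
have [B1 m1 e1] := key _ h1 i1; have [B2 m2 e2'] := key _ h2 i2.
have -> : \sum_(i <- B) f i = \sum_(j <- B1) f (h1 j) + \sum_(k <- B2) f (h2 k).
  rewrite (big_fsetID _ (fun i => `[< exists k, i = h1 k >])) /= -e1.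
  have -> : [fset x in B | ~~ `[< exists k, x = h1 k >]]%fset
          = [fset i in B | `[< exists k, i = h2 k >]]%fset.
    apply/fsetP => i; rewrite !inE /=; congr (_ && _); apply/idP/idP => /asboolP h; apply/asboolP.
      by case: (cov i).
    by move=> [j ij]; move: h => [k]; rewrite ij; apply: dis.
  by rewrite -e2' !big_imfset //= => x y _ _; [apply: i2|apply: i1].
rewrite opprD addrACA (le_lt_trans (nrmD _ _)) // (splitr e) ltrD //.
  apply: hA1; apply/fsubsetP => j jA; rewrite m1 AB // !inE.
  by apply/orP; left; apply/imfsetP; exists j.
apply: hA2; apply/fsubsetP => j jA; rewrite m2 AB // !inE.
by apply/orP; right; apply/imfsetP; exists j.
Qed.

Lemma hassum_void (I : choiceType) (f : I -> C) : (I -> False) -> hassum f 0.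
Proof.
move=> nI; apply/hassumP => e e0; exists fset0 => B _.
by rewrite big1_fset ?subr0 ?nrm0 // => i; case: (nI i).
Qed.

Lemma hassum_reindex (I J : choiceType) (h : J -> I) (f : I -> C) s :
  bijective h -> hassum (fun j => f (h j)) s -> hassum f s.
Proof.
move=> [g hg gh] H; rewrite -[s]addr0.
apply: (@hassum_split I J void h (fun v : void => match v with end)) => //.
- exact: can_inj hg.
- by move=> i; left; exists (g i); rewrite gh.
- by apply: hassum_void => -[].
Qed.

Lemma big_fset_prod (I J : choiceType) (A : {fset I}) (B : {fset J}) (V : nmodType)
    (F : I * J -> V) :
  \sum_(p <- (A `*` B)%fset) F p = \sum_(i <- A) \sum_(j <- B) F (i, j).
Proof.
rewrite -big_allpairs.
apply: perm_big; apply: uniq_perm; first exact: fset_uniq.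
  by apply: allpairs_uniq => // -[a b] [c d] _ _ /= [-> ->].
move=> [i j]; rewrite in_fsetM /=; apply/andP/allpairsP => /=.
  by move=> [iA jB]; exists (i, j).
by move=> [[i' j'] /= [? ?] [-> ->]].
Qed.

Lemma absum_prod (I J : choiceType) (f : I -> C) (g : J -> C) :
  absum f -> absum g -> absum (fun p : I * J => f p.1 * g p.2).
Proof.
move=> [M hM] [N hN]; exists (M * N) => A.
pose A1 := [fset p.1 | p in A]%fset; pose A2 := [fset p.2 | p in A]%fset.
have M0 : 0 <= M by apply: le_trans (hM fset0); rewrite big_nil.
have sub : (A `<=` A1 `*` A2)%fset.
  apply/fsubsetP => p pA; rewrite in_fsetM; apply/andP; split; apply/imfsetP; by exists p.
apply: (le_trans (fsub_sum (g := fun p : I * J => nrm (f p.1 * g p.2)) _ sub)).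
  by move=> p; apply: nrm_ge0.
rewrite big_fset_prod /=.
under eq_bigr => i _ do (under eq_bigr => j _ do rewrite nrmM; rewrite -big_distrr /=).
rewrite -big_distrl /= ler_pM ?sumr_ge0 // => i _; exact: nrm_ge0.
Qed.

(** Partial sums of the product family over large rectangles are products of
    partial sums; every finite set of pairs lies in such a rectangle. *)
Lemma hassum_prod (I J : choiceType) (f : I -> C) (g : J -> C) s t :
  absum f -> absum g -> hassum f s -> hassum g t ->
  hassum (fun p : I * J => f p.1 * g p.2) (s * t).
Proof.
move=> af ag hf hg; have hp := absum_hassum (absum_prod af ag).
set F := (X in hassum X _) in hp.
suff -> : s * t = summability.sum F by [].
apply/eqP; rewrite -subr_eq0 -nrm_eq0 eq_le nrm_ge0 andbT; apply/ler_addgt0Pr => e e0.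
rewrite add0r; move/hassumP : hp => hp.
have e2 : 0 < e / 2 by rewrite divr_gt0.
have [A hA] := hp _ e2.
pose k := nrm s + nrm t + 1.
have k0 : 0 < k by rewrite /k; have := nrm_ge0 s; have := nrm_ge0 t; lra.
pose d := Num.min 1 (e / 2 / k).
have d0 : 0 < d by rewrite lt_min ltr01 divr_gt0.
move/hassumP/(_ d d0) : hf => [A1 hA1]; move/hassumP/(_ d d0) : hg => [A2 hA2].
pose B1 := (A1 `|` [fset p.1 | p in A])%fset.
pose B2 := (A2 `|` [fset p.2 | p in A])%fset.
have {}hA1 := hA1 B1 (fsubsetUl _ _); have {}hA2 := hA2 B2 (fsubsetUl _ _).
have sub : (A `<=` B1 `*` B2)%fset.
  apply/fsubsetP => p pA; rewrite in_fsetM !inE; apply/andP; split; apply/orP; right;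
  apply/imfsetP; by exists p.
have := hA _ sub; rewrite big_fset_prod /= {1}/F /=.
under eq_bigr => i _ do rewrite -big_distrr /=.
rewrite -big_distrl /=; set u := \sum_(i <- _) _; set v := \sum_(i <- _) _ => h.
have -> : s * t - summability.sum F =
   (s * (t - v) + (s - u) * t - (s - u) * (t - v)) - (summability.sum F - u * v) by ring.
rewrite (le_trans (nrmBD _ _)) // (splitr e) lerD //; last exact: ltW.
rewrite (le_trans (nrmBD _ _)) //.
have := nrmD (s * (t - v)) ((s - u) * t); rewrite !nrmM => h1.
rewrite -/u in hA1; rewrite -/v in hA2.
have dk : d * k <= e / 2.
  by rewrite -ler_pdivlMr // ge_min lexx orbT.
have dd : nrm (s - u) * nrm (t - v) <= d * 1.
  by rewrite ler_pM ?nrm_ge0 // ltW // (lt_le_trans hA2) // ge_min lexx.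
have := nrm_ge0 s; have := nrm_ge0 t => t0 s0.
have q1 : nrm s * nrm (t - v) <= nrm s * d by rewrite ler_wpM2l // ltW.
have q2 : nrm (s - u) * nrm t <= d * nrm t by rewrite ler_wpM2r // ltW.
apply: le_trans dk; rewrite /k.
have -> : d * (nrm s + nrm t + 1) = nrm s * d + d * nrm t + d * 1 by ring.
lra.
Qed.

End Sums.

(** * Complex differentiation *)

Section Calculus.
Variable R : realType.
Local Notation C := R[i].

(** The real value of the norm of V, which takes its values in R[i]. *)
Definition vnrm (V : normedModType C) (h : V) : R := complex.Re `|h|.

Lemma vnrmE (V : normedModType C) (h : V) : `|h| = (vnrm h)%:C.
Proof. by rewrite /vnrm RRe_real // normr_real. Qed.

Lemma vnrmC (h : C) : vnrm h = nrm h.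
Proof. by apply: complexI; rewrite -vnrmE; exact: normE. Qed.

Lemma vnrm_ge0 (V : normedModType C) (h : V) : 0 <= vnrm h.
Proof. by rewrite -lecR -vnrmE normr_ge0. Qed.

Lemma gt0C (e : C) : 0 < e -> exists2 r : R, 0 < r & e = r%:C.
Proof.
case: e => a b; rewrite ltcE /= => /andP[/eqP -> a0].
by exists a.
Qed.

(** Termwise estimates of a series yield a remainder of second order; this turns
    such a bound into differentiability. *)
Lemma diff_quad (V : normedModType C) (F : V -> C) (x : V) (L : {linear V -> C})
    (K M r : R) : 0 < r ->
  (forall h, nrm (L h) <= K * vnrm h) ->
  (forall h, vnrm h < r -> nrm (F (h + x) - F x - L h) <= M * vnrm h ^+ 2) ->
  differentiable F x /\ forall v, is_derive x v F (L v).
Proof.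
move=> r0 LK Fr.
have Lc : continuous L.
  move=> y; apply/nbhsCP => e e0.
  have k0 : 0 < `|K| + 1 by rewrite ltr_wpDl.
  have : \forall z \near y, `|y - z| < (e / (`|K| + 1))%:C.
    apply: (@cvgr_dist_lt _ _ _ _ _ id y) => //.
    by rewrite ltcR divr_gt0.
  apply: filterS => z; rewrite vnrmE ltcR ltr_pdivlMr // => h.
  rewrite -linearB (le_lt_trans (LK _)) // (le_lt_trans _ h) // mulrC ler_wpM2l ?vnrm_ge0 //.
  by rewrite (le_trans (ler_norm _)) // lerDl.
have Lo : F \o shift x = cst (F x) + L +o_ 0 id.
  apply/eqaddoP => e /gt0C [e' e0 ->].
  have k0 : 0 < `|M| + 1 by rewrite ltr_wpDl.
  have : \forall z \near (0 : V), `|0 - z| < (Num.min r (e' / (`|M| + 1)))%:C.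
    apply: (@cvgr_dist_lt _ _ _ _ _ id 0) => //.
    by rewrite ltcR lt_min r0 divr_gt0.
  apply: filterS => z; rewrite sub0r normrN vnrmE ltcR lt_min => /andP[zr ze].
  rewrite [leLHS]normE /= -rmorphM lecR /=.
  have := Fr z zr; rewrite opprD addrA => h; apply: le_trans h _.
  rewrite expr2 mulrA ler_wpM2r ?vnrm_ge0 //.
  move: ze; rewrite ltr_pdivlMr // => ze; rewrite (le_trans _ (ltW ze)) // mulrC.
  by rewrite ler_wpM2l ?vnrm_ge0 // (le_trans (ler_norm _)) // lerDl.
have dF : 'd F x = L :> (V -> C) by apply: diff_unique.
have D : differentiable F x by apply/diff_locallyP; rewrite dF.
split=> // v; apply: DeriveDef; first exact: diff_derivable.
by rewrite deriveE // dF.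
Qed.

Lemma is_derive_epsP (V : normedModType C) (F : V -> C) (z v : V) (l : C) :
  is_derive z v F l <->
  forall e : R, 0 < e -> exists2 d : R, 0 < d &
    forall h : C, nrm h < d -> nrm (F (h *: v + z) - F z - l * h) <= e * nrm h.
Proof.
split=> [[dF <-] e e0|H].
  have /eqaddoP := derivable_nbhs dF.
  have ec0 : 0 < e%:C :> C by rewrite ltcR.
  move=> /(_ _ ec0) /nbhs_ballP [d /= /gt0C[d' d0 ->]] H.
  exists d' => // h hd; have := H h.
  rewrite -ball_normE /= sub0r normrN normE ltcR => /(_ hd).
  rewrite normE -rmorphM lecR /=.
  apply: le_trans; rewrite le_eqVlt; apply/orP; left; apply/eqP; congr nrm.
  rewrite !fctE /= opprD addrA.
  by rewrite [_ * h]mulrC.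
have cv : h^-1 *: (F (h *: v + z) - F z) @[h --> (0 : C)^'] --> l.
  apply/cvgrPdist_le => e /gt0C [e' e0 ->]; have [d d0 hd] := H e' e0.
  near=> h.
  have h0 : h != 0 by near: h; exact: nbhs_dnbhs_neq.
  have := hd h => /(_ _)/wrap[].
    by rewrite -ltcR -normE; near: h; apply: dnbhs0_lt; rewrite ltcR.
  move=> hh.
  have -> : l - h^-1 *: (F (h *: v + z) - F z) = - ((F (h *: v + z) - F z - l * h) / h).
    by rewrite [_ *: _]mulrC; field.
  by rewrite normrN normE lecR nrmM nrmV ler_pdivrMr // nrm_gt0.
apply: DeriveDef; first by apply/cvg_ex; exists l.
exact: (cvg_lim (@norm_hausdorff _ C) cv).
Unshelve. all: by end_near. Qed.

Lemma is_derive_eps (F : C -> C) (z l : C) : is_derive z 1 F l <->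
  forall e : R, 0 < e -> exists2 d : R, 0 < d &
    forall h, nrm h < d -> nrm (F (z + h) - F z - l * h) <= e * nrm h.
Proof.
have E (h : C) : h%:A + z = z + h by rewrite [h%:A]mulr1 addrC.
rewrite is_derive_epsP; split=> H e /H[d d0 hd]; exists d => // h /hd;
by rewrite E.
Qed.

Lemma eps_is_derive (g : R -> R) (t D : R) :
  (forall e : R, 0 < e -> exists2 d : R, 0 < d &
     forall h, `|h| < d -> `|g (t + h) - g t - D * h| <= e * `|h|) ->
  is_derive t 1 g D.
Proof.
move=> H.
have cv : h^-1 *: (g (h *: 1 + t) - g t) @[h --> (0 : R)^'] --> D.
  apply/cvgrPdist_le => e e0; have [d d0 hd] := H e e0.
  near=> h.
  have h0 : h != 0 by near: h; exact: nbhs_dnbhs_neq.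
  have := hd h; rewrite {1}/GRing.scale /= => /(_ _)/wrap[].
    near: h; apply: dnbhs0_lt => //.
  rewrite [_ *: 1]mulr1 [h + t]addrC => hh.
  have -> : D - h^-1 *: (g (t + h) - g t) = - ((g (t + h) - g t - D * h) / h).
    by rewrite /GRing.scale /=; field.
  by rewrite normrN normrM normfV ler_pdivrMr // normr_gt0.
apply: DeriveDef; first by apply/cvg_ex; exists D.
exact: (cvg_lim (@norm_hausdorff _ R) cv).
Unshelve. all: by end_near. Qed.

Lemma is_derive_path (F : C -> C) (p w l u : C) (t : R) :
  is_derive (p + t%:C * w) 1 F l ->
  is_derive t 1 (fun s : R => complex.Re (u * F (p + s%:C * w))) (complex.Re (u * l * w)).
Proof.
move=> dF; apply: eps_is_derive => e e0.
pose k := nrm u * nrm w + 1.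
have k0 : 0 < k by rewrite ltr_wpDl // mulr_ge0 // nrm_ge0.
have [d d0 H] := (is_derive_eps _ _ _).1 dF _ (divr_gt0 e0 k0).
exists (d / (nrm w + 1)) => [|h hd].
  by rewrite divr_gt0 // ltr_wpDl // nrm_ge0.
have w0 : 0 < nrm w + 1 by rewrite ltr_wpDl // nrm_ge0.
have hw : nrm (h%:C * w) < d.
  rewrite nrmM nrmR; move: hd; rewrite ltr_pdivlMr //; apply: le_lt_trans.
  by rewrite ler_wpM2l // lerDl.
have := H _ hw; set z := p + t%:C * w => {}H.
have -> : p + (t + h)%:C * w = z + h%:C * w by rewrite rmorphD mulrDl addrA.
have -> : complex.Re (u * F (z + h%:C * w)) - complex.Re (u * F z) - complex.Re (u * l * w) * h
   = complex.Re (u * (F (z + h%:C * w) - F z - l * (h%:C * w))).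
  have -> : complex.Re (u * l * w) * h = complex.Re (u * l * w * h%:C).
    by case: (u * l * w) => a b /=; rewrite mulr0 subr0.
  by rewrite -!raddfB /=; congr complex.Re; ring.
apply: le_trans (Re_le _) _; rewrite nrmM.
apply: (@le_trans _ _ (nrm u * (e / k * nrm (h%:C * w)))); first by rewrite ler_wpM2l // nrm_ge0.
rewrite nrmM nrmR.
have -> : nrm u * (e / k * (`|h| * nrm w)) = (e * `|h|) * (nrm u * nrm w / k) by ring.
rewrite -[leRHS]mulr1 ler_wpM2l ?mulr_ge0 // ?(ltW e0) // ler_pdivrMr // mul1r.
by rewrite /k lerDl.
Qed.

Lemma mvt01 (g g' : R -> R) :
  (forall s : R, 0 <= s <= 1 -> is_derive s 1 g (g' s)) ->
  exists2 c, 0 <= c <= 1 & g 1 - g 0 = g' c.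
Proof.
move=> dg.
have gc : {within `[0, 1], continuous g}.
  by apply: derivable_within_continuous => s; rewrite in_itv /= => /dg [].
have dg' (s : R) : s \in `]0, 1[%R -> is_derive s 1 g (g' s).
  by rewrite in_itv /= => /andP[s0 s1]; apply: dg; rewrite !ltW.
have [c c01 E] := @MVT_segment R g g' 0 1 ler01 dg' gc.
by exists c; [move: c01; rewrite in_itv|rewrite E subr0 mulr1].
Qed.

(** Apply the real mean value theorem to the real part of u F along the segment,
    where u is the unit number that makes u (F q - F p) real and positive. *)
Lemma mvt_ineq (F F' : C -> C) (p q : C) (M : R) :
  (forall t : R, 0 <= t <= 1 -> is_derive (p + t%:C * (q - p)) 1 F (F' (p + t%:C * (q - p)))) ->
  (forall t : R, 0 <= t <= 1 -> nrm (F' (p + t%:C * (q - p))) <= M) ->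
  nrm (F q - F p) <= M * nrm (q - p).
Proof.
move=> dF FM; have M0 : 0 <= M.
  by apply: le_trans (nrm_ge0 _) (FM 0 _); rewrite lexx ler01.
have [->|ne] := eqVneq (F q) (F p).
  by rewrite subrr nrm0 mulr_ge0 // nrm_ge0.
have D0 : 0 < nrm (F q - F p) by rewrite nrm_gt0 subr_eq0.
set D := F q - F p in D0 *.
pose u := (D^* / (nrm D)%:C)%C.
have nu : nrm u = 1.
  rewrite nrmM nrmV nrmR ger0_norm ?nrm_ge0 //.
  have -> : nrm (D^*)%C = nrm D by apply: complexI; rewrite -!normE normcJ.
  by rewrite divff // gt_eqF.
have uD : complex.Re (u * D) = nrm D.
  have -> : u * D = (nrm D)%:C.
    have n0 : (nrm D)%:C != 0 by rewrite -normE normr_eq0 -nrm_eq0 gt_eqF.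
    rewrite /u mulrAC [X in X / _]mulrC -sqr_normc normE expr2 mulfK //.
  by [].
clearbody u.
pose g (s : R) := complex.Re (u * F (p + s%:C * (q - p))).
pose g' (s : R) := complex.Re (u * F' (p + s%:C * (q - p)) * (q - p)).
have [c c01 E] : exists2 c, 0 <= c <= 1 & g 1 - g 0 = g' c.
  by apply: mvt01 => s h; apply: is_derive_path; apply: dF.
have : g 1 - g 0 = nrm D.
  have E1 : p + 1%:C * (q - p) = q by rewrite mul1r addrC subrK.
  have E0 : p + 0%:C * (q - p) = p by rewrite mul0r addr0.
  by rewrite /g E1 E0 -raddfB /= -mulrBr; exact: uD.
rewrite E => <-; apply: (le_trans (ler_norm _)).
apply: (le_trans (Re_le _)); rewrite /g' !nrmM nu mul1r ler_wpM2r ?nrm_ge0 //.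
exact: FM.
Qed.

Lemma is_derive0_segment (F : C -> C) (p q : C) :
  (forall t : R, 0 <= t <= 1 -> is_derive (p + t%:C * (q - p)) 1 F 0) -> F q = F p.
Proof.
move=> dF; have := @mvt_ineq F (fun=> 0) p q 0 dF.
rewrite nrm0 mul0r => /(_ (fun _ _ => lexx _)) h.
by apply/eqP; rewrite -subr_eq0 -nrm_eq0 eq_le h nrm_ge0.
Qed.

(** A countable set has Lebesgue measure 0, the unit interval has not. *)
Lemma countable_avoid (A : set R) : countable A -> exists t, ~ A t.
Proof.
move=> cA; apply: contrapT => h.
have At : A = setT.
  by apply/seteqP; split=> // t _; apply: contrapT => nA; apply: h; exists t.
have c01 : countable (`[0%R, 1%R]%classic : set R).
  by apply: sub_countable cA; apply: subset_card_le; rewrite At.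
have := countable_lebesgue_measure0 c01.
rewrite lebesgue_measure_itv /= lte_fin ltr01 oppr0 adde0 => /eqP.
by rewrite eqe oner_eq0.
Qed.

(** A detour p, p + w (1/2 + i t), q around G exists since each point of G
    blocks at most one value of t. *)
Lemma const_off_countable (G : set C) (F : C -> C) (p q : C) : countable G ->
  (forall z, ~ G z -> is_derive z 1 F 0) -> ~ G p -> ~ G q -> F p = F q.
Proof.
move=> cG dF Gp Gq; have [->//|pq] := eqVneq p q.
pose w := q - p; have w0 : w != 0 by rewrite subr_eq0 eq_sym.
pose f1 (g : C) : R := let u := (g - p) / w in complex.Im u / (2 * complex.Re u).
pose f2 (g : C) : R := let u := (g - q) / w in - complex.Im u / (2 * complex.Re u).
have [t ht] : exists t, ~ (f1 @` G `|` f2 @` G) t.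
  apply: countable_avoid.
  have -> : f1 @` G `|` f2 @` G = \bigcup_(b in [set: bool]) ((if b then f1 else f2) @` G).
    apply/seteqP; split=> [t [h|h]|t [[] _ h]]; [by exists true|by exists false|by left|by right].
  by apply: bigcup_countable => // b _; apply: sub_countable (card_image_le _ _) cG.
pose r := p + w * ((1 / 2) +i* t).
have E1 (s : R) : 0 <= s <= 1 -> ~ G (p + s%:C * (r - p)).
  move=> s01 Gs; have [s0|s0] := eqVneq s 0.
    by move: Gs; rewrite s0 mul0r addr0.
  apply: ht; left; exists (p + s%:C * (r - p)) => //; rewrite /f1.
  have -> : (p + s%:C * (r - p) - p) / w = s%:C * ((1 / 2) +i* t).
    by rewrite /r; field.
  by rewrite /= !mul0r subr0 addr0; field.
have E2 (s : R) : 0 <= s <= 1 -> ~ G (q + s%:C * (r - q)).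
  move=> s01 Gs; have [s0|s0] := eqVneq s 0.
    by move: Gs; rewrite s0 mul0r addr0.
  apply: ht; right; exists (q + s%:C * (r - q)) => //; rewrite /f2.
  have -> : (q + s%:C * (r - q) - q) / w = s%:C * ((1 / 2) +i* t - 1).
    have -> : q = p + w by rewrite /w addrC subrK.
    by rewrite /r; field.
  have -> : (1 / 2 +i* t) - 1 = (- (1 / 2)) +i* t.
    by apply/eqP; rewrite eq_complex /= subr0 eqxx andbT; apply/eqP; field.
  by rewrite /= !mul0r subr0 addr0; field.
have r1 : F r = F p by apply: is_derive0_segment => s s01; apply: dF; apply: E1.
have r2 : F r = F q by apply: is_derive0_segment => s s01; apply: dF; apply: E2.
by rewrite -r1 r2.
Qed.

(** Rules stated for explicit lambda terms, so that dv_rec can apply them by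
    recursion on the expression to be differentiated. *)
Section Rules.
Variable V : normedModType C.
Implicit Types (f g : V -> C) (z v : V) (a b : C).

Lemma dv_eq f z v a b : is_derive z v f a -> a = b -> is_derive z v f b.
Proof. by move=> h <-. Qed.

Lemma dv_unique f z v a b : is_derive z v f a -> is_derive z v f b -> a = b.
Proof. by move=> [_ <-] [_ <-]. Qed.

Lemma dv_cst c z v : is_derive z v (fun _ : V => c) (0 : C).
Proof. exact: is_derive_cst. Qed.

Lemma dvD f g z v a b : is_derive z v f a -> is_derive z v g b ->
  is_derive z v (fun x => f x + g x) (a + b).
Proof. by move=> h1 h2; apply: is_deriveD. Qed.

Lemma dvN f z v a : is_derive z v f a -> is_derive z v (fun x => - f x) (- a).
Proof. by move=> h1; apply: is_deriveN. Qed.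

Lemma dvM f g z v a b : is_derive z v f a -> is_derive z v g b ->
  is_derive z v (fun x => f x * g x) (a * g z + f z * b).
Proof.
move=> h1 h2.
have H : is_derive z v (fun x => f x * g x) (f z *: b + g z *: a) := is_deriveM h1 h2.
by apply: (dv_eq H); rewrite addrC [X in X + _]mulrC.
Qed.

Lemma dvX f z v a n : is_derive z v f a ->
  is_derive z v (fun x => f x ^+ n.+1) (n.+1%:R * f z ^+ n * a).
Proof.
move=> h; elim: n => [|n IH].
  have -> : (fun x => f x ^+ 1) = f by apply/funext => x; rewrite expr1.
  by rewrite mul1r expr0 mul1r.
have -> : (fun x => f x ^+ n.+2) = (fun x => f x * f x ^+ n.+1).
  by apply/funext => x; rewrite exprS.
by apply: (dv_eq (dvM h IH)); rewrite [n.+2%:R]mulrS exprS; ring.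
Qed.

Lemma dvV f z v a : f z != 0 -> is_derive z v f a ->
  is_derive z v (fun x => (f x)^-1) (- (f z) ^- 2 * a).
Proof.
move=> f0 h; case: (h) => h1 h2; apply: DeriveDef; first exact: derivableV.
by rewrite deriveV // h2.
Qed.

Lemma dv_comp (f : C -> C) g z v a b : is_derive (g z) 1 f a -> is_derive z v g b ->
  is_derive z v (fun x => f (g x)) (a * b).
Proof.
move=> /is_derive_eps hf /is_derive_epsP hg; apply/is_derive_epsP => e e0.
pose k := nrm a + nrm b + 1.
have k0 : 0 < k by rewrite /k; have := nrm_ge0 a; have := nrm_ge0 b; lra.
pose m := Num.min 1 (e / 2 / k).
have m0 : 0 < m by rewrite lt_min ltr01 !divr_gt0.
have mk : m * k <= e / 2 by rewrite -ler_pdivlMr // ge_min lexx orbT.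
have [d1 d10 h1] := hf _ m0; have [d2 d20 h2] := hg _ m0.
exists (Num.min d2 (d1 / k)) => [|h]; first by rewrite lt_min d20 divr_gt0.
rewrite lt_min => /andP[hd2 hd1].
have := h2 h hd2; set w := g (h *: v + z) - g z => hw.
have m1 : m <= 1 by rewrite ge_min lexx.
have nw : nrm w <= k * nrm h.
  have -> : w = (w - b * h) + b * h by rewrite subrK.
  apply: (le_trans (nrmD _ _)); rewrite nrmM.
  have := nrm_ge0 h => h0.
  have : m * nrm h <= 1 * nrm h by rewrite ler_wpM2r.
  have : 0 <= nrm a * nrm h by rewrite mulr_ge0 // nrm_ge0.
  by rewrite /k !mulrDl; lra.
have wd : nrm w < d1.
  by apply: le_lt_trans nw _; move: hd1; rewrite ltr_pdivlMr // mulrC.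
have -> : g (h *: v + z) = g z + w by rewrite /w; ring.
have -> : f (g z + w) - f (g z) - a * b * h = (f (g z + w) - f (g z) - a * w) + a * (w - b * h).
  by ring.
apply: (le_trans (nrmD _ _)); rewrite nrmM.
have := h1 w wd => H1.
have E1 : m * nrm w <= e / 2 * nrm h.
  apply: (@le_trans _ _ (m * (k * nrm h))); first by rewrite ler_wpM2l // ltW.
  by rewrite mulrA ler_wpM2r // nrm_ge0.
have E2 : nrm a * nrm (w - b * h) <= e / 2 * nrm h.
  apply: (@le_trans _ _ (nrm a * (m * nrm h))); first by rewrite ler_wpM2l // nrm_ge0.
  rewrite mulrA ler_wpM2r ?nrm_ge0 // mulrC; apply: le_trans mk.
  by rewrite ler_wpM2l ?(ltW m0) // /k; have := nrm_ge0 b; lra.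
have -> : e * nrm h = e / 2 * nrm h + e / 2 * nrm h by field.
lra.
Qed.

End Rules.

Lemma dv_id (z : C) : is_derive z 1 (fun x : C => x) (1 : C).
Proof. exact: is_derive_id. Qed.

Lemma dv_ext (f g : C -> C) (z a : C) (d : R) : 0 < d ->
  (forall h, nrm h < d -> f (z + h) = g (z + h)) -> is_derive z 1 f a -> is_derive z 1 g a.
Proof.
move=> d0 fg /is_derive_eps H; apply/is_derive_eps => e /H[d' d'0 hd].
exists (Num.min d d') => [|h]; first by rewrite lt_min d0.
rewrite lt_min => /andP[h1 h2]; rewrite -fg //.
have -> : g z = f z by rewrite -[z]addr0 fg // nrm0.
exact: hd.
Qed.

Lemma dv_cont (f : C -> C) (z a : C) : is_derive z 1 f a -> {for z, continuous f}.
Proof.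
by case=> [h _]; apply: differentiable_continuous; apply/derivable1_diffP.
Qed.

End Calculus.

(** The tactic leaf differentiates the atoms; dv_by leaves the equality between
    the derivative computed by the rules and the one announced. *)
Ltac dv_rec leaf := first
  [ notypeclasses refine (dv_id _)
  | notypeclasses refine (dv_cst _ _ _)
  | leaf
  | notypeclasses refine (dvD _ _); dv_rec leaf
  | notypeclasses refine (dvN _); dv_rec leaf
  | notypeclasses refine (dvM _ _); dv_rec leaf
  | notypeclasses refine (dvX _ _); dv_rec leaf
  | notypeclasses refine (dvV _ _); [cbv beta; assumption | dv_rec leaf] ].
Ltac dv_by leaf := notypeclasses refine (dv_eq _ _); [dv_rec leaf | cbv beta].

(** * Two summable majorants *)

Section Families.
Variable R : realType.
Local Notation C := R[i].

Lemma hassum_ge_psum (I : choiceType) (g : I -> R) (s : C) : (forall i, 0 <= g i) ->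
  hassum (fun i => (g i)%:C) s -> forall A : {fset I}, \sum_(i <- A) g i <= nrm s.
Proof.
move=> g0 /hassumP H A; apply/ler_addgt0Pr => e e0.
have [A0 hA0] := H e e0.
have := hA0 (A `|` A0)%fset (fsubsetUr _ _).
have := fsub_sum g0 (fsubsetUl A A0); rewrite -rmorph_sum /=.
set S := \sum_(i <- _) g i; set T := \sum_(i <- (A `|` A0)%fset) _ => ST.
have T0 : 0 <= T by apply: sumr_ge0.
have := nrm_sub (T%:C) s; rewrite nrmB nrmR ger0_norm // nrmB; lra.
Qed.

Lemma absum_split (I I1 I2 : choiceType) (h1 : I1 -> I) (h2 : I2 -> I) (f : I -> C) :
  injective h1 -> injective h2 ->
  (forall i, (exists j, i = h1 j) \/ (exists k, i = h2 k)) ->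
  (forall j k, h1 j <> h2 k) ->
  absum (fun j => f (h1 j)) -> absum (fun k => f (h2 k)) -> absum f.
Proof.
move=> i1 i2 cov dis [M1 hM1] [M2 hM2].
have [s1 hs1] := hassum_nonneg (fun i => nrm_ge0 (f (h1 i))) hM1.
have [s2 hs2] := hassum_nonneg (fun i => nrm_ge0 (f (h2 i))) hM2.
have H := hassum_split (f := fun i => (nrm (f i))%:C) i1 i2 cov dis hs1 hs2.
exists (nrm (s1%:C + s2%:C)) => A; apply: hassum_ge_psum H A => i; exact: nrm_ge0.
Qed.

Lemma absum_int_split (J : choiceType) (f : int * J -> C) :
  absum (fun p : nat * J => f (Posz p.1, p.2)) ->
  absum (fun p : nat * J => f (Negz p.1, p.2)) -> absum f.
Proof.
apply: (@absum_split _ _ _ (fun p : nat * J => (Posz p.1, p.2)) (fun p : nat * J => (Negz p.1, p.2))).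
- by move=> [a b] [c d] /= [-> ->].
- by move=> [a b] [c d] /= [-> ->].
- by move=> [[n|n] j]; [left|right]; exists (n, j).
- by move=> [a b] [c d].
Qed.

(** Telescoping majorants: the sum of q3 (m + n) over n is at most q2 m, and the
    sum of q2 is at most 1. *)
Definition q2 (n : nat) : R := (n.+1%:R * n.+2%:R)^-1.
Definition q3 (n : nat) : R := (n.+1%:R * n.+2%:R * n.+3%:R)^-1.

Lemma q2_ge0 n : 0 <= q2 n.
Proof. by rewrite /q2 invr_ge0 mulr_ge0. Qed.

Lemma q3_ge0 n : 0 <= q3 n.
Proof. by rewrite /q3 invr_ge0 !mulr_ge0. Qed.

Lemma sum_q2 (N : nat) : \sum_(0 <= i < N) q2 i <= 1.
Proof.
suff -> : \sum_(0 <= i < N) q2 i = 1 - (N.+1%:R)^-1 by rewrite gerBl invr_ge0.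
elim: N => [|N IH]; first by rewrite big_geq // invr1 subrr.
rewrite big_nat_recr //= IH /q2.
have h1 : N%:R + 1 != 0 :> R by rewrite gt_eqF // ltr_wpDl.
have h2 : N%:R + 2 != 0 :> R by rewrite gt_eqF // ltr_wpDl.
have -> : N.+1%:R = N%:R + 1 :> R by rewrite -natr1.
have -> : N.+2%:R = N%:R + 2 :> R by rewrite -addn2 natrD.
by field; rewrite h1 h2.
Qed.

Lemma sum_q3 (m N : nat) : \sum_(0 <= i < N) q3 (m + i) <= q2 m.
Proof.
suff : \sum_(0 <= i < N) q3 (m + i) = 2^-1 * (q2 m - q2 (m + N)).
  move=> ->; have := q2_ge0 m; have := q2_ge0 (m + N); lra.
elim: N => [|N IH]; first by rewrite big_geq // addn0 subrr mulr0.
rewrite big_nat_recr //= IH /q2 /q3 addnS.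
clear IH; set k := (m + N)%N; clearbody k.
have h1 : k%:R + 1 != 0 :> R by rewrite gt_eqF // ltr_wpDl.
have h2 : k%:R + 2 != 0 :> R by rewrite gt_eqF // ltr_wpDl.
have h3 : k%:R + 3 != 0 :> R by rewrite gt_eqF // ltr_wpDl.
have h4 : m%:R + 1 != 0 :> R by rewrite gt_eqF // ltr_wpDl.
have h5 : m%:R + 2 != 0 :> R by rewrite gt_eqF // ltr_wpDl.
have e1 n : n.+1%:R = n%:R + 1 :> R by rewrite -natr1.
have e2 n : n.+2%:R = n%:R + 2 :> R by rewrite -addn2 natrD.
have e3 n : n.+3%:R = n%:R + 3 :> R by rewrite -addn3 natrD.
by rewrite (e1 m) (e2 m) (e1 k) (e2 k) (e3 k); field; rewrite ?h1 ?h2 ?h3 ?h4 ?h5.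
Qed.

Lemma fset_nat_sub (A : {fset nat}) : exists N, (A `<=` [fset i in iota 0 N])%fset.
Proof.
exists (\max_(i <- A) i).+1; apply/fsubsetP => i iA.
by rewrite !inE mem_iota /= ltnS; case: i iA => // i iA; rewrite /= leq_bigmax_seq.
Qed.

Lemma sum_iota (N : nat) (g : nat -> R) :
  \sum_(i <- [fset i in iota 0 N]%fset) g i = \sum_(0 <= i < N) g i.
Proof.
rewrite /index_iota subn0; apply: perm_big; apply: uniq_perm; first exact: fset_uniq.
  exact: iota_uniq.
by move=> i; rewrite !inE.
Qed.

Lemma absum_q2 : absum (fun n : int => (q2 `|n|%N)%:C).
Proof.
have P : absum (fun n : nat => (q2 n)%:C).
  exists 1 => A; have [N AN] := fset_nat_sub A.
  under eq_bigr => i _ do rewrite nrmR ger0_norm ?q2_ge0 //.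
  by apply: le_trans (fsub_sum q2_ge0 AN) _; rewrite sum_iota sum_q2.
apply: (@absum_split _ _ _ Posz Negz).
- by move=> a b [].
- by move=> a b [].
- by move=> [n|n]; [left|right]; exists n.
- by [].
- exact: P.
- by have := absum_inj (h := S) (fun a b => @succn_inj a b) P.
Qed.

(** Each quadrant of the integer plane is indexed by pairs of natural numbers,
    over which the double sum telescopes twice. *)
Lemma absum_q3 : absum (fun p : int * int => (q3 (`|p.1| + `|p.2|)%N)%:C).
Proof.
have P : absum (fun p : nat * nat => (q3 (p.1 + p.2))%:C).
  exists 1 => A.
  have [N1 A1] := fset_nat_sub [fset p.1 | p in A]%fset.
  have [N2 A2] := fset_nat_sub [fset p.2 | p in A]%fset.
  have sub : (A `<=` [fset i in iota 0 N1] `*` [fset i in iota 0 N2])%fset.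
    apply/fsubsetP => p pA; rewrite in_fsetM; apply/andP; split.
      by apply: (fsubsetP A1); apply/imfsetP; exists p.
    by apply: (fsubsetP A2); apply/imfsetP; exists p.
  under eq_bigr => i _ do rewrite nrmR ger0_norm ?q3_ge0 //.
  apply: le_trans (fsub_sum (g := fun p : nat * nat => q3 (p.1 + p.2)) _ sub) _.
    by move=> p; apply: q3_ge0.
  rewrite big_fset_prod /= (le_trans _ (sum_q2 N1)) // -sum_iota ler_sum // => i _.
  by rewrite sum_iota sum_q3.
have Q (h1 h2 : nat -> nat) : (h1 = id \/ h1 = S) -> (h2 = id \/ h2 = S) ->
    absum (fun p : nat * nat => (q3 (h1 p.1 + h2 p.2))%:C).
  move=> H1 H2; apply: (absum_inj (h := fun p : nat * nat => (h1 p.1, h2 p.2)) _ P).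
  move=> [a b] [c d] /= [].
  by case: H1 => ->; case: H2 => -> /=;
    first [move=> -> -> | move=> -> [->] | move=> [->] -> | move=> [->] [->]].
have sw (J J' : choiceType) (f : J * J' -> C) : absum (fun p => f (p.2, p.1)) -> absum f.
  move=> h; have := absum_inj (h := fun p : J * J' => (p.2, p.1)) _ h => /(_ _)/wrap[].
    by move=> [a b] [c d] /= [-> ->].
  by congr absum; apply/funext => -[].
apply: absum_int_split; apply: (sw); apply: absum_int_split => /=; apply: (sw) => /=.
- exact: (Q id id (or_introl erefl) (or_introl erefl)).
- exact: (Q id S (or_introl erefl) (or_intror erefl)).
- exact: (Q S id (or_intror erefl) (or_introl erefl)).
- exact: (Q S S (or_intror erefl) (or_intror erefl)).
Qed.

End Families.

(** * The exponential function *)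

Section Exponential.
Variable R : realType.
Local Notation C := R[i].
Implicit Types (w z : C).

Lemma cexpD w z : cexp (w + z) = cexp w * cexp z.
Proof.
rewrite /cexp raddfD /= raddfD /= expRD cosD sinD rmorphM /=.
rewrite mulrACA; congr (_ * _).
by apply/eqP; rewrite eq_complex /= eqxx /= addrC.
Qed.

Lemma cexp0 : cexp (0 : C) = 1.
Proof. by rewrite /cexp /= expR0 cos0 sin0 mul1r. Qed.

Lemma nrm_cexp w : nrm (cexp w) = expR (complex.Re w).
Proof.
rewrite /cexp nrmM nrmR ger0_norm ?expR_ge0 //=.
by rewrite cos2Dsin2 sqrtr1 mulr1.
Qed.

Lemma cexp_neq0 w : cexp w != 0.
Proof. by rewrite -nrm_gt0 nrm_cexp expR_gt0. Qed.

Lemma cexpN w : cexp (- w) = (cexp w)^-1.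
Proof. by apply: (mulfI (cexp_neq0 w)); rewrite -cexpD subrr cexp0 divff // cexp_neq0. Qed.

Lemma cexp_ipi : cexp ((pi : R)%:C * 'i) = -1.
Proof.
rewrite /cexp; have -> : (pi : R)%:C * 'i = 0 +i* (pi : R).
  by rewrite -complexiE; apply/eqP; rewrite eq_complex /= !mulr0 !mul0r mulr1 subr0 addr0 !eqxx.
rewrite /= expR0 mul1r cospi sinpi.
by apply/eqP; rewrite eq_complex /= oppr0 !eqxx.
Qed.

Lemma real_mvt0 (g g' : R -> R) (v : R) : (forall x : R, is_derive x 1 g (g' x)) ->
  exists2 c, `|c| <= `|v| & g v - g 0 = g' c * v.
Proof.
move=> dg.
have gc (a b : R) : {within `[a, b], continuous g}.
  by apply: derivable_within_continuous => s _; have [] := dg s.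
have dg' (a b s : R) : s \in `]a, b[%R -> is_derive s 1 g (g' s) by move=> _; apply: dg.
have [v0|v0] := leP 0 v.
  have [c] := @MVT_segment R g g' 0 v v0 (dg' 0 v) (gc 0 v).
  rewrite in_itv /= subr0 => /andP[c0 cv] E; exists c => //.
  by rewrite !ger0_norm.
have [c] := @MVT_segment R g g' v 0 (ltW v0) (dg' v 0) (gc v 0).
rewrite in_itv /= => /andP[c0 cv] E; exists c.
  by rewrite !ler0_norm // ?lerN2 // ltW.
by rewrite -opprB E sub0r mulrN opprK.
Qed.

Lemma sin_le_abs (v : R) : `|sin v| <= `|v|.
Proof.
have [c _] := @real_mvt0 sin cos v (fun x => is_derive_sin x).
by rewrite sin0 subr0 => ->; rewrite normrM ler_piMl // cos_max.
Qed.

Lemma cos_sub1_le (v : R) : `|cos v - 1| <= v ^+ 2.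
Proof.
have [c cv] := @real_mvt0 cos (fun x => - sin x) v (fun x => is_derive_cos x).
rewrite cos0 => ->; rewrite normrM normrN -[leRHS]ger0_norm ?sqr_ge0 // expr2 normrM ler_wpM2r //.
by apply: le_trans cv; apply: sin_le_abs.
Qed.

Lemma sin_sub_le (v : R) : `|sin v - v| <= v ^+ 2.
Proof.
have [c cv] := @real_mvt0 sin cos v (fun x => is_derive_sin x).
rewrite sin0 subr0 => ->; rewrite -[X in _ - X]mul1r -mulrBl normrM -[leRHS]ger0_norm ?sqr_ge0 //.
rewrite expr2 normrM ler_wpM2r //; apply: le_trans cv.
have [d dc] := @real_mvt0 cos (fun x => - sin x) c (fun x => is_derive_cos x).
by rewrite cos0 => ->; rewrite normrM normrN ler_piMl // sin_max.
Qed.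

Lemma expR_sub1_le (u : R) : `|expR u - 1| <= `|u| * expR `|u|.
Proof.
have h1 := expR_ge1Dx u; have h2 := expR_ge1Dx (- u).
have e0 := expR_gt0 u.
have h3 : expR u - 1 <= u * expR u.
  have : expR u * (1 - u) <= expR u * expR (- u) by rewrite ler_wpM2l // ltW.
  by rewrite expRN divff ?gt_eqF //; lra.
have [u0|u0] := leP 0 u.
  by rewrite (ger0_norm u0) ger0_norm //; lra.
rewrite (ltr0_norm u0) ler0_norm; last first.
  by have : expR u < 1; [rewrite expR_lt1|lra].
apply: (@le_trans _ _ (- u)); first lra.
rewrite ler_peMr ?oppr_ge0 ?(ltW u0) //.
by rewrite -expR0 ler_expR oppr_ge0 ltW.
Qed.

Lemma expR_sub1x_le (u : R) : `|expR u - 1 - u| <= u ^+ 2 * expR `|u|.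
Proof.
have h1 := expR_ge1Dx u; have h2 := expR_ge1Dx (- u).
have e0 := expR_gt0 u.
have h3 : expR u - 1 <= u * expR u.
  have : expR u * (1 - u) <= expR u * expR (- u) by rewrite ler_wpM2l // ltW.
  by rewrite expRN divff ?gt_eqF //; lra.
rewrite ger0_norm; last lra.
apply: (@le_trans _ _ (u * (expR u - 1))); first by rewrite mulrBr; lra.
apply: (le_trans (ler_norm _)); rewrite normrM.
have -> : u ^+ 2 = `|u| * `|u| by rewrite -normrM -expr2 ger0_norm ?sqr_ge0.
by rewrite -mulrA ler_wpM2l // expR_sub1_le.
Qed.

Lemma cexp_quad w : nrm (cexp w - 1 - w) <= 4 * nrm w ^+ 2 * expR (nrm w).
Proof.
have hr := Re_le w; have hi := Im_le w; have n0 := nrm_ge0 w.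
move: (nrm w) hr hi n0 => n; case: w => u v hu hv n0; rewrite /= in hu hv.
have -> : cexp (u +i* v) - 1 - (u +i* v) = (expR u - 1 - u)%:C + (expR u * (cos v - 1))%:C
   + 'i%C * ((expR u - 1) * sin v)%:C + 'i%C * (sin v - v)%:C.
  apply/eqP; rewrite eq_complex /cexp /= !mul0r !mul1r !subr0 !addr0 !add0r.
  by apply/andP; split; apply/eqP; ring.
have e1 : 1 <= expR n by rewrite -expR0 ler_expR.
have eu : expR `|u| <= expR n by rewrite ler_expR.
have u2 : u ^+ 2 <= n ^+ 2 by rewrite -real_normK ?num_real // lerXn2r // nnegrE.
have v2 : v ^+ 2 <= n ^+ 2 by rewrite -real_normK ?num_real // lerXn2r // nnegrE.
have n2 : 0 <= n ^+ 2 by rewrite sqr_ge0.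
have ni : nrm ('i%C : C) = 1 by rewrite /= expr0n expr1n /= add0r sqrtr1.
have t1 : nrm (expR u - 1 - u)%:C <= n ^+ 2 * expR n.
  by rewrite nrmR (le_trans (expR_sub1x_le _)) // ler_pM // ?sqr_ge0 ?expR_ge0.
have t2 : nrm (expR u * (cos v - 1))%:C <= n ^+ 2 * expR n.
  rewrite nrmR normrM mulrC ler_pM //; first by rewrite (le_trans (cos_sub1_le _)).
  by rewrite ger0_norm ?expR_ge0 // ler_expR (le_trans (ler_norm _)).
have t3 : nrm ('i%C * ((expR u - 1) * sin v)%:C) <= n ^+ 2 * expR n.
  rewrite nrmM ni mul1r nrmR normrM.
  apply: (@le_trans _ _ (`|u| * expR `|u| * `|v|)).
    by rewrite ler_pM // ?expR_sub1_le // sin_le_abs.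
  by rewrite mulrAC ler_pM ?mulr_ge0 ?expR_ge0 // expr2 ler_pM.
have t4 : nrm ('i%C * (sin v - v)%:C) <= n ^+ 2 * expR n.
  rewrite nrmM ni mul1r nrmR (le_trans (sin_sub_le _)) // (le_trans v2) //.
  by rewrite ler_peMr.
apply: (le_trans (nrmD _ _)); apply: (le_trans (lerD (nrmD _ _) (lexx _))).
apply: (le_trans (lerD (lerD (nrmD _ _) (lexx _)) (lexx _))).
by rewrite -mulrA; lra.
Qed.

(** (1 + a)^(k + 2) is at most (k + 2)! e^(1 + a), and completing the square
    bounds the total exponent 1 + a + B a - al a^2 by 1 + K. *)
Lemma gauss_decay (k : nat) (al B : R) : 0 < al -> 0 <= B ->
  exists2 M : R, 0 <= M & forall a, 0 <= a ->
    (1 + a) ^+ k * expR (- al * a ^+ 2 + B * a) <= M * (1 + a) ^- 2.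
Proof.
move=> al0 B0.
pose K := (B + 1) ^+ 2 / (4 * al).
exists (k.+2`!%:R * expR (1 + K)); first by rewrite mulr_ge0 // expR_ge0.
move=> a a0.
have a1 : 0 < (1 + a) ^+ 2 by rewrite exprn_gt0 // ltr_pwDl.
rewrite ler_pdivlMr //.
have f0 : 0 < k.+2`!%:R :> R by rewrite ltr0n fact_gt0.
have h2 : (1 + a) ^+ k * (1 + a) ^+ 2 <= k.+2`!%:R * expR (1 + a).
  rewrite -exprD addn2 mulrC -ler_pdivrMr // (le_trans _ (expR_ge1Dxn k.+1 _)) ?lerDr //.
  by rewrite addr_ge0.
rewrite mulrAC; apply: (@le_trans _ _ (k.+2`!%:R * expR (1 + a) * expR (- al * a ^+ 2 + B * a))).
  by rewrite ler_wpM2r // expR_ge0.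
rewrite -mulrA ler_wpM2l ?(ltW f0) // -expRD ler_expR -addrA lerD2l.
rewrite /K ler_pdivlMr ?mulr_gt0 //.
have := sqr_ge0 (2 * al * a - (B + 1)).
have -> : (2 * al * a - (B + 1)) ^+ 2 = (B + 1) ^+ 2 - (a + (- al * a ^+ 2 + B * a)) * (4 * al) by ring.
lra.
Qed.

End Exponential.

(** * Theta series and their differentiability *)

Local Opaque cexp.

(** The number pi i, locked so that rewriting with laws of the product leaves it
    alone. *)
HB.lock Definition pIR (R : realType) : R[i] := (pi : R)%:C * 'i.

Section ThetaSeries.
Variable R : realType.
Local Notation C := R[i].
Implicit Types (z tau : C) (n : int).

Local Notation pI := (pIR R).

Lemma pIE : pI = (pi : R)%:C * 'i.
Proof. by rewrite pIR.unlock. Qed.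

Lemma pI_neq0 : pI != 0.
Proof.
rewrite -nrm_eq0 pIE nrmM nrmi mulr1 nrmR normr_eq0 gt_eqF //; exact: pi_gt0.
Qed.

Lemma nrm_pI : nrm pI = pi.
Proof. by rewrite pIE nrmM nrmi mulr1 nrmR ger0_norm // ltW // pi_gt0. Qed.

Lemma cexp_pI : cexp pI = -1.
Proof. by rewrite pIE; exact: cexp_ipi. Qed.

Lemma Re_pIM (x : C) : complex.Re (pI * x) = - (pi * complex.Im x).
Proof. by rewrite pIE -complexiE; case: x => a b /=; ring. Qed.

Definition sgn (chi : bool) (n : int) : C := if chi then (-1) ^ n else 1.

Lemma nrm_sgn chi n : nrm (sgn chi n) = 1.
Proof.
rewrite /sgn; case: chi; last exact: nrm1.
case: n => n; first by rewrite -exprnP nrmX nrmN nrm1 expr1n.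
by rewrite NegzE -exprnN nrmV nrmX nrmN nrm1 expr1n invr1.
Qed.

Section Fixed.
Variables (chi : bool) (s : R).

(** The frequencies of a theta series with characteristic s. *)
Definition lam n : C := n%:~R + s%:C.

(** The k-th z-derivative of the n-th term of the theta series with
    characteristics chi and s; the sign (-1)^n is present when chi holds. *)
Definition tterm (k : nat) z tau n : C :=
  sgn chi n * (pI * lam n) ^+ k * cexp (pI * lam n ^+ 2 * tau + pI * lam n * z).

Definition thk (k : nat) z tau : C := summability.sum (tterm k z tau).

Let a n : R := `|n%:~R + s|.

Lemma nrm_lam n : nrm (lam n) = a n.
Proof. by rewrite /lam -(rmorph_int (real_complex R)) -rmorphD nrmR. Qed.

Lemma lamE n : lam n = (n%:~R + s)%:C.
Proof. by rewrite /lam -(rmorph_int (real_complex R)) -rmorphD. Qed.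

Lemma tterm_le k z tau n : nrm (tterm k z tau n) <=
  pi ^+ k * ((1 + a n) ^+ k * expR (- (pi * complex.Im tau) * a n ^+ 2 + pi * nrm z * a n)).
Proof.
have pi0 := @pi_ge0 R; have a0 : 0 <= a n by rewrite /a.
rewrite /tterm; set w := pI * _ * tau + _; have hE := nrm_cexp w.
move: (cexp w) hE => E hE.
rewrite !nrmM hE nrm_sgn mul1r nrmX nrmM nrm_pI nrm_lam exprMn -!mulrA.
rewrite ler_wpM2l ?exprn_ge0 // ler_pM ?exprn_ge0 ?expR_ge0 //.
  by rewrite lerXn2r ?nnegrE ?addr_ge0 // lerDr.
have -> : complex.Re w = - (pi * complex.Im (lam n ^+ 2 * tau)) - pi * complex.Im (lam n * z).
  by rewrite /w -!mulrA raddfD /= !Re_pIM.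
rewrite ler_expR lerD //.
  clear hE; clear E w; rewrite lamE; case: tau => u v /=.
  have -> : a n ^+ 2 = (n%:~R + s) ^+ 2 by rewrite /a real_normK ?num_real.
  by rewrite le_eqVlt; apply/orP; left; apply/eqP; rewrite expr2 /=; ring.
rewrite mulrA -mulrN -mulrA ler_wpM2l // (le_trans (ler_norm _)) // normrN.
by rewrite (le_trans (Im_le _)) // nrmM nrm_lam mulrC.
Qed.

Lemma gauss_q2 (m : nat) (al B : R) : 0 < al -> 0 <= B ->
  exists2 M : R, 0 <= M & forall n,
    (1 + a n) ^+ m * expR (- al * a n ^+ 2 + B * a n) <= M * q2 R `|n|%N.
Proof.
move=> al0 B0; have [M M0 hM] := gauss_decay m al0 B0.
exists (M * (`|s| + 2) ^+ 2) => [|n]; first by rewrite mulr_ge0 // sqr_ge0.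
have a0 : 0 <= a n by rewrite /a.
apply: (le_trans (hM (a n) a0)); rewrite -mulrA ler_wpM2l // /q2.
have na : `|n|%N%:R <= a n + `|s|.
  have -> : `|n|%N%:R = `|n%:~R| :> R by rewrite -intr_norm pmulrn abszE.
  by have := ler_normB (n%:~R + s) s; rewrite addrK /a.
rewrite ler_pdivlMr ?mulr_gt0 ?ltr0n // mulrC ler_pdivrMr ?exprn_gt0 ?ltr_pwDl //.
have -> : `|n|%N.+1%:R = `|n|%N%:R + 1 :> R by rewrite -natr1.
have -> : `|n|%N.+2%:R = `|n|%N%:R + 2 :> R by rewrite -addn2 natrD.
have s0 : 0 <= `|s| by [].
have n0 : 0 <= `|n|%N%:R :> R by rewrite ler0n.
rewrite -exprMn expr2 ler_pM ?addr_ge0 //; nra.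
Qed.

Lemma absum_q2Z (M : R) : absum (fun n : int => (M * q2 R `|n|%N)%:C).
Proof.
have [N hN] := absum_q2 R; exists (`|M| * N) => A.
apply: (@le_trans _ _ (`|M| * \sum_(i <- A) nrm (q2 R `|i|%N)%:C)); last by rewrite ler_wpM2l.
by rewrite big_distrr; apply: ler_sum => i _; rewrite !nrmR normrM.
Qed.

Lemma absum_tterm k z tau : 0 < complex.Im tau -> absum (tterm k z tau).
Proof.
move=> t0; have pi0 := @pi_gt0 R.
have [M M0 hM] := gauss_q2 k (mulr_gt0 pi0 t0) (mulr_ge0 (ltW pi0) (nrm_ge0 z)).
apply: (absum_dom (c := 1) (absum_q2Z (pi ^+ k * M))) => n.
rewrite mul1r nrmR ger0_norm; last by rewrite !mulr_ge0 ?exprn_ge0 ?q2_ge0 // ltW.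
by apply: (le_trans (tterm_le _ _ _ _)); rewrite -[leRHS]mulrA ler_wpM2l // exprn_ge0 // ltW.
Qed.

Lemma thk_hassum k z tau : 0 < complex.Im tau -> hassum (tterm k z tau) (thk k z tau).
Proof. by move=> t0; apply: absum_hassum; apply: absum_tterm. Qed.

Lemma tterm_shift k z tau n w v :
  tterm k (z + w) (tau + v) n = tterm k z tau n * cexp (pI * lam n ^+ 2 * v + pI * lam n * w).
Proof.
rewrite /tterm -[RHS]mulrA -cexpD.
by congr (_ * cexp _); ring.
Qed.

(** The heat equation for one term: a variation v of tau acts as (pi i)^-1 v
    times the second z-derivative. *)
Lemma tterm_lin k z tau n w v :
  (pI * lam n ^+ 2 * v + pI * lam n * w) * tterm k z tau n =
  tterm k.+1 z tau n * w + tterm k.+2 z tau n * (pI^-1 * v).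
Proof.
rewrite /tterm; set E := cexp _; rewrite !exprS; have := pI_neq0.
by move: (pI) (lam n) E => p l E p0; field.
Qed.

Section Diff.
Variables (V : normedModType C) (Z T : {linear V -> C}) (z0 t0 : C) (K : R).
Hypothesis K0 : 0 < K.
Hypothesis ZK : forall h, nrm (Z h) <= K * vnrm h.
Hypothesis TK : forall h, nrm (T h) <= K * vnrm h.

(** The arguments (z, tau) depend affinely on a parameter in V, with linear parts
    Z and T; this covers the derivative in z, in tau, and in both. Each term of
    the remainder is the term of the series times e^w - 1 - w, with w linear in
    the increment, and the Gaussian decay absorbs both |w|^2 and e^|w|. *)
Lemma thk_diff k (x : V) : 0 < complex.Im (T x + t0) ->
  let F y := thk k (Z y + z0) (T y + t0) in
  differentiable F x /\ forall v, is_derive x v F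
    (thk k.+1 (Z x + z0) (T x + t0) * Z v + thk k.+2 (Z x + z0) (T x + t0) * (pI^-1 * T v)).
Proof.
move=> tx F; set z := Z x + z0; set tau := T x + t0 in tx *.
set t := complex.Im tau in tx; have pi0 := @pi_gt0 R.
pose L := [the {linear V -> C} of
  (thk k.+1 z tau) \*: Z \+ (thk k.+2 z tau / pI) \*: T].
have LE h : L h = thk k.+1 z tau * Z h + thk k.+2 z tau * (pI^-1 * T h).
  by rewrite mulrA.
have al0 : 0 < pi * t / 2 by rewrite !mulr_gt0.
have B0 : 0 <= pi * nrm z + pi * t / 2.
  by rewrite addr_ge0 ?mulr_ge0 ?nrm_ge0 ?ltW.
have [M M0 hM] := gauss_q2 (k + 4) al0 B0.
have [N hN] := absum_q2 R.
have r0 : 0 < t / 2 / K by rewrite !divr_gt0.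
pose LK := nrm (thk k.+1 z tau) * K + nrm (thk k.+2 z tau / pI) * K.
have [||D1 D2] := @diff_quad R V F x L LK (pi ^+ k * 4 * pi ^+ 2 * K ^+ 2 * M * N) (t / 2 / K) r0.
- move=> h; rewrite LE; apply: (le_trans (nrmD _ _)); rewrite mulrA [nrm (_ * Z h)]nrmM [nrm (_ * T h)]nrmM /LK mulrDl lerD //.
    by rewrite -mulrA ler_wpM2l ?nrm_ge0.
  by rewrite -mulrA ler_wpM2l ?nrm_ge0.
- move=> h; rewrite ltr_pdivlMr // => hr.
  have h0 := vnrm_ge0 h.
  have th : nrm (T h) < t / 2 by apply: le_lt_trans hr; rewrite mulrC.
  have tx' : 0 < complex.Im (tau + T h).
    rewrite raddfD /=; have := Im_le (T h); rewrite ler_norml -/t => /andP[]; lra.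
  have FE : F (h + x) = thk k (z + Z h) (tau + T h).
    by rewrite /F !linearD [Z h + _]addrC [T h + _]addrC (addrAC (Z x)) (addrAC (T x)).
  rewrite FE LE.
  have H1 := thk_hassum k (z + Z h) tx'; have H2 := thk_hassum k z tx.
  have H3 := hassumD (hassumMr (Z h) (thk_hassum k.+1 z tx))
                     (hassumMr (pI^-1 * T h) (thk_hassum k.+2 z tx)).
  have H := hassumB (hassumB H1 H2) H3.
  apply: (hassum_nrm H) => A.
  apply: (@le_trans _ _ (\sum_(n <- A) (pi ^+ k * 4 * pi ^+ 2 * K ^+ 2 * M * vnrm h ^+ 2) * nrm (q2 R `|n|%N)%:C)).
    apply: ler_sum => n _; rewrite -tterm_lin tterm_shift.
    set w := pI * lam n ^+ 2 * T h + pI * lam n * Z h.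
    have -> : tterm k z tau n * cexp w - tterm k z tau n - w * tterm k z tau n =
      tterm k z tau n * (cexp w - 1 - w) by ring.
    have a0 : 0 <= a n by rewrite /a.
    have wle : nrm w <= pi * (a n ^+ 2 + a n) * (K * vnrm h).
      have e1 : nrm (pI * lam n ^+ 2 * T h) = pi * a n ^+ 2 * nrm (T h).
        by rewrite 2!nrmM nrmX nrm_pI nrm_lam.
      have e2 : nrm (pI * lam n * Z h) = pi * a n * nrm (Z h).
        by rewrite 2!nrmM nrm_pI nrm_lam.
      apply: (le_trans (nrmD _ _)); rewrite e1 e2 mulrDr mulrDl.
      by rewrite lerD // ler_wpM2l // !mulr_ge0 ?exprn_ge0 // ltW.
    have wle2 : nrm w ^+ 2 <= pi ^+ 2 * (1 + a n) ^+ 4 * (K ^+ 2 * vnrm h ^+ 2).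
      apply: (@le_trans _ _ ((pi * (a n ^+ 2 + a n) * (K * vnrm h)) ^+ 2)).
        by rewrite lerXn2r ?nnegrE ?nrm_ge0 // (le_trans (nrm_ge0 _) wle).
      rewrite !exprMn ler_wpM2r ?mulr_ge0 ?exprn_ge0 ?(ltW K0) // ler_wpM2l ?exprn_ge0 ?(ltW pi0) //.
      rewrite (_ : 4 = 2 * 2)%N // exprM lerXn2r ?nnegrE ?addr_ge0 ?exprn_ge0 ?addr_ge0 //; nra.
    have wle3 : nrm w <= pi * t / 2 * a n ^+ 2 + pi * t / 2 * a n.
      apply: (le_trans wle); rewrite -mulrDr.
      have -> : pi * t / 2 * (a n ^+ 2 + a n) = pi * (a n ^+ 2 + a n) * (t / 2) by ring.
      have kv : K * vnrm h <= t / 2 by rewrite mulrC ltW.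
      apply: ler_wpM2l kv; apply: mulr_ge0; first exact: ltW.
      by apply: addr_ge0 => //; apply: exprn_ge0.
    rewrite nrmM nrmR ger0_norm ?q2_ge0 //.
    have T1 := tterm_le k z tau n; have T2 := cexp_quad w.
    apply: (le_trans (ler_pM (nrm_ge0 _) (nrm_ge0 _) T1 T2)).
    rewrite -/t.
    set E1 := expR _; set X := (1 + a n) in T1 wle2 *.
    have X0 : 0 <= X by rewrite /X addr_ge0.
    have E2 : E1 * expR (nrm w) <= expR (- (pi * t / 2) * a n ^+ 2 + (pi * nrm z + pi * t / 2) * a n).
      rewrite /E1 -expRD ler_expR.
      have -> : - (pi * t / 2) * a n ^+ 2 + (pi * nrm z + pi * t / 2) * a n =
        - (pi * t) * a n ^+ 2 + pi * nrm z * a n + (pi * t / 2 * a n ^+ 2 + pi * t / 2 * a n) by field.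
      by rewrite lerD2l.
    set E3 := expR (_ + _) in E2.
    have hn := hM n; rewrite -/E3 -/X exprD in hn.
    apply: (@le_trans _ _ (pi ^+ k * 4 * (X ^+ k * (pi ^+ 2 * X ^+ 4 * (K ^+ 2 * vnrm h ^+ 2))) * E3)).
      have -> : pi ^+ k * (X ^+ k * E1) * (4 * nrm w ^+ 2 * expR (nrm w)) =
        pi ^+ k * 4 * (X ^+ k * nrm w ^+ 2) * (E1 * expR (nrm w)) by ring.
      apply: ler_pM => //.
      - by rewrite !mulr_ge0 ?exprn_ge0 ?nrm_ge0 // ltW.
      - by rewrite mulr_ge0 ?expR_ge0.
      - rewrite ler_wpM2l ?mulr_ge0 ?exprn_ge0 ?(ltW pi0) //.
        by rewrite ler_wpM2l ?exprn_ge0.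
    apply: (@le_trans _ _ ((pi ^+ k * 4 * pi ^+ 2 * K ^+ 2 * vnrm h ^+ 2) * (X ^+ k * X ^+ 4 * E3))).
      by rewrite le_eqVlt; apply/orP; left; apply/eqP; ring.
    apply: (@le_trans _ _ ((pi ^+ k * 4 * pi ^+ 2 * K ^+ 2 * vnrm h ^+ 2) * (M * q2 R `|n|))); last first.
      by rewrite le_eqVlt; apply/orP; left; apply/eqP; ring.
    by rewrite ler_wpM2l // !mulr_ge0 ?exprn_ge0 ?(ltW pi0) ?(ltW K0).
  rewrite -big_distrr /=.
  have -> : pi ^+ k * 4 * pi ^+ 2 * K ^+ 2 * M * N * vnrm h ^+ 2 =
     pi ^+ k * 4 * pi ^+ 2 * K ^+ 2 * M * vnrm h ^+ 2 * N by ring.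
  by rewrite ler_wpM2l // !mulr_ge0 ?exprn_ge0 ?(ltW pi0) ?(ltW K0).
by split=> // v; rewrite -LE.
Qed.

End Diff.
End Fixed.
End ThetaSeries.

(** * The odd theta function: nonvanishing, periods, addition formula *)

Section Theta.
Variable R : realType.
Local Notation C := R[i].
Local Notation pI := (pIR R).
Implicit Types (z tau x y : C) (n : int).

Lemma cexp_pIz n : cexp (pI * n%:~R) = (-1) ^ n.
Proof.
have N (m : nat) : cexp (pI * m%:R) = (-1) ^+ m.
  elim: m => [|m IH]; first by rewrite mulr0 cexp0.
  by rewrite -natr1 mulrDr mulr1 cexpD IH cexp_pI exprSr.
case: n => m; first by rewrite -exprnP -N.
rewrite NegzE -exprnN -N -cexpN; congr cexp.
by rewrite mulrNz mulrN.
Qed.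

Lemma sgnD n m : (-1) ^ (n + m) = (-1) ^ n * (-1) ^ m :> C.
Proof. by rewrite expfzDr // oppr_eq0 oner_eq0. Qed.

Lemma sgn_sqr n : (-1) ^ n * (-1) ^ n = 1 :> C.
Proof. by rewrite -expfzMl mulrNN mulr1 exp1rz. Qed.

Lemma sgnN n : (-1) ^ (- n) = (-1) ^ n :> C.
Proof.
have n0 : (-1) ^ n != 0 :> C by rewrite expfz_neq0 // oppr_eq0 oner_eq0.
by apply: (mulfI n0); rewrite -sgnD subrr expr0z sgn_sqr.
Qed.

Lemma cexp_2pIz n : cexp (pI * (n%:~R * 2)) = 1.
Proof.
have -> : n%:~R * 2 = (n + n)%:~R :> C by rewrite rmorphD /= ; ring.
by rewrite cexp_pIz sgnD sgn_sqr.
Qed.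

Lemma halfC : (1 / 2)%:C = 1 / 2 :> C.
Proof. by rewrite rmorphM fmorphV /= rmorph1 rmorph_nat. Qed.

Lemma tterm0E chi (s : R) z tau n :
  tterm chi s 0 z tau n = sgn R chi n * cexp (pI * lam s n ^+ 2 * tau + pI * lam s n * z).
Proof. by rewrite /tterm expr0 mulr1. Qed.

Lemma tterm0F (s : R) z tau n :
  tterm false s 0 z tau n = cexp (pI * lam s n ^+ 2 * tau + pI * lam s n * z).
Proof. by rewrite tterm0E mul1r. Qed.

(** The coefficients c_n of a vanishing trigonometric sum vanish for even n:
    compare the sum at t and at t + 1. *)
Lemma trig_sum_even (c : int -> C) : absum c ->
  (forall t : R, hassum (fun n => c n * cexp (pI * (n%:~R * t%:C))) 0) ->
  forall t : R, hassum (fun n => c (n * 2) * cexp (pI * (n%:~R * t%:C))) 0.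
Proof.
move=> ac H t.
have nr n (r : R) : nrm (cexp (pI * (n%:~R * r%:C))) = 1.
  rewrite nrm_cexp Re_pIM -(rmorph_int (real_complex R)) -rmorphM /=.
  by rewrite mulr0 oppr0 expR0.
pose h0 n : int := n * 2; pose h1 n : int := n * 2 + 1.
have i0 : injective h0 by rewrite /h0 => a b; lia.
have i1 : injective h1 by rewrite /h1 => a b; lia.
have cov n : (exists j, n = h0 j) \/ (exists k, n = h1 k).
  rewrite /h0 /h1; case: (boolP ((n %% 2)%Z == 0)) => e.
    by left; exists (n %/ 2)%Z; lia.
  by right; exists (n %/ 2)%Z; lia.
have dis j k : h0 j <> h1 k by rewrite /h0 /h1; lia.
have ab (r : R) (h : int -> int) : injective h ->
    absum (fun n => c (h n) * cexp (pI * ((h n)%:~R * r%:C))).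
  move=> hi; apply: (absum_dom (c := 1) (absum_inj hi ac)) => n.
  by rewrite nrmM nr mulr1 mul1r.
pose r := t / 2.
have r1 : (r + 1)%:C = r%:C + 1 by rewrite rmorphD rmorph1.
have S0 := absum_hassum (ab r h0 i0); have S1 := absum_hassum (ab r h1 i1).
set s0 := summability.sum _ in S0; set s1 := summability.sum _ in S1.
have e1 : s0 + s1 = 0.
  apply: hassum_unique (H r).
  exact: (hassum_split (f := fun n => c n * cexp (pI * (n%:~R * r%:C))) i0 i1 cov dis S0 S1).
have e2 : s0 - s1 = 0.
  apply: hassum_unique (H (r + 1)).
  apply: (hassum_split (f := fun n => c n * cexp (pI * (n%:~R * (r + 1)%:C))) i0 i1 cov dis).
    apply: eq_hassum S0 => n; rewrite r1 !mulrDr cexpD mulr1 /h0.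
    by rewrite rmorphM /= cexp_2pIz mulr1.
  apply: eq_hassum (hassumN S1) => n; rewrite r1 !mulrDr cexpD mulr1.
  have -> : cexp (pI * (h1 n)%:~R) = -1.
    by rewrite /h1 rmorphD rmorphM /= mulrDr cexpD cexp_2pIz mulr1 cexp_pI mul1r.
  by rewrite mulrN1 mulrN.
have {e1 e2} s00 : s0 = 0.
  have : s0 + s0 = 0 by rewrite -[X in X + _](subrK s1) e2 add0r addrC e1.
  by move/eqP; rewrite -mulr2n mulrn_eq0 /= => /eqP.
rewrite s00 in S0; apply: eq_hassum S0 => n; rewrite /h0 rmorphM /= /r.
by congr (_ * cexp (_ * _)); rewrite rmorphM fmorphV /= rmorph_nat; field.
Qed.

(** Restricting K times to even indices leaves c 0 and the coefficients at the
    nonzero multiples of 2^K, whose sum is O(2^-K). *)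
Lemma trig_sum_coef0 (c : int -> C) : absum c -> absum (fun n => c n * n%:~R) ->
  (forall t : R, hassum (fun n => c n * cexp (pI * (n%:~R * t%:C))) 0) -> c 0 = 0.
Proof.
move=> ac [M hM] H.
have it (K : nat) : injective (fun n : int => n * (2 ^ K)%:Z) /\
    forall t : R, hassum (fun n => c (n * (2 ^ K)%:Z) * cexp (pI * (n%:~R * t%:C))) 0.
  elim: K => [|K [inj IH]].
    by split=> [a b|t]; rewrite ?mulr1 //; apply: eq_hassum (H t) => n; rewrite mulr1.
  split=> [a b|t].
    by rewrite expnS PoszM !mulrA => /inj; lia.
  have := trig_sum_even (absum_inj inj ac) IH t; apply: eq_hassum => n.
  by rewrite expnS PoszM mulrA.
have bound (K : nat) : nrm (c 0) * (2 ^ K)%:R <= M.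
  have [inj /(_ 0) H0] := it K.
  have D : hassum (fun n : int => if n == 0 then c 0 else 0) (c 0).
    apply/hassumP => e e0; exists [fset (0 : int)]%fset => B sB.
    rewrite (big_fsetD1 0) /=; last by apply: (fsubsetP sB); rewrite inE.
    rewrite big1_fset ?addr0 ?subrr ?nrm0 // => i; rewrite !inE => /andP[/negPf -> //].
  have Hd := hassumB H0 D; rewrite sub0r in Hd.
  rewrite -nrmN -ler_pdivlMr ?ltr0n ?expn_gt0 //.
  apply: (hassum_nrm Hd) => A; rewrite ler_pdivlMr ?ltr0n ?expn_gt0 // big_distrl /=.
  have := sum_inj_le (g := fun n => nrm (c n * n%:~R)) inj hM A; apply: le_trans.
  apply: ler_sum => n _; rewrite mulr0 mulr0 cexp0 mulr1.
  have [->|n0] := eqVneq n 0; first by rewrite mul0r subrr nrm0 mul0r nrm_ge0.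
  rewrite subr0 nrmM ler_wpM2l ?nrm_ge0 // nrmz rmorphM /= normrM.
  rewrite -pmulrn normr_nat ler_peMl // -intr_norm ler1z -gtz0_ge1 normr_gt0 //.
apply/eqP; rewrite -nrm_eq0; apply/negPn/negP => c0.
have cp : 0 < nrm (c 0) by rewrite lt_neqAle eq_sym c0 nrm_ge0.
have := bound (Num.bound (M / nrm (c 0))).
rewrite mulrC -ler_pdivlMr // => h.
have M0 : 0 <= M by apply: le_trans (hM fset0); rewrite big_nil.
have := archi_boundP (divr_ge0 M0 (ltW cp)).
rewrite ltNge (le_trans _ h) // ler_nat ltnW // ltn_expl //.
Qed.

(** By theta1_tildeE and thf_derive these are theta1_tilde and its z-derivatives. *)
Definition thf k z tau : C := - 'i * thk true (1 / 2) k z tau.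

(** Otherwise all Fourier coefficients of f along the real axis would vanish, but
    none of them is zero. *)
Lemma thf_neq0 tau : 0 < complex.Im tau -> exists z, thf 0 z tau != 0.
Proof.
move=> t0; apply: contrapT => h.
have f0 z : thk true (1 / 2) 0 z tau = 0.
  have : thf 0 z tau == 0 by apply/negPn/negP => h1; apply: h; exists z.
  by rewrite mulf_eq0 oppr_eq0 -nrm_eq0 nrmi oner_eq0 => /eqP.
pose c n := tterm true (1 / 2 : R) 0 0 tau n.
have ac : absum c by apply: absum_tterm.
suff : c 0 = 0.
  move/eqP; rewrite /c /tterm mulf_eq0 (negPf (cexp_neq0 _)) orbF expr0 mulr1.
  by rewrite -nrm_eq0 nrm_sgn oner_eq0.
apply: trig_sum_coef0 => //.
  have ac1 : absum (tterm true (1 / 2 : R) 1 0 tau) by apply: absum_tterm.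
  have := absumD (absumZ pI^-1 ac1) (absumZ (- (1 / 2)) ac).
  congr absum; apply/funext => n; rewrite /c /tterm expr0 expr1 mulr0 addr0 /lam halfC.
  have := pI_neq0 R; move: (pI) => p p0.
  by move: (cexp _) (sgn _ _) => u v; field.
move=> t; have := hassumMr (cexp (- (pI * (t%:C / 2)))) (thk_hassum true (1 / 2) 0 t%:C t0).
rewrite f0 mul0r; apply: eq_hassum => n.
rewrite /c !tterm0E -[LHS]mulrA -[RHS]mulrA -!cexpD; congr (_ * cexp _).
by rewrite /lam halfC; field.
Qed.

Lemma thk_derive chi (s : R) k z tau : 0 < complex.Im tau ->
  is_derive z 1 (fun w => thk chi s k w tau) (thk chi s k.+1 z tau).
Proof.
move=> t0.
have L1 (h : C) : nrm (idfun h) <= 1 * vnrm h by rewrite mul1r vnrmC.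
have L2 (h : C) : nrm ((\0 : {linear C -> C}) h) <= 1 * vnrm h.
  by rewrite mul1r vnrmC nrm0 nrm_ge0.
have tx : 0 < complex.Im ((\0 : {linear C -> C}) z + tau) by rewrite /= add0r.
have [_ D] := @thk_diff R chi s C (idfun : {linear C -> C}) \0 0 tau 1 ltr01 L1 L2 k z tx.
have := D 1; rewrite /= !addr0 !add0r !mulr0 !mulr1 addr0.
by congr is_derive; apply/funext => y; rewrite addr0.
Qed.

Lemma thf_derive k z tau : 0 < complex.Im tau ->
  is_derive z 1 (fun w => thf k w tau) (thf k.+1 z tau).
Proof.
move=> t0; rewrite /thf.
dv_by ltac:(exact: thk_derive).
by rewrite mul0r add0r.
Qed.

Lemma thf_per1 k z tau : 0 < complex.Im tau -> thf k (z + 2) tau = - thf k z tau.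
Proof.
move=> t0; rewrite /thf -mulrN; congr (_ * _).
apply: hassum_unique (thk_hassum _ _ _ _ t0) _.
apply: eq_hassum (hassumN (thk_hassum _ _ _ _ t0)) => n.
have := tterm_shift true (1 / 2) k z tau n 2 0; rewrite addr0 mulr0 add0r => ->.
have -> : pI * lam (1 / 2 : R) n * 2 = pI * (n%:~R * 2) + pI by rewrite /lam halfC; field.
by rewrite cexpD cexp_2pIz cexp_pI !mulrN1.
Qed.

Lemma thf_per2 z tau : 0 < complex.Im tau ->
  thf 0 (z + 2 * tau) tau = - cexp (- (pI * (z + tau))) * thf 0 z tau.
Proof.
move=> t0; rewrite /thf mulrCA; congr (_ * _).
apply: hassum_unique (thk_hassum _ _ _ _ t0) _.
pose h n : int := n - 1.
have bh : bijective h by exists (fun n => n + 1) => n; rewrite /h ?subrK ?addrK.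
apply: (hassum_reindex bh).
apply: eq_hassum (hassumZ (- cexp (- (pI * (z + tau)))) (thk_hassum true (1 / 2) 0 z t0)) => n.
rewrite /tterm !expr0 !mulr1 /sgn /h sgnD /= mulrCA mulNr -cexpD -mulrA.
rewrite -[RHS]mulrA; congr (_ * _); rewrite sgnN expr1z mulN1r; congr (- cexp _).
by rewrite /lam halfC rmorphB /=; field.
Qed.

Lemma thf_odd k z tau : 0 < complex.Im tau -> thf k (- z) tau = (-1) ^+ k.+1 * thf k z tau.
Proof.
move=> t0; rewrite /thf mulrCA; congr (_ * _).
apply: hassum_unique (thk_hassum _ _ _ _ t0) _.
pose h n : int := - n - 1.
have bh : bijective h by exists h => n; rewrite /h; lia.
apply: (hassum_reindex bh).
apply: eq_hassum (hassumZ ((-1) ^+ k.+1) (thk_hassum true (1 / 2) k z t0)) => n.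
have lh : lam (1 / 2 : R) (h n) = - lam (1 / 2 : R) n.
  by rewrite /lam halfC /h rmorphB rmorphN /=; field.
rewrite /tterm lh /sgn /h sgnD !sgnN expr1z.
have -> : (pI * - lam (1 / 2 : R) n) ^+ k = (-1) ^+ k * (pI * lam (1 / 2 : R) n) ^+ k.
  by rewrite mulrN [LHS]exprNn.
have -> : pI * (- lam (1 / 2 : R) n) ^+ 2 * tau + pI * - lam (1 / 2 : R) n * - z =
   pI * lam (1 / 2 : R) n ^+ 2 * tau + pI * lam (1 / 2 : R) n * z by ring.
rewrite exprS.
by move: ((-1) ^+ k) ((-1) ^ n) ((pI * _) ^+ k) (cexp _) => u v w e; ring.
Qed.

(** The two theta functions of 2 x and modulus 2 tau that enter the addition
    formula, scaled so that k is the order of the derivative in x. *)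
Definition thE k x tau : C := 2 ^+ k * thk false 0 k (2 * x) (2 * tau).
Definition thO k x tau : C := 2 ^+ k * thk false (1 / 2) k (2 * x) (2 * tau).

Lemma Im2_gt0 tau : 0 < complex.Im tau -> 0 < complex.Im (2 * tau).
Proof. by rewrite mulr_natl mulr2n raddfD /= => h; rewrite addr_gt0. Qed.

Lemma thEO_derive (s : R) k x tau : 0 < complex.Im tau ->
  is_derive x 1 (fun w => 2 ^+ k * thk false s k (2 * w) (2 * tau))
    (2 ^+ k.+1 * thk false s k.+1 (2 * x) (2 * tau)).
Proof.
move=> /Im2_gt0 t0.
dv_by ltac:(notypeclasses refine (dv_comp (thk_derive _ _ _ _ t0) _); dv_rec fail).
by rewrite exprSr; ring.
Qed.

(** Sum over s = n + m + 1 and d = n - m instead of the indices n and m. These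
    have opposite parity, and each of the two cases is a product of two series. *)
Lemma thf_add x y tau : 0 < complex.Im tau ->
  thf 0 (x + y) tau * thf 0 (x - y) tau =
  thO 0 y tau * thE 0 x tau - thE 0 y tau * thO 0 x tau.
Proof.
move=> t0; have t20 := Im2_gt0 t0.
have -> : thf 0 (x + y) tau * thf 0 (x - y) tau =
    - (thk true (1 / 2) 0 (x + y) tau * thk true (1 / 2) 0 (x - y) tau).
  by rewrite /thf mulrACA mulrNN -expr2 sqrCi mulN1r.
have -> : thO 0 y tau * thE 0 x tau - thE 0 y tau * thO 0 x tau =
    - (thk false (1 / 2) 0 (2 * x) (2 * tau) * thk false 0 0 (2 * y) (2 * tau)
     - thk false 0 0 (2 * x) (2 * tau) * thk false (1 / 2) 0 (2 * y) (2 * tau)).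
  by rewrite /thO /thE; ring.
congr (- _).
pose F (p : int * int) := tterm true (1 / 2 : R) 0 (x + y) tau p.1 * tterm true (1 / 2 : R) 0 (x - y) tau p.2.
have H : hassum F (thk true (1 / 2) 0 (x + y) tau * thk true (1 / 2) 0 (x - y) tau).
  by apply: hassum_prod; [exact: absum_tterm|exact: absum_tterm|exact: thk_hassum|exact: thk_hassum].
apply: (hassum_unique H).
pose h1 (p : int * int) := (p.1 + p.2, p.1 - p.2).
pose h2 (p : int * int) := (p.1 + p.2, p.1 - p.2 - 1).
have EO u v : hassum (fun p : int * int => tterm false 0 0 (2 * u) (2 * tau) p.1 * tterm false (1 / 2 : R) 0 (2 * v) (2 * tau) p.2)
   (thk false 0 0 (2 * u) (2 * tau) * thk false (1 / 2) 0 (2 * v) (2 * tau)).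
  by apply: hassum_prod; [exact: absum_tterm|exact: absum_tterm|exact: thk_hassum|exact: thk_hassum].
have OE u v : hassum (fun p : int * int => tterm false (1 / 2 : R) 0 (2 * u) (2 * tau) p.1 * tterm false 0 0 (2 * v) (2 * tau) p.2)
   (thk false (1 / 2) 0 (2 * u) (2 * tau) * thk false 0 0 (2 * v) (2 * tau)).
  by apply: hassum_prod; [exact: absum_tterm|exact: absum_tterm|exact: thk_hassum|exact: thk_hassum].
apply: (@hassum_split R (int * int)%type (int * int)%type (int * int)%type h1 h2).
- by move=> [a b] [c d]; rewrite /h1 /= => -[h h']; congr (_, _); lia.
- by move=> [a b] [c d]; rewrite /h2 /= => -[h h']; congr (_, _); lia.
- move=> [n m]; rewrite /h1 /h2 /=; case: (boolP (((n + m) %% 2)%Z == 0)) => e.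
    by left; exists (((n + m) %/ 2)%Z, n - ((n + m) %/ 2)%Z) => /=; congr (_, _); lia.
  by right; exists (((n + m) %/ 2)%Z + 1, n - ((n + m) %/ 2)%Z - 1) => /=; congr (_, _); lia.
- by move=> [a b] [c d]; rewrite /h1 /h2 /= => -[]; lia.
- apply: eq_hassum (OE x y) => -[j k]; rewrite /F /h1 [LHS]/= [RHS]/= !tterm0F !tterm0E.
  have sg : sgn R true (j + k) * sgn R true (j - k) = 1.
    by rewrite /sgn !sgnD sgnN mulrACA !sgn_sqr mulr1.
  rewrite [RHS]mulrACA sg [RHS]mul1r -!cexpD; congr cexp.
  by rewrite /lam halfC rmorphD rmorphB /= raddf0; field.
- apply: eq_hassum (hassumN (EO x y)) => -[j k]; rewrite /F /h2 [LHS]/= [RHS]/= !tterm0F !tterm0E.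
  have sg : sgn R true (j + k) * sgn R true (j - k - 1) = -1.
    by rewrite /sgn !sgnD !sgnN expr1z !mulrN1 mulrN mulrACA !sgn_sqr mulr1.
  rewrite [RHS]mulrACA sg [RHS]mulN1r -!cexpD; congr (- cexp _).
  by rewrite /lam halfC !rmorphD /= !rmorphN /= raddf0; field.
Qed.

End Theta.

(** * The exponential function, continuity, the lattice *)

Local Transparent cexp.

Section ExpFacts.
Variable R : realType.
Local Notation C := R[i].
Local Notation pI := (pIR R).

Lemma cexp_derive (z : C) : is_derive z 1 (@cexp R) (cexp z).
Proof.
pose L := [the {linear C -> C} of (cexp z) \*: (idfun : {linear C -> C})].
have LE h : L h = cexp z * h by [].
have [||_ D] := @diff_quad R C (@cexp R) z L (nrm (cexp z)) (nrm (cexp z) * 4 * expR 1) 1 ltr01.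
- by move=> h; rewrite LE nrmM vnrmC.
- move=> h; rewrite vnrmC => h1; rewrite LE.
  have -> : cexp (h + z) - cexp z - cexp z * h = cexp z * (cexp h - 1 - h).
    by rewrite cexpD; ring.
  have E1 : nrm (cexp z) * 4 * expR 1 * nrm h ^+ 2 = nrm (cexp z) * (4 * nrm h ^+ 2 * expR 1) by ring.
  rewrite nrmM E1 ler_wpM2l ?nrm_ge0 // (le_trans (cexp_quad h)) //.
  by rewrite ler_wpM2l ?mulr_ge0 ?exprn_ge0 ?nrm_ge0 // ler_expR ltW.
by have := D 1; rewrite LE mulr1.
Qed.

Lemma cexp_eq1 (w : C) : cexp w = 1 -> exists n : int, w = pI * (n%:~R * 2).
Proof.
case: w => u v h.
have : nrm (cexp (u +i* v)) = 1 by rewrite h nrm1.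
rewrite nrm_cexp /= => /eqP; rewrite -expR0 (inj_eq (@expR_inj R)) => /eqP u0.
have pi0 := @pi_gt0 R.
pose n := Num.floor (v / (pi *+ 2)).
have p2 : 0 < pi *+ 2 :> R by rewrite mulrn_wgt0.
have /andP[n1 n2] := floor_itv (v / (pi *+ 2)); rewrite -/n in n1 n2.
exists n.
have wn : cexp (u +i* v - pI * (n%:~R * 2)) = 1.
  by rewrite cexpD h mul1r cexpN cexp_2pIz invr1.
have E2 : u +i* v - pI * (n%:~R * 2) = 0 +i* (v - pi *+ 2 * n%:~R).
  rewrite pIE -complexiE -(rmorph_int (real_complex R)) u0.
  by apply/eqP; rewrite eq_complex /=; apply/andP; split; apply/eqP; rewrite ?mulr2n; ring.
move: wn; rewrite E2 /cexp /= expR0 mul1r => /eqP; rewrite eq_complex /= => /andP[/eqP c1 _].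
set y := v - _ in c1 E2.
have y0 : 0 <= y by rewrite /y subr_ge0 mulrC -ler_pdivlMr.
have y2 : y < pi *+ 2.
  by rewrite /y ltrBlDl -{2}[pi *+ 2]mulr1 -mulrDr mulrC -ltr_pdivrMr // -(intrD _ n 1).
have yy : y = 0.
  have [yp|yp] := leP y pi.
    by apply: (@cos_inj R); rewrite ?in_itv /= ?lexx ?y0 ?yp ?(ltW pi0) // c1 cos0.
  have : pi *+ 2 - y = 0.
    apply: (@cos_inj R); rewrite ?in_itv /= ?lexx ?(ltW pi0) //.
      by rewrite subr_ge0 (ltW y2) /= mulr2n; lra.
    by rewrite cos0 addrC cosD2pi cosN.
  by move/eqP; rewrite subr_eq0 => /eqP E3; rewrite E3 ltxx in y2.
by apply/eqP; rewrite -subr_eq0 E2 yy; apply/eqP.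
Qed.

Lemma cont_eps (F : C -> C) (z : C) : {for z, continuous F} -> forall e : R, 0 < e ->
  exists2 d : R, 0 < d & forall h, nrm h < d -> nrm (F z - F (z + h)) < e.
Proof.
move=> /nbhsCP H e /H /nbhs_ballP [d /= /gt0C[d' d0 ->]] hd; exists d' => // h hh.
by have := hd (z + h); rewrite -ball_normE /= opprD addNKr normrN normE ltcR => /(_ hh).
Qed.

Lemma cont_neq0 (F : C -> C) (z : C) : {for z, continuous F} -> F z != 0 ->
  exists2 d : R, 0 < d & forall h, nrm h < d -> F (z + h) != 0.
Proof.
rewrite -nrm_gt0 => cF Fz; have [d d0 hd] := cont_eps cF Fz; exists d => // h /hd.
by apply: contraPneq => ->; rewrite subr0 ltxx.
Qed.

Lemma cont_bound (F : C -> C) (z : C) : {for z, continuous F} ->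
  exists2 d : R, 0 < d & forall h, nrm h < d -> nrm (F (z + h)) <= nrm (F z) + 1.
Proof.
move=> cF; have [d d0 hd] := cont_eps cF ltr01; exists d => // h /hd h1.
have := nrm_sub (F (z + h)) (F z); rewrite nrmB; lra.
Qed.

End ExpFacts.

Section Lattice.
Variable R : realType.
Local Notation C := R[i].
Variable tau : C.
Hypothesis t0 : 0 < complex.Im tau.

Lemma latP z : lattice tau z <-> exists m n : int, z = 2 * m%:~R + 2 * tau * n%:~R.
Proof.
split=> [[[m n] _ <-]|[m [n ->]]]; first by exists m, n.
by exists (m, n).
Qed.

Lemma lat0 : lattice tau 0.
Proof. by apply/latP; exists 0, 0; rewrite !mulr0 addr0. Qed.

Lemma latD y z : lattice tau y -> lattice tau z -> lattice tau (y + z).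
Proof.
move=> /latP[m [n ->]] /latP[m' [n' ->]]; apply/latP; exists (m + m'), (n + n').
by rewrite !rmorphD /=; ring.
Qed.

Lemma latN z : lattice tau z -> lattice tau (- z).
Proof.
move=> /latP[m [n ->]]; apply/latP; exists (- m), (- n).
by rewrite !rmorphN /=; ring.
Qed.

Lemma lat2 : lattice tau 2.
Proof. by apply/latP; exists 1, 0; rewrite mulr0 mulr1 addr0. Qed.

Lemma lat2t : lattice tau (2 * tau).
Proof. by apply/latP; exists 0, 1; rewrite mulr0 mulr1 add0r. Qed.

Lemma lat_shift z w : lattice tau w -> lattice tau (z + w) <-> lattice tau z.
Proof.
move=> lw; split=> h; last exact: latD.
by rewrite -(addrK w z); apply: latD => //; apply: latN.
Qed.

Lemma countable_lat : countable (lattice tau).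
Proof. by apply: sub_countable (card_image_le _ _) (countableP _). Qed.

Lemma lat_coord z : let y := complex.Im z / (2 * complex.Im tau) in
  let x := (complex.Re z - 2 * complex.Re tau * y) / 2 in
  z = 2 * x%:C + 2 * tau * y%:C.
Proof.
case: z => a b /=; case: tau t0 => u v /= v0.
have v0' : v != 0 by rewrite gt_eqF.
rewrite -!(rmorph_nat (real_complex R)).
by apply/eqP; rewrite eq_complex /=; apply/andP; split; apply/eqP; field.
Qed.

Lemma lat_reduce z : exists w s t, [/\ lattice tau w, 0 <= s <= 1, 0 <= t <= 1 &
  z = w + (2 * s%:C + 2 * tau * t%:C)].
Proof.
pose y := complex.Im z / (2 * complex.Im tau).
pose x := (complex.Re z - 2 * complex.Re tau * y) / 2.
have /andP[y1 y2] := floor_itv y; have /andP[x1 x2] := floor_itv x.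
rewrite rmorphD /= in y2; rewrite rmorphD /= in x2.
exists (2 * (Num.floor x)%:~R + 2 * tau * (Num.floor y)%:~R), (x - (Num.floor x)%:~R), (y - (Num.floor y)%:~R).
split; [by apply/latP; exists (Num.floor x), (Num.floor y)| | |].
- by rewrite subr_ge0 x1 /=; lra.
- by rewrite subr_ge0 y1 /=; lra.
have E : z = 2 * x%:C + 2 * tau * y%:C by apply: lat_coord.
rewrite {1}E !rmorphB /= !(rmorph_int (real_complex R)); ring.
Qed.

Lemma lat_half_notin (m n : int) : (m%:~R + tau * n%:~R = 0 :> C) -> m = 0 /\ n = 0.
Proof.
rewrite -!(rmorph_int (real_complex R)); case: tau t0 => u v /= v0.
move=> /eqP; rewrite eq_complex /= !mulr0 !add0r subr0 => /andP[/eqP e1 /eqP e2].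
move: e2; rewrite ?add0r => /eqP; rewrite mulf_eq0 (gt_eqF v0) /= intr_eq0 => /eqP n0.
by move: e1; rewrite n0 mulr0 addr0 => /eqP; rewrite intr_eq0 => /eqP.
Qed.

End Lattice.

(** * The zeros of the odd theta function *)

(** The properties of theta1_tilde at a fixed tau on which the next parts rest:
    f k, E k and O k stand for the k-th derivatives of f 0, E 0 and O 0. *)
Record theta_like (R : realType) (tau : R[i]) (f E O : nat -> R[i] -> R[i]) : Prop :=
ThetaLike {
  tl_im : 0 < complex.Im tau ;
  tl_f : forall k (z : R[i]), is_derive z 1 (f k) (f k.+1 z) ;
  tl_E : forall k (z : R[i]), is_derive z 1 (E k) (E k.+1 z) ;
  tl_O : forall k (z : R[i]), is_derive z 1 (O k) (O k.+1 z) ;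
  tl_add : forall x y : R[i], f 0 (x + y) * f 0 (x - y) = O 0 y * E 0 x - E 0 y * O 0 x ;
  tl_odd : forall k (z : R[i]), f k (- z) = (-1) ^+ k.+1 * f k z ;
  tl_per1 : forall k (z : R[i]), f k (z + 2) = - f k z ;
  tl_per2 : forall z : R[i], f 0 (z + 2 * tau) = - cexp (- (pIR R * (z + tau))) * f 0 z ;
  tl_neq0 : exists z, f 0 z != 0 }.

Section SigmaLike.
Variable R : realType.
Local Notation C := R[i].
Local Notation pI := (pIR R).
Variables (tau : C) (f E O : nat -> C -> C).
Hypothesis HS : theta_like tau f E O.
Let t0 := tl_im HS.
Let Hf := tl_f HS.
Let HE := tl_E HS.
Let HO := tl_O HS.
Let Hadd := tl_add HS.
Let Hodd := tl_odd HS.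
Let Hp1 := tl_per1 HS.
Let Hp2 := tl_per2 HS.
Let Hnz := tl_neq0 HS.

Ltac feo := first
 [ notypeclasses refine (dv_comp (Hf _ _) _); dv_rec fail
 | notypeclasses refine (dv_comp (HE _ _) _); dv_rec fail
 | notypeclasses refine (dv_comp (HO _ _) _); dv_rec fail
 | notypeclasses refine (dv_comp (cexp_derive _) _); dv_rec fail ].
Ltac dvf := dv_by feo.

Lemma dv_eqfun (F G : C -> C) (z a b : C) : (forall y, F y = G y) ->
  is_derive z 1 F a -> is_derive z 1 G b -> a = b.
Proof. by move=> /funext ->; apply: dv_unique. Qed.

Lemma f_even0 k : ~~ odd k -> f k 0 = 0.
Proof.
move=> ek; have := Hodd k 0; rewrite oppr0 exprS -signr_odd (negPf ek) expr0 mulr1 mulN1r.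
by move/eqP; rewrite -addr_eq0 -mulr2n mulrn_eq0 /= => /eqP.
Qed.

Let f00 : f 0 0 = 0. Proof. exact: f_even0. Qed.
Let f20 : f 2 0 = 0. Proof. exact: f_even0. Qed.
Let f40 : f 4 0 = 0. Proof. exact: f_even0. Qed.

Lemma G0 (x : C) : f 0 x ^+ 2 = O 0 0 * E 0 x - E 0 0 * O 0 x.
Proof. by rewrite -Hadd addr0 subr0 expr2. Qed.

(** The iterated y-derivatives of the addition formula. At y = 0 they express
    f f'' - f'^2 and f f'''' - 4 f' f''' + 3 f''^2 as combinations of E and O. *)
Lemma add1 (x y : C) : f 1 (x + y) * f 0 (x - y) - f 0 (x + y) * f 1 (x - y) =
  O 1 y * E 0 x - E 1 y * O 0 x.
Proof.
notypeclasses refine (dv_eqfun (z := y) (Hadd x) _ _); dvf; ring.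
Qed.

Lemma add2 (x y : C) : f 2 (x + y) * f 0 (x - y) - 2 * (f 1 (x + y) * f 1 (x - y))
  + f 0 (x + y) * f 2 (x - y) = O 2 y * E 0 x - E 2 y * O 0 x.
Proof.
notypeclasses refine (dv_eqfun (z := y) (add1 x) _ _); dvf; ring.
Qed.

Lemma add3 (x y : C) : f 3 (x + y) * f 0 (x - y) - 3 * (f 2 (x + y) * f 1 (x - y))
  + 3 * (f 1 (x + y) * f 2 (x - y)) - f 0 (x + y) * f 3 (x - y) =
  O 3 y * E 0 x - E 3 y * O 0 x.
Proof.
notypeclasses refine (dv_eqfun (z := y) (add2 x) _ _); dvf; ring.
Qed.

Lemma add4 (x y : C) : f 4 (x + y) * f 0 (x - y) - 4 * (f 3 (x + y) * f 1 (x - y))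
  + 6 * (f 2 (x + y) * f 2 (x - y)) - 4 * (f 1 (x + y) * f 3 (x - y))
  + f 0 (x + y) * f 4 (x - y) = O 4 y * E 0 x - E 4 y * O 0 x.
Proof.
notypeclasses refine (dv_eqfun (z := y) (add3 x) _ _); dvf; ring.
Qed.

(** f^2 times the second derivative of log f. *)
Definition D2 (x : C) : C := f 0 x * f 2 x - f 1 x ^+ 2.

Lemma G2 (x : C) : 2 * D2 x = O 2 0 * E 0 x - E 2 0 * O 0 x.
Proof. by rewrite -add2 addr0 subr0 /D2; ring. Qed.

Lemma G4 (x : C) : 2 * f 0 x * f 4 x - 8 * f 1 x * f 3 x + 6 * f 2 x ^+ 2 =
  O 4 0 * E 0 x - E 4 0 * O 0 x.
Proof. by rewrite -add4 addr0 subr0; ring. Qed.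

Lemma det_EO : O 0 0 * E 2 0 - E 0 0 * O 2 0 = 2 * f 1 0 ^+ 2.
Proof.
have H1 x : 2 * f 0 x * f 1 x = O 0 0 * E 1 x - E 0 0 * O 1 x.
  notypeclasses refine (dv_eqfun (z := x) (G0) _ _); dvf; ring.
have H2 : 2 * f 1 0 * f 1 0 + 2 * f 0 0 * f 2 0 = O 0 0 * E 2 0 - E 0 0 * O 2 0.
  notypeclasses refine (dv_eqfun (z := 0) (H1) _ _); dvf; ring.
by rewrite -H2 f00; ring.
Qed.

(** If f 1 0 vanished, D2 would be a multiple of f^2, and log f would be quadratic
    beyond the last zero of f on the segment from 0 to a point where f does not
    vanish; but then f would not tend to 0 at that zero. *)
Lemma f1_neq0 : f 1 0 != 0.
Proof.
apply/eqP => c0; have [x1 fx1] := Hnz.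
have det0 : O 0 0 * E 2 0 = E 0 0 * O 2 0.
  by apply/eqP; rewrite -subr_eq0 det_EO c0 expr0n mulr0.
have [p hp] : exists p, forall x, D2 x = p * f 0 x ^+ 2.
  have [e0|e0] := eqVneq (O 0 0) 0.
    have E0 : E 0 0 != 0.
      apply: contra fx1 => /eqP E0; rewrite -sqrf_eq0 G0 e0 E0 !mul0r subrr //.
    have O2 : O 2 0 = 0.
      by move: det0; rewrite e0 mul0r => /esym/eqP; rewrite mulf_eq0 (negPf E0) => /eqP.
    exists (E 2 0 / (2 * E 0 0)) => x; have := G2 x; have := G0 x; rewrite e0 O2 => -> H.
    have -> : D2 x = (2 * D2 x) / 2 by field.
    by rewrite H; field.
  exists (O 2 0 / (2 * O 0 0)) => x; have := G2 x; have := G0 x => -> H.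
  have -> : D2 x = (2 * D2 x) / 2 by field.
  have E2 : E 2 0 = E 0 0 * O 2 0 / O 0 0 by rewrite -det0; field.
  by rewrite H E2; field; rewrite e0.
pose S := [set t : R | 0 <= t <= 1 /\ f 0 (t%:C * x1) = 0].
have hS : has_sup S.
  split; first by exists 0; split; rewrite ?lexx ?ler01 // mul0r f00.
  by exists 1 => t [] /andP[].
set s := sup S; have s0 : 0 <= s by apply: ub_le_sup; [exact: hS.2|split; rewrite ?lexx ?ler01 // mul0r f00].
have s1 : s <= 1 by apply: ge_sup => [|t [/andP[]] //]; exact: hS.1.
have fc : {for s%:C * x1, continuous (f 0)} by apply: dv_cont (Hf 0 _).
have step (t h : R) : t%:C * x1 + h%:C * x1 = (t + h)%:C * x1 by rewrite rmorphD mulrDl.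
have nx : 0 < nrm x1 + 1 by rewrite ltr_wpDl ?nrm_ge0.
have small (h d : R) : 0 < d -> `|h| < d / (nrm x1 + 1) -> nrm (h%:C * x1) < d.
  move=> d0; rewrite ltr_pdivlMr // => hh; rewrite nrmM nrmR; apply: le_lt_trans hh.
  by rewrite ler_wpM2l // lerDl.
have fs : f 0 (s%:C * x1) = 0.
  apply: contrapT => /eqP fs; have [d d0 hd] := cont_neq0 fc fs.
  have dd : 0 < d / (nrm x1 + 1) by rewrite divr_gt0.
  have [t [t01 ft] ht] := sup_adherent dd hS; rewrite -/s in ht.
  have ts : t <= s by apply: ub_le_sup; [exact: hS.2|].
  have st : s + (t - s) = t by rewrite addrC subrK.
  have := hd ((t - s)%:C * x1); rewrite step st ft eqxx => /(_ _)/wrap[] //.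
  by apply: small => //; rewrite ler0_norm; lra.
have sl : s < 1.
  by rewrite lt_neqAle s1 andbT; apply/negP => /eqP E1; move: fx1; rewrite -[x1]mul1r -(rmorph1 (real_complex R)) -E1 fs eqxx.
have nz (t : R) : s < t <= 1 -> f 0 (t%:C * x1) != 0.
  move=> /andP[st t1]; apply/eqP => ft; have : t <= s.
    by apply: ub_le_sup; [exact: hS.2|split=> //; rewrite t1 (le_trans s0 (ltW st))].
  by rewrite leNgt st.
have seg (t u : R) : s < t <= 1 -> 0 <= u <= 1 -> exists2 v : R, s < v <= 1 &
    t%:C * x1 + u%:C * (x1 - t%:C * x1) = v%:C * x1.
  move=> /andP[st t1] /andP[u0 u1]; exists (t + u * (1 - t)).
    by apply/andP; split; nra.
  by rewrite rmorphD rmorphM rmorphB rmorph1 /=; ring.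
pose F x := f 1 x / f 0 x - p * x.
have hF (t : R) : s < t <= 1 -> F x1 = F (t%:C * x1).
  move=> st; apply: is_derive0_segment => u u01; have [v vs ->] := seg t u st u01.
  have vn := nz v vs; rewrite /F.
  dvf.
  have := hp (v%:C * x1); rewrite /D2 => H.
  have -> : f 2 (v%:C * x1) = (p * f 0 (v%:C * x1) ^+ 2 + f 1 (v%:C * x1) ^+ 2) / f 0 (v%:C * x1).
    by rewrite -H; field.
  by field.
set al := F x1 in hF.
pose Gx x := f 0 x * cexp (- (p / 2 * x ^+ 2 + al * x)).
have hG (t : R) : s < t <= 1 -> Gx x1 = Gx (t%:C * x1).
  move=> st; apply: is_derive0_segment => u u01; have [v vs ->] := seg t u st u01.
  have vn := nz v vs; rewrite /Gx; dvf.
  have := hF v vs; rewrite /F => ->; set e := cexp _; field.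
  exact: vn.
have Gc : {for s%:C * x1, continuous Gx}.
  have [l H] : exists l, is_derive (s%:C * x1) 1 Gx l by eexists; rewrite /Gx; dv_rec feo.
  exact: dv_cont H.
have Gx1 : Gx x1 != 0 by rewrite mulf_neq0 // cexp_neq0.
have g0 : 0 < nrm (Gx x1) by rewrite nrm_gt0.
have [d' d0 hd] := cont_eps Gc g0.
pose h := Num.min (1 - s) (d' / (nrm x1 + 1) / 2).
have h0 : 0 < h by rewrite lt_min subr_gt0 sl !divr_gt0.
have h1 : h <= 1 - s by rewrite ge_min lexx.
have h2 : h < d' / (nrm x1 + 1).
  have : h <= d' / (nrm x1 + 1) / 2 by rewrite ge_min lexx orbT.
  have : 0 < d' / (nrm x1 + 1) by rewrite divr_gt0.
  lra.
have := hd (h%:C * x1) => /(_ _)/wrap[].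
  by apply: small; rewrite // ger0_norm // ltW.
rewrite step -hG; last by apply/andP; split; lra.
by rewrite {1}/Gx fs mul0r sub0r nrmN ltxx.
Qed.

Lemma cross (w x : C) : f 0 w = 0 -> O 0 x * E 0 (x + w) = E 0 x * O 0 (x + w).
Proof.
move=> w0; have := Hadd (x + w) x; have -> : x + w - x = w by ring.
by rewrite w0 mulr0 => /esym/eqP; rewrite subr_eq0 => /eqP.
Qed.

(** By cross the vectors (E, O) at x and x + w are proportional, and both f^2 and
    D2 are linear in (E, O). *)
Lemma zero_rel (w x : C) : f 0 w = 0 ->
  f 0 (x + w) ^+ 2 * D2 x = f 0 x ^+ 2 * D2 (x + w).
Proof.
move=> /(cross x) H; have two : (2 : C) != 0 by rewrite pnatr_eq0.
apply: (mulfI two).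
have -> : 2 * (f 0 (x + w) ^+ 2 * D2 x) = f 0 (x + w) ^+ 2 * (2 * D2 x) by ring.
have -> : 2 * (f 0 x ^+ 2 * D2 (x + w)) = f 0 x ^+ 2 * (2 * D2 (x + w)) by ring.
rewrite !G0 !G2; apply/eqP; rewrite -subr_eq0.
move: (O 0 0) (E 0 0) (O 2 0) (E 2 0) => a b c d.
have -> : (a * E 0 (x + w) - b * O 0 (x + w)) * (c * E 0 x - d * O 0 x) -
   (a * E 0 x - b * O 0 x) * (c * E 0 (x + w) - d * O 0 (x + w)) =
   (b * c - a * d) * (O 0 x * E 0 (x + w) - E 0 x * O 0 (x + w)) by ring.
by rewrite H subrr mulr0.
Qed.

Lemma EO_zero (x : C) : f 0 x = 0 -> D2 x = 0 -> E 0 x = 0 /\ O 0 x = 0.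
Proof.
move=> fx dx; have H0 := G0 x; have H2 := G2 x; have Hd := det_EO.
rewrite fx expr0n /= in H0; rewrite dx mulr0 in H2.
have n0 : 2 * f 1 0 ^+ 2 != 0 by rewrite mulf_neq0 ?pnatr_eq0 // expf_neq0 // f1_neq0.
rewrite -Hd in n0; move: n0 H0 H2.
move: (O 0 0) (E 0 0) (O 2 0) (E 2 0) => a b c d n0 H0 H2.
split; apply: (mulIf n0); rewrite mul0r.
  have -> : E 0 x * (a * d - b * c) = d * (a * E 0 x - b * O 0 x) - b * (c * E 0 x - d * O 0 x) by ring.
  by rewrite -H0 -H2 !mulr0 subrr.
have -> : O 0 x * (a * d - b * c) = c * (a * E 0 x - b * O 0 x) - a * (c * E 0 x - d * O 0 x) by ring.
by rewrite -H0 -H2 !mulr0 subrr.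
Qed.

Lemma f_isolated : exists2 d : R, 0 < d & forall h : C, h != 0 -> nrm h < d -> f 0 h != 0.
Proof.
have c0 := f1_neq0; have n0 : 0 < nrm (f 1 0) / 2 by rewrite divr_gt0 // nrm_gt0.
have [d d0 H] := (is_derive_eps _ _ _).1 (Hf 0 0) _ n0.
exists d => // h h0 hd; have := H h hd; rewrite add0r f00 subr0 => h1.
rewrite -nrm_gt0; have h2 := nrm_sub (f 1 0 * h) (f 0 h).
rewrite nrmB in h1; rewrite nrmM in h2.
have : 0 < nrm (f 1 0) / 2 * nrm h by rewrite mulr_gt0 // nrm_gt0.
lra.
Qed.

Lemma f_zero_shift (a : C) : (forall z, f 0 (z + a) = 0 <-> f 0 z = 0) ->
  forall (n : int) z, f 0 (z + a * n%:~R) = 0 <-> f 0 z = 0.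
Proof.
move=> Ha; have N (m : nat) z : f 0 (z + a * m%:R) = 0 <-> f 0 z = 0.
  elim: m => [|m IH]; first by rewrite mulr0 addr0.
  by rewrite -natr1 mulrDr mulr1 addrA Ha.
case=> m z; first exact: N.
rewrite NegzE mulrNz mulrN -[X in _ <-> f 0 X = 0](subrK (a * m.+1%:R)).
by rewrite N.
Qed.

Lemma f_zero_lat (w z : C) : lattice tau w -> f 0 (z + w) = 0 <-> f 0 z = 0.
Proof.
move=> /latP[m [n ->]]; rewrite addrA f_zero_shift; last first.
  move=> y; rewrite Hp2; split=> [/eqP|->]; last by rewrite mulr0.
  by rewrite mulf_eq0 oppr_eq0 (negPf (cexp_neq0 _)) => /eqP.
apply: f_zero_shift => y; rewrite Hp1; split=> [/eqP|->]; last by rewrite oppr0.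
by rewrite oppr_eq0 => /eqP.
Qed.

Definition zero_ball (c : C) (r : R) := forall h, nrm h < r -> f 0 (c + h) = 0.

(** At a point v of the disc f and f' vanish, hence so do E and O, and the
    addition formula at (v + s, v) gives f (2 v + s) f s = 0. *)
Lemma zero_ball_double c r : 0 < r -> zero_ball c r -> zero_ball (2 * c) (2 * r).
Proof.
move=> r0 H h hr; have [d d0 Hd] := f_isolated.
pose s := Num.min (d / 2) ((2 * r - nrm h) / 2).
have s0 : 0 < s by rewrite lt_min !divr_gt0 // subr_gt0.
have s1 : s <= d / 2 by rewrite ge_min lexx.
have s2 : s <= (2 * r - nrm h) / 2 by rewrite ge_min lexx orbT.
have sn : nrm s%:C = s by rewrite nrmR ger0_norm // ltW.
have fs : f 0 s%:C != 0 by apply: Hd; rewrite ?sn; [rewrite -nrm_gt0 sn|lra].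
pose v := c + (h - s%:C) / 2.
have vr : nrm ((h - s%:C) / 2) < r.
  rewrite nrmM nrmV nrmn ltr_pdivrMr //; have := nrmBD h s%:C; rewrite sn; lra.
have fv : f 0 v = 0 by apply: H.
have dv : is_derive v 1 (f 0) 0.
  apply: (@dv_ext R (fun _ => 0) (f 0) v 0 (r - nrm ((h - s%:C) / 2))).
  - by rewrite subr_gt0.
  - move=> k hk; rewrite /v -addrA H // (le_lt_trans (nrmD _ _)) //; lra.
have fv1 : f 1 v = 0 by apply: dv_unique (Hf 0 v) dv.
have D0 : D2 v = 0 by rewrite /D2 fv fv1 mul0r expr0n subrr.
have [Ev Ov] := EO_zero fv D0.
have := Hadd (v + s%:C) v; rewrite Ev Ov.
have -> : v + s%:C + v = 2 * c + h by rewrite /v; field.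
have -> : v + s%:C - v = s%:C by ring.
by rewrite !mul0r subrr => /eqP; rewrite mulf_eq0 (negPf fs) orbF => /eqP.
Qed.

(** A common zero v of E and O gives f a disc of zeros; doubling discs
    repeatedly yields one containing a period parallelogram. *)
Lemma EO_no_common_zero v : E 0 v = 0 -> O 0 v = 0 -> False.
Proof.
move=> Ev Ov; have [d d0 Hd] := f_isolated.
have fz z : f 0 z * f 0 (z - 2 * v) = 0.
  have := Hadd (z - v) v; rewrite Ev Ov !mul0r subrr.
  by rewrite subrK; have -> : z - v - v = z - 2 * v by ring.
have d2 : 0 < d / 2 by rewrite divr_gt0.
pose c0 := 2 * v + (d / 2)%:C.
have B0 : zero_ball c0 (d / 2).
  move=> h hd; have := fz (c0 + h); have -> : c0 + h - 2 * v = (d / 2)%:C + h by rewrite /c0; ring.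
  move/eqP; rewrite mulf_eq0 => /orP[/eqP //|/negPn/negP []]; apply: Hd.
    apply/eqP => E1; move: hd; have -> : h = - (d / 2)%:C by apply/eqP; rewrite -addr_eq0 addrC E1.
    by rewrite nrmN nrmR gtr0_norm // ltxx.
  by rewrite (le_lt_trans (nrmD _ _)) // nrmR gtr0_norm //; lra.
have B n : zero_ball (2 ^+ n * c0) (2 ^+ n * (d / 2)).
  elim: n => [|n IH]; first by rewrite !expr0 !mul1r.
  by rewrite !exprS -!mulrA; apply: zero_ball_double => //; rewrite mulr_gt0 // exprn_gt0.
have [z0 nz0] := Hnz.
pose K := 2 + 2 * nrm tau + 1.
have K0 : 0 <= K / (d / 2) by rewrite divr_ge0 ?(ltW d2) // /K; have := nrm_ge0 tau; lra.
pose n := Num.bound (K / (d / 2)).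
have nK : K < 2 ^+ n * (d / 2).
  rewrite -ltr_pdivrMr //; apply: (lt_le_trans (archi_boundP K0)).
  by rewrite -natrX ler_nat ltnW // ltn_expl.
have [w [s [t [lw s01 t01 E1]]]] := lat_reduce t0 (z0 - 2 ^+ n * c0).
suff : f 0 z0 = 0 by move/eqP; rewrite (negPf nz0).
have -> : z0 = (2 ^+ n * c0 + (2 * s%:C + 2 * tau * t%:C)) + w.
  have -> : z0 = (z0 - 2 ^+ n * c0) + 2 ^+ n * c0 by rewrite subrK.
  by rewrite E1; ring.
apply/(f_zero_lat _ lw)/B; apply: le_lt_trans nK.
move: s01 t01 => /andP[s0 s1] /andP[t0' t1].
rewrite (le_trans (nrmD _ _)) // !nrmM nrmn !nrmR !ger0_norm // /K.
have := nrm_ge0 tau; nra.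
Qed.

Lemma f1_simple v : f 0 v = 0 -> f 1 v != 0.
Proof.
move=> fv; apply/eqP => f1v; have D0 : D2 v = 0 by rewrite /D2 fv f1v mul0r expr0n subrr.
have [Ev Ov] := EO_zero fv D0.
exact: EO_no_common_zero Ev Ov.
Qed.

(** In zero_rel with x := v only the left side can be nonzero, and D2 v <> 0 as v
    is a simple zero. *)
Lemma f_zeroD v w : f 0 v = 0 -> f 0 w = 0 -> f 0 (v + w) = 0.
Proof.
move=> fv fw; have := zero_rel v fw; rewrite fv expr0n mul0r /D2 fv mul0r sub0r.
move/eqP; rewrite mulf_eq0 oppr_eq0 !sqrf_eq0 (negPf (f1_simple fv)) orbF => /eqP //.
Qed.

Lemma f_zeroN v : f 0 v = 0 -> f 0 (- v) = 0.
Proof. by move=> fv; rewrite Hodd fv mulr0. Qed.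

Lemma f_zero_add v w : f 0 w = 0 -> f 0 (v + w) = 0 <-> f 0 v = 0.
Proof.
move=> fw; split=> h; last exact: f_zeroD.
by rewrite -(addrK w v); apply: f_zeroD => //; apply: f_zeroN.
Qed.

Lemma countable_zeros : countable [set z | f 0 z = 0].
Proof.
have [d d0 Hd] := f_isolated.
have d4 : 0 < d / 4 by rewrite divr_gt0.
pose g (z : C) := (Num.floor (complex.Re z / (d / 4)), Num.floor (complex.Im z / (d / 4))).
have cl (x y : R) : Num.floor (x / (d / 4)) = Num.floor (y / (d / 4)) -> `|x - y| < d / 2.
  move=> E1; have /andP[] := floor_itv (x / (d / 4)); have /andP[] := floor_itv (y / (d / 4)).
  rewrite E1 rmorphD /= !ltr_pdivrMr // !ler_pdivlMr //.
  by move: (Num.floor _)%:~R => k *; rewrite ltr_norml; apply/andP; split; lra.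
apply/(@countable_injP _ _); exists (fun z => choice.pickle (g z)).
move=> z1 z2 /set_mem /= f1 /set_mem /= f2 /(pcan_inj choice.pickleK) [e1 e2].
apply/eqP; rewrite -subr_eq0; apply/negPn/negP => n0.
have : f 0 (z1 - z2) = 0 by apply: f_zeroD => //; apply: f_zeroN.
move/eqP; apply/negP; apply: Hd => //.
rewrite (le_lt_trans (nrm_le_ReIm _)) //.
have := cl _ _ e1; have := cl _ _ e2.
by rewrite -!raddfB /=; lra.
Qed.

(** A zero w makes f (x + w) / f x the exponential of an affine function of x;
    comparing with the multipliers of 2 and 2 tau puts w in the lattice. *)
Lemma f_zeros w : f 0 w = 0 <-> lattice tau w.
Proof.
split=> [fw|lw]; last by rewrite -[w]add0r f_zero_lat.
pose G := [set z | f 0 z = 0].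
have cG : countable G := countable_zeros.
pose A x := f 1 (x + w) / f 0 (x + w) - f 1 x / f 0 x.
have [x0 nx0] := Hnz.
have nG x : ~ G x -> f 0 x != 0 /\ f 0 (x + w) != 0.
  by move=> Gx; split; apply/eqP => // /(f_zero_add _ fw).
have Gx0 : ~ G x0 by apply/eqP.
have hA x : ~ G x -> A x = A x0.
  move=> Gx; apply: (const_off_countable cG) => // z /nG [n1 n2]; rewrite /A.
  dvf.
  have := zero_rel z fw; rewrite /D2 => H.
  have -> : f 2 (z + w) = ((f 0 (z + w) ^+ 2 * (f 0 z * f 2 z - f 1 z ^+ 2)) / f 0 z ^+ 2
     + f 1 (z + w) ^+ 2) / f 0 (z + w).
    by rewrite H; field; rewrite n1 n2.
  by field; rewrite n1 n2.
set al := A x0 in hA.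
pose B x := f 0 (x + w) / f 0 x * cexp (- (al * x)).
have hB x : ~ G x -> B x = B x0.
  move=> Gx; apply: (const_off_countable cG) => // z Gz; have [n1 n2] := nG z Gz; rewrite /B.
  dvf.
  rewrite -(hA z Gz) /A; move: (cexp _) => e.
  by field; rewrite n1 n2.
have [n1 n2] := nG _ Gx0.
have B0 : B x0 != 0 by apply: mulf_neq0; [apply: mulf_neq0 => //; rewrite invr_neq0|exact: cexp_neq0].
have G2' : ~ G (x0 + 2) by rewrite /G /= f_zero_lat //; apply: lat2.
have Gt : ~ G (x0 + 2 * tau) by rewrite /G /= f_zero_lat //; apply: lat2t.
have E1 : cexp (2 * al) = 1.
  have := hB _ G2'; rewrite /B Hp1 addrAC Hp1.
  have -> : cexp (- (al * (x0 + 2))) = cexp (- (al * x0)) * cexp (- (2 * al)).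
    by rewrite -cexpD; congr cexp; ring.
  rewrite invrN mulrNN mulrA => H.
  have : cexp (- (2 * al)) = 1.
    by apply: (mulfI (x := B x0)) => //; rewrite mulr1.
  by rewrite cexpN => H1; rewrite -[cexp _]invrK H1 invr1.
have E2 : cexp (2 * al * tau + pI * w) = 1.
  have := hB _ Gt; rewrite /B addrAC !Hp2.
  have -> : cexp (- (al * (x0 + 2 * tau))) = cexp (- (al * x0)) * cexp (- (2 * al * tau)).
    by rewrite -cexpD; congr cexp; ring.
  have -> : cexp (- (pI * (x0 + w + tau))) = cexp (- (pI * (x0 + tau))) * cexp (- (pI * w)).
    by rewrite -cexpD; congr cexp; ring.
  have := cexp_neq0 (- (pI * (x0 + tau))); move: (cexp (- (pI * (x0 + tau)))) => e e0 H.
  have : cexp (- (2 * al * tau + pI * w)) = 1.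
    rewrite opprD cexpD; apply: (mulfI (x := B x0)) => //; rewrite mulr1 -[RHS]H /B.
    move: (cexp _) (cexp (- (pI * w))) (cexp (- (al * x0))) => a b c.
    by field; rewrite n1 e0.
  by rewrite cexpN => H1; rewrite -[cexp _]invrK H1 invr1.
have [m Em] := cexp_eq1 E1; have [n En] := cexp_eq1 E2.
apply/latP; exists n, (- m).
have p0 := pI_neq0 R; apply: (mulfI p0).
have -> : pI * w = (2 * al * tau + pI * w) - (2 * al) * tau by ring.
by rewrite En Em rmorphN /=; ring.
Qed.

End SigmaLike.

(** * The logarithmic derivatives and their differential equation *)

Section Bounded.
Variable R : realType.
Local Notation C := R[i].

(** Boundedness near the origin, whatever the value at the origin. *)
Definition bdd (F : C -> C) := exists M d : R, 0 < d /\
  forall z, z != 0 -> nrm z < d -> nrm (F z) <= M.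

Lemma bdd_cst c : bdd (fun=> c).
Proof. by exists (nrm c), 1. Qed.

Lemma bdd_id : bdd (fun z => z).
Proof. by exists 1, 1; split=> // z _ /ltW. Qed.

Lemma bddD F G : bdd F -> bdd G -> bdd (fun z => F z + G z).
Proof.
move=> [M [d [d0 hF]]] [N [e [e0 hG]]]; exists (M + N), (Num.min d e); split.
  by rewrite lt_min d0.
by move=> z z0; rewrite lt_min => /andP[zd ze]; rewrite (le_trans (nrmD _ _)) // lerD ?hF ?hG.
Qed.

Lemma bddN F : bdd F -> bdd (fun z => - F z).
Proof. by move=> [M [d [d0 hF]]]; exists M, d; split=> // z z0 zd; rewrite nrmN hF. Qed.

Lemma bddM F G : bdd F -> bdd G -> bdd (fun z => F z * G z).
Proof.
move=> [M [d [d0 hF]]] [N [e [e0 hG]]]; exists (M * N), (Num.min d e); split.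
  by rewrite lt_min d0.
move=> z z0; rewrite lt_min => /andP[zd ze]; rewrite nrmM ler_pM ?nrm_ge0 ?hF ?hG //.
Qed.

Lemma bddX F n : bdd F -> bdd (fun z => F z ^+ n).
Proof.
move=> hF; elim: n => [|n IH]; first exact: bdd_cst.
have -> : (fun z => F z ^+ n.+1) = (fun z => F z * F z ^+ n) by apply/funext => z; rewrite exprS.
exact: bddM.
Qed.

Lemma bdd_ext F G : (exists2 d : R, 0 < d & forall z, z != 0 -> nrm z < d -> F z = G z) -> bdd F -> bdd G.
Proof.
move=> [e e0 FG] [M [d [d0 hF]]]; exists M, (Num.min d e); split; first by rewrite lt_min d0.
by move=> z z0; rewrite lt_min => /andP[zd ze]; rewrite -FG // hF.
Qed.

Lemma bdd_inv c G : c != 0 -> bdd G -> bdd (fun z => (c + z * G z)^-1).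
Proof.
move=> c0 [M [d [d0 hG]]].
have cp : 0 < nrm c by rewrite nrm_gt0.
have M1 : 0 < `|M| + 1 by rewrite ltr_wpDl.
exists (nrm c / 2)^-1, (Num.min d (nrm c / 2 / (`|M| + 1))); split.
  by rewrite lt_min d0 !divr_gt0.
move=> z z0; rewrite lt_min => /andP[zd zc]; rewrite nrmV.
have h : nrm (z * G z) <= nrm c / 2.
  rewrite nrmM; move: zc; rewrite ltr_pdivlMr // => /ltW; apply: le_trans.
  rewrite ler_wpM2l ?nrm_ge0 // (le_trans (hG z z0 zd)) // (le_trans (ler_norm _)) // lerDl //.
have h2 : nrm c / 2 <= nrm (c + z * G z).
  by have := nrm_sub c (- (z * G z)); rewrite nrmN opprK; lra.
have c2 : 0 < nrm c / 2 by rewrite divr_gt0.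
by rewrite lef_pV2 ?posrE // (lt_le_trans c2).
Qed.

End Bounded.

Ltac bdd_rec := first
  [ assumption | exact: bdd_cst | exact: bdd_id
  | notypeclasses refine (bddD _ _); bdd_rec
  | notypeclasses refine (bddN _); bdd_rec
  | notypeclasses refine (bddM _ _); bdd_rec
  | notypeclasses refine (bddX _ _); bdd_rec ].

Section Elliptic.
Variable R : realType.
Local Notation C := R[i].
Local Notation pI := (pIR R).
Variables (tau : C) (f E O : nat -> C -> C).
Hypothesis HS : theta_like tau f E O.
Let t0 := tl_im HS.
Let Hf := tl_f HS.
Let HE := tl_E HS.
Let HO := tl_O HS.
Let Hadd := tl_add HS.
Let Hodd := tl_odd HS.
Let Hp1 := tl_per1 HS.
Let Hp2 := tl_per2 HS.

Ltac fl := first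
 [ notypeclasses refine (dv_comp (Hf _ _) _); dv_rec fail
 | notypeclasses refine (dv_comp (HE _ _) _); dv_rec fail
 | notypeclasses refine (dv_comp (HO _ _) _); dv_rec fail
 | notypeclasses refine (dv_comp (cexp_derive _) _); dv_rec fail ].
Ltac dvf := dv_by fl.

Let f00 : f 0 0 = 0. Proof. exact: (f_even0 HS). Qed.
Let f20 : f 2 0 = 0. Proof. exact: (f_even0 HS). Qed.
Let f40 : f 4 0 = 0. Proof. exact: (f_even0 HS). Qed.
Let c := f 1 0.
Let c0 : c != 0. Proof. exact: (f1_neq0 HS). Qed.
Let d := f 3 0.

Let two : (2 : C) != 0. Proof. by rewrite pnatr_eq0. Qed.

Lemma f_neq0 z : ~ lattice tau z -> f 0 z != 0.
Proof. by move=> zl; apply/eqP => /(f_zeros HS). Qed.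

(** By the addition formula the left side is a combination of f^2 and
    f f'' - f'^2; its coefficients are read off from the derivatives at 0. *)
Lemma hirota x : c ^+ 2 * (f 0 x * f 4 x - 4 * f 1 x * f 3 x + 3 * f 2 x ^+ 2) =
  (d ^+ 2 - c * f 5 0) * f 0 x ^+ 2 + 4 * d * c * (f 0 x * f 2 x - f 1 x ^+ 2).
Proof.
have [p [q H]] : exists p q, forall x, 2 * f 0 x * f 4 x - 8 * f 1 x * f 3 x + 6 * f 2 x ^+ 2 =
    p * f 0 x ^+ 2 + q * (2 * (f 0 x * f 2 x - f 1 x ^+ 2)).
  have Hd := det_EO HS; rewrite -/c in Hd.
  have n0 : 2 * c ^+ 2 != 0 by rewrite mulf_neq0 // expf_neq0.
  exists ((O 4 0 * E 2 0 - E 4 0 * O 2 0) / (2 * c ^+ 2)), ((O 0 0 * E 4 0 - E 0 0 * O 4 0) / (2 * c ^+ 2)) => y.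
  rewrite (G4 HS) (G0 HS); have := G2 HS y; rewrite /D2 => ->.
  have lin (k u v u' v' : C) : u / k * u' + v / k * v' = (u * u' + v * v') / k by ring.
  by rewrite lin; apply: (mulIf n0); rewrite divfK // -Hd; ring.
have H1 := H 0; rewrite f00 f20 f40 -/c -/d in H1.
have Hq : q = 4 * d / c.
  apply: (mulIf (x := c ^+ 2)); first by rewrite expf_neq0.
  have -> : 4 * d / c * c ^+ 2 = 4 * c * d by field.
  by apply: (mulfI (x := - 2)); [rewrite oppr_eq0|apply: etrans (etrans (esym H1) _); ring].
have D1 y : 2 * f 0 y * f 5 y - 6 * f 1 y * f 4 y + 4 * f 2 y * f 3 y =
    p * (2 * f 0 y * f 1 y) + q * (2 * (f 0 y * f 3 y - f 1 y * f 2 y)).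
  notypeclasses refine (dv_eqfun (z := y) H _ _); dvf; ring.
have DD : 2 * f 0 0 * f 6 0 - 4 * f 1 0 * f 5 0 - 2 * f 2 0 * f 4 0 + 4 * f 3 0 ^+ 2 =
    p * (2 * f 1 0 ^+ 2 + 2 * f 0 0 * f 2 0) + q * (2 * (f 0 0 * f 4 0 - f 2 0 ^+ 2)).
  notypeclasses refine (dv_eqfun (z := 0) D1 _ _); dvf; ring.
rewrite f00 f20 f40 -/c -/d in DD.
have Hp : p = 2 * (d ^+ 2 - c * f 5 0) / c ^+ 2.
  apply: (mulIf (x := 2 * c ^+ 2)); first by rewrite mulf_neq0 // expf_neq0.
  have -> : 2 * (d ^+ 2 - c * f 5 0) / c ^+ 2 * (2 * c ^+ 2) = 4 * (d ^+ 2 - c * f 5 0) by field.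
  by apply: etrans (etrans (esym DD) _); ring.
apply: (mulfI two).
have -> : 2 * (c ^+ 2 * (f 0 x * f 4 x - 4 * f 1 x * f 3 x + 3 * f 2 x ^+ 2)) =
  c ^+ 2 * (2 * f 0 x * f 4 x - 8 * f 1 x * f 3 x + 6 * f 2 x ^+ 2) by ring.
by rewrite H Hp Hq; field.
Qed.

Definition ell_L (x : C) : C := f 1 x / f 0 x.
Definition ell_P (x : C) : C := (f 1 x ^+ 2 - f 0 x * f 2 x) / f 0 x ^+ 2.
Definition ell_P1 (x : C) : C :=
  (3 * f 0 x * f 1 x * f 2 x - 2 * f 1 x ^+ 3 - f 0 x ^+ 2 * f 3 x) / f 0 x ^+ 3.
Definition ell_a : C := - d / (3 * c).
Definition ell_b : C := (c * f 5 0 - d ^+ 2) / c ^+ 2.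
Local Notation L := ell_L.
Local Notation P := ell_P.
Local Notation P1 := ell_P1.
Local Notation a := ell_a.
Local Notation b := ell_b.

Lemma L_derive x : ~ lattice tau x -> is_derive x 1 L (- P x).
Proof. by move=> /f_neq0 nx; rewrite /L /P; dvf; field. Qed.

Lemma P_derive x : ~ lattice tau x -> is_derive x 1 P (P1 x).
Proof.
move=> /f_neq0 nx; rewrite /P /P1.
have nx2 : f 0 x ^+ 2 != 0 by rewrite expf_neq0.
by dvf; field.
Qed.

Lemma P1_derive x : ~ lattice tau x -> is_derive x 1 P1 (6 * P x ^+ 2 - 12 * a * P x + b).
Proof.
move=> /f_neq0 nx; rewrite /P /P1.
have nx3 : f 0 x ^+ 3 != 0 by rewrite expf_neq0.
dvf; rewrite /a /b.
have H := hirota x.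
have -> : f 4 x = (((d ^+ 2 - c * f 5 0) * f 0 x ^+ 2 + 4 * d * c * (f 0 x * f 2 x - f 1 x ^+ 2)) / c ^+ 2
   + 4 * f 1 x * f 3 x - 3 * f 2 x ^+ 2) / f 0 x.
  by rewrite -H; field; rewrite nx c0.
by field; rewrite nx c0.
Qed.

Lemma padd x y : (f 0 x * f 2 x - f 1 x ^+ 2) * f 0 y ^+ 2 - (f 0 y * f 2 y - f 1 y ^+ 2) * f 0 x ^+ 2 =
  c ^+ 2 * (f 0 (x + y) * f 0 (x - y)).
Proof.
have Hd := det_EO HS; rewrite -/c in Hd; apply: (mulfI two).
have -> : 2 * (c ^+ 2 * (f 0 (x + y) * f 0 (x - y))) = (2 * c ^+ 2) * (f 0 (x + y) * f 0 (x - y)) by ring.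
rewrite -Hd Hadd.
have := G2 HS x; have := G2 HS y; rewrite /D2 => e1 e2.
have -> : 2 * ((f 0 x * f 2 x - f 1 x ^+ 2) * f 0 y ^+ 2 - (f 0 y * f 2 y - f 1 y ^+ 2) * f 0 x ^+ 2) =
  (2 * (f 0 x * f 2 x - f 1 x ^+ 2)) * f 0 y ^+ 2 - (2 * (f 0 y * f 2 y - f 1 y ^+ 2)) * f 0 x ^+ 2 by ring.
by rewrite e1 e2 !(G0 HS); ring.
Qed.

Lemma P_sub x y : ~ lattice tau x -> ~ lattice tau y ->
  P y - P x = c ^+ 2 * (f 0 (x + y) * f 0 (x - y)) / (f 0 x ^+ 2 * f 0 y ^+ 2).
Proof.
by move=> /f_neq0 nx /f_neq0 ny; rewrite -padd /P; field; rewrite nx ny.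
Qed.

(** The y-derivative of padd at y = x. *)
Lemma f_dup x : c ^+ 3 * f 0 (2 * x) =
  f 0 x * (f 0 x ^+ 2 * f 3 x - 3 * f 0 x * f 1 x * f 2 x + 2 * f 1 x ^+ 3).
Proof.
have H : (f 0 x * f 2 x - f 1 x ^+ 2) * (2 * f 0 x * f 1 x) - (f 0 x * f 3 x - f 1 x * f 2 x) * f 0 x ^+ 2 =
    c ^+ 2 * (f 1 (x + x) * f 0 (x - x) - f 0 (x + x) * f 1 (x - x)).
  notypeclasses refine (dv_eqfun (z := x) (padd x) _ _); dvf; ring.
rewrite subrr f00 -/c in H.
have -> : 2 * x = x + x by ring.
have -> : c ^+ 3 * f 0 (x + x) = - (c ^+ 2 * (f 1 (x + x) * 0 - f 0 (x + x) * c)) by ring.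
by rewrite -H; ring.
Qed.

Lemma P1_dup x : ~ lattice tau x -> P1 x * f 0 x ^+ 4 = - (c ^+ 3 * f 0 (2 * x)).
Proof. by move=> /f_neq0 nx; rewrite f_dup /P1; field. Qed.

Lemma f_per2 (z : C) : let e := cexp (- (pI * (z + tau))) in
  [/\ f 1 (z + 2 * tau) = - e * (f 1 z - pI * f 0 z),
      f 2 (z + 2 * tau) = - e * (f 2 z - 2 * pI * f 1 z + pI ^+ 2 * f 0 z) &
      f 3 (z + 2 * tau) = - e * (f 3 z - 3 * pI * f 2 z + 3 * pI ^+ 2 * f 1 z - pI ^+ 3 * f 0 z)].
Proof.
have H1 y : f 1 (y + 2 * tau) = - cexp (- (pI * (y + tau))) * (f 1 y - pI * f 0 y).
  notypeclasses refine (dv_eqfun (z := y) Hp2 _ _); dvf; ring.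
have H2 y : f 2 (y + 2 * tau) = - cexp (- (pI * (y + tau))) * (f 2 y - 2 * pI * f 1 y + pI ^+ 2 * f 0 y).
  notypeclasses refine (dv_eqfun (z := y) H1 _ _); dvf; ring.
have H3 y : f 3 (y + 2 * tau) = - cexp (- (pI * (y + tau))) *
   (f 3 y - 3 * pI * f 2 y + 3 * pI ^+ 2 * f 1 y - pI ^+ 3 * f 0 y).
  notypeclasses refine (dv_eqfun (z := y) H2 _ _); dvf; ring.
by split.
Qed.

Lemma P1_per1 x : ~ lattice tau x -> P1 (x + 2) = P1 x.
Proof. by move=> /f_neq0 nx; rewrite /P1 !Hp1; field. Qed.

Lemma P1_per2 x : ~ lattice tau x -> P1 (x + 2 * tau) = P1 x.
Proof.
move=> /f_neq0 nx; rewrite /P1 Hp2; have [-> -> ->] := f_per2 x.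
have := cexp_neq0 (- (pI * (x + tau))); move: (cexp _) => e e0.
by field; rewrite nx e0.
Qed.

Lemma P1_odd x : ~ lattice tau x -> P1 (- x) = - P1 x.
Proof. by move=> /f_neq0 nx; rewrite /P1 !Hodd; field. Qed.

Lemma P1_lat x w : ~ lattice tau x -> lattice tau w -> P1 (x + w) = P1 x.
Proof.
move=> xl /latP[m [n ->]].
have step (v : C) : lattice tau v -> (forall y, ~ lattice tau y -> P1 (y + v) = P1 y) ->
    forall (k : int) y, ~ lattice tau y -> P1 (y + v * k%:~R) = P1 y.
  move=> lv Hv.
  have N (k : nat) y : ~ lattice tau y -> P1 (y + v * k%:R) = P1 y.
    elim: k y => [|k IH] y yl; first by rewrite mulr0 addr0.
    rewrite -natr1 mulrDr mulr1 addrA Hv ?IH //.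
    rewrite lat_shift //; elim: {IH} k => [|k IH]; first by rewrite mulr0; apply: lat0.
    by rewrite -natr1 mulrDr mulr1; apply: latD.
  move=> [k|k] y yl; first exact: N.
  rewrite NegzE mulrNz mulrN -[in RHS](subrK (v * k.+1%:R) y) N //.
  move=> H; apply: yl; rewrite -(subrK (v * k.+1%:R) y); apply: latD => //.
  elim: {H} k.+1 => [|j IH]; first by rewrite mulr0; apply: lat0.
  by rewrite -natr1 mulrDr mulr1; apply: latD.
rewrite addrA step //; first last.
- have l2 : lattice tau (2 * m%:~R) by apply/latP; exists m, 0; rewrite mulr0 addr0.
  by move=> H; apply: xl; rewrite -(addrK (2 * m%:~R) x); apply: latD => //; apply: latN.
- exact: P1_per2.
- exact: lat2t.
by apply: step => //; [exact: lat2|exact: P1_per1].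
Qed.

End Elliptic.

(** * Half-periods and duplication *)

Section Duplication.
Variable R : realType.
Local Notation C := R[i].
Local Notation pI := (pIR R).
Variables (tau : C) (f E O : nat -> C -> C).
Hypothesis HS : theta_like tau f E O.
Let t0 := tl_im HS.
Let Hf := tl_f HS.
Let c0 : f 1 0 != 0. Proof. exact: (f1_neq0 HS). Qed.
Local Notation c := (f 1 0).
Local Notation L := (ell_L f).
Local Notation P := (ell_P f).
Local Notation P1 := (ell_P1 f).
Local Notation a := (ell_a f).
Local Notation b := (ell_b f).
Let two : (2 : C) != 0. Proof. by rewrite pnatr_eq0. Qed.

Lemma dv_eq_near (N F G : C -> C) (z l m : C) : {for z, continuous N} -> N z != 0 ->
  (forall y, N y != 0 -> F y = G y) -> is_derive z 1 F l -> is_derive z 1 G m -> l = m.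
Proof.
move=> cN Nz FG dF dG; have [r r0 Hr] := cont_neq0 cN Nz.
apply: dv_unique dG; apply: (dv_ext r0 _ dF) => h /Hr; exact: FG.
Qed.

Lemma lat_half (m n : int) : lattice tau (m%:~R + tau * n%:~R) ->
  exists m' n' : int, m = 2 * m' /\ n = 2 * n'.
Proof.
move=> /latP[m' [n' e]]; exists m', n'.
have : (m - 2 * m')%:~R + tau * (n - 2 * n')%:~R = 0 :> C.
  have -> : (m - 2 * m')%:~R + tau * (n - 2 * n')%:~R =
    (m%:~R + tau * n%:~R) - (2 * m'%:~R + 2 * tau * n'%:~R) :> C.
    by rewrite !intrB !intrM; ring.
  by rewrite e subrr.
by move=> /(lat_half_notin t0)[]; lia.
Qed.

Definition half_period (i : 'I_3) : C := nth 0 [:: 1; tau; 1 + tau] i.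

Lemma half_lat i : ~ lattice tau (half_period i).
Proof.
have H (m n : int) (z : C) : z = m%:~R + tau * n%:~R -> lattice tau z ->
   exists m' n' : int, m = 2 * m' /\ n = 2 * n' by move=> -> /lat_half.
case: i => [[|[|[|//]]] hi]; rewrite /half_period /=.
- by move=> /(H 1 0); rewrite mulr0 addr0 => /(_ erefl)[m [n [h1 h2]]]; lia.
- by move=> /(H 0 1); rewrite mulr1 add0r => /(_ erefl)[m [n [h1 h2]]]; lia.
- by move=> /(H 1 1); rewrite mulr1 => /(_ erefl)[m [n [h1 h2]]]; lia.
Qed.

Lemma half2_lat i : lattice tau (half_period i + half_period i).
Proof.
case: i => [[|[|[|//]]] hi]; rewrite /half_period /=; apply/latP.
- by exists 1, 0; rewrite mulr0; ring.
- by exists 0, 1; rewrite mulr0 mulr1; ring.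
- by exists 1, 1; rewrite !mulr1; ring.
Qed.

Lemma half_lat2 i j : i != j -> ~ lattice tau (half_period i - half_period j).
Proof.
have H (m n : int) (z : C) : z = m%:~R + tau * n%:~R -> lattice tau z ->
   exists m' n' : int, m = 2 * m' /\ n = 2 * n' by move=> -> /lat_half.
have K (z : C) : lattice tau z -> lattice tau (- z) by apply: latN.
case: i j => [[|[|[|//]]] hi] [[|[|[|//]]] hj] // _; rewrite /half_period /= => h.
- by case: (H 1 (-1) _ _ h) => [|m [n [h1 h2]]]; [rewrite mulrN1z mulr1z; ring|lia].
- by case: (H 0 (-1) _ _ h) => [|m [n [h1 h2]]]; [rewrite mulrN1z mulr0z; ring|lia].
- by case: (H (-1) 1 _ _ h) => [|m [n [h1 h2]]]; [rewrite mulrN1z mulr1z; ring|lia].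
- by case: (H (-1) 0 _ _ h) => [|m [n [h1 h2]]]; [rewrite mulrN1z mulr0z; ring|lia].
- by case: (H 0 1 _ _ h) => [|m [n [h1 h2]]]; [rewrite mulr1z mulr0z; ring|lia].
- by case: (H 1 0 _ _ h) => [|m [n [h1 h2]]]; [rewrite mulr1z mulr0z; ring|lia].
Qed.

Lemma half_lat3 i j : i != j -> ~ lattice tau (half_period i + half_period j).
Proof.
move=> ij h; apply: (half_lat2 ij).
have -> : half_period i - half_period j = half_period i + half_period j - (half_period j + half_period j) by ring.
by apply: latD => //; apply: latN; apply: half2_lat.
Qed.

(** P1 is odd, and a half-period differs from its opposite by a period. *)
Lemma P1_half i : P1 (half_period i) = 0.
Proof.
have h := P1_odd HS (@half_lat i).
have := P1_lat HS (x := - half_period i) (w := half_period i + half_period i); rewrite addKr h => /(_ _ (half2_lat i)) e.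
have nl : ~ lattice tau (- half_period i) by move=> /latN; rewrite opprK; apply: half_lat.
apply: (mulfI two); rewrite mulr0.
have -> : 2 * P1 (half_period i) = P1 (half_period i) + P1 (half_period i) by ring.
by rewrite {1}(e nl) addNr.
Qed.

Lemma P_half_neq i j : i != j -> P (half_period i) != P (half_period j).
Proof.
move=> ij; rewrite eq_sym -subr_eq0 (P_sub HS (@half_lat _) (@half_lat _)).
have n i' := f_neq0 HS (@half_lat i'); have n1 := f_neq0 HS (half_lat3 ij); have n2 := f_neq0 HS (half_lat2 ij).
by rewrite !mulf_neq0 // ?expf_neq0 // ?invr_eq0 ?mulf_neq0 ?expf_neq0.
Qed.

Lemma cubic : exists g, forall x, ~ lattice tau x ->
  P1 x ^+ 2 = 4 * P x ^+ 3 - 12 * a * P x ^+ 2 + 2 * b * P x + g.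
Proof.
pose F x := P1 x ^+ 2 - (4 * (P x * P x ^+ 2) - 12 * a * P x ^+ 2 + 2 * b * P x).
exists (F (half_period ord0)) => x xl.
suff -> : F (half_period ord0) = F x by rewrite /F; ring.
apply: (const_off_countable (@countable_lat _ tau) _ (@half_lat _) xl) => z zl.
have d1 := P_derive HS zl; have d2 := P1_derive HS zl.
rewrite /F; dv_by ltac:(eassumption); ring.
Qed.

Lemma quad0 (A B D x y z : C) : x != y -> y != z -> x != z ->
  A * x ^+ 2 + B * x + D = 0 -> A * y ^+ 2 + B * y + D = 0 -> A * z ^+ 2 + B * z + D = 0 ->
  [/\ A = 0, B = 0 & D = 0].
Proof.
rewrite -(subr_eq0 x y) -(subr_eq0 y z) -(subr_eq0 x z) => xy yz xz hx hy hz.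
have h1 : A * (x + y) + B = 0.
  apply: (mulfI xy); rewrite mulr0.
  have -> : (x - y) * (A * (x + y) + B) = (A * x ^+ 2 + B * x + D) - (A * y ^+ 2 + B * y + D) by ring.
  by rewrite hx hy subrr.
have h2 : A * (y + z) + B = 0.
  apply: (mulfI yz); rewrite mulr0.
  have -> : (y - z) * (A * (y + z) + B) = (A * y ^+ 2 + B * y + D) - (A * z ^+ 2 + B * z + D) by ring.
  by rewrite hy hz subrr.
have A0 : A = 0.
  apply: (mulfI xz); rewrite mulr0.
  have -> : (x - z) * A = (A * (x + y) + B) - (A * (y + z) + B) by ring.
  by rewrite h1 h2 subrr.
move: h1 hx; rewrite A0 mul0r add0r => B0; rewrite B0 !mul0r !add0r => D0; by split.
Qed.

Let i0 : 'I_3 := ord0.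
Let i1 : 'I_3 := inord 1.
Let i2 : 'I_3 := inord 2.
Let i01 : i0 != i1. Proof. by rewrite -val_eqE /= inordK. Qed.
Let i02 : i0 != i2. Proof. by rewrite -val_eqE /= inordK. Qed.
Let i12 : i1 != i2. Proof. by rewrite -val_eqE /= !inordK. Qed.

(** Both sides are cubics in P with leading coefficient 4 that vanish at the
    three distinct values of P at the half-periods. *)
Lemma cubic_factor x : ~ lattice tau x -> P1 x ^+ 2 =
  4 * ((P x - P (half_period i0)) * (P x - P (half_period i1)) * (P x - P (half_period i2))).
Proof.
have [g H] := cubic; have h i := H _ (@half_lat i).
have n01 := P_half_neq i01; have n02 := P_half_neq i02; have n12 := P_half_neq i12.
move=> /H ->; have e0 := h i0; have e1 := h i1; have e2 := h i2.
rewrite P1_half expr0n /= in e0; rewrite P1_half expr0n /= in e1; rewrite P1_half expr0n /= in e2.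
move: n01 n02 n12 e0 e1 e2; move: (P (half_period i0)) (P (half_period i1)) (P (half_period i2)) (P x) => p q r X pq pr qr e0 e1 e2.
have [|||A0 B0 D0] := @quad0 (- 12 * a + 4 * (p + q + r)) (2 * b - 4 * (p * q + q * r + p * r))
  (g + 4 * (p * q * r)) p q r pq qr pr.
- by rewrite [RHS]e0; ring.
- by rewrite [RHS]e1; ring.
- by rewrite [RHS]e2; ring.
have -> : 4 * X ^+ 3 - 12 * a * X ^+ 2 + 2 * b * X + g = 4 * ((X - p) * (X - q) * (X - r)) +
  (- 12 * a + 4 * (p + q + r)) * X ^+ 2 + (2 * b - 4 * (p * q + q * r + p * r)) * X
   + (g + 4 * (p * q * r)) by ring.
by rewrite A0 B0 D0 !mul0r !addr0.
Qed.

Local Notation w0 := (half_period i0).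
Local Notation w1 := (half_period i1).
Local Notation w2 := (half_period i2).

(** P1_dup and P_sub turn the factored cubic into a relation between values of f. *)
Lemma f_dup2 : exists2 K, K != 0 & forall x, f 0 (2 * x) ^+ 2 = K * (f 0 x ^+ 2 *
  (f 0 (w0 + x) * f 0 (w0 - x)) * (f 0 (w1 + x) * f 0 (w1 - x)) * (f 0 (w2 + x) * f 0 (w2 - x))).
Proof.
have n i := f_neq0 HS (@half_lat i); have n0 := n i0; have n1 := n i1; have n2 := n i2.
exists (4 / (f 0 w0 ^+ 2 * f 0 w1 ^+ 2 * f 0 w2 ^+ 2)) => [|x].
  by rewrite !mulf_neq0 ?invr_eq0 ?mulf_neq0 ?expf_neq0 // pnatr_eq0.
have [xl|xl] := pselect (lattice tau x).
  have -> : f 0 x = 0 by apply/(f_zeros HS).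
  have -> : f 0 (2 * x) = 0.
    apply/(f_zeros HS); have -> : 2 * x = x + x by ring.
    exact: latD.
  by rewrite expr0n /= !mul0r mulr0.
have nx := f_neq0 HS xl.
have hd := P1_dup HS xl; have hc := cubic_factor xl.
rewrite !(P_sub HS (@half_lat _) xl) in hc.
have c6 : c ^+ 6 != 0 by rewrite expf_neq0.
apply: (mulfI c6).
have -> : c ^+ 6 * f 0 (2 * x) ^+ 2 = P1 x ^+ 2 * f 0 x ^+ 8.
  have -> : P1 x ^+ 2 * f 0 x ^+ 8 = (P1 x * f 0 x ^+ 4) ^+ 2 by ring.
  by rewrite hd; ring.
by rewrite hc; field; rewrite n0 n1 n2 nx.
Qed.

Lemma lat_double x : ~ lattice tau (2 * x) -> [/\ ~ lattice tau x,
  forall i, ~ lattice tau (half_period i + x) & forall i, ~ lattice tau (half_period i - x)].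
Proof.
move=> h; split=> [xl|i xl|i xl]; apply: h.
- have -> : 2 * x = x + x by ring.
  exact: latD.
- have -> : 2 * x = (half_period i + x) + (half_period i + x) - (half_period i + half_period i) by ring.
  by apply: latD; [apply: latD|apply: latN; apply: half2_lat].
- have -> : 2 * x = (half_period i + half_period i) - ((half_period i - x) + (half_period i - x)) by ring.
  by apply: latD; [apply: half2_lat|apply: latN; apply: latD].
Qed.

(** The logarithmic derivative of f_dup2. *)
Lemma L_dup x : f 0 (2 * x) != 0 -> 4 * L (2 * x) = 2 * L x +
  (L (w0 + x) - L (w0 - x)) + (L (w1 + x) - L (w1 - x)) + (L (w2 + x) - L (w2 - x)).
Proof.
move=> n2x; have h : ~ lattice tau (2 * x) by move=> /(f_zeros HS) e; rewrite e eqxx in n2x.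
have [xl hp hm] := lat_double h.
have nx := f_neq0 HS xl; have np i := f_neq0 HS (hp i); have nm i := f_neq0 HS (hm i).
have [K K0 HK] := f_dup2.
have dl : is_derive x 1 (fun x => f 0 (2 * x) ^+ 2) (4 * f 0 (2 * x) * f 1 (2 * x)).
  by dv_by ltac:(notypeclasses refine (dv_comp (Hf _ _) _); dv_rec fail); ring.
have := dv_eqfun HK dl => /(_ _ _) H.
have {}H : 4 * f 0 (2 * x) * f 1 (2 * x) = K * (f 0 x ^+ 2 *
  (f 0 (w0 + x) * f 0 (w0 - x)) * (f 0 (w1 + x) * f 0 (w1 - x)) * (f 0 (w2 + x) * f 0 (w2 - x))) *
   (2 * L x +
  (L (w0 + x) - L (w0 - x)) + (L (w1 + x) - L (w1 - x)) + (L (w2 + x) - L (w2 - x))).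
  apply: H; dv_by ltac:(notypeclasses refine (dv_comp (Hf _ _) _); dv_rec fail).
  rewrite /L; have := (np i0, np i1, np i2, (nm i0, nm i1, nm i2)) => -[[[a0 a1] a2] [[b0 b1] b2]].
  by field; rewrite nx a0 a1 a2 b0 b1 b2.
rewrite -HK in H; apply: (mulfI (x := f 0 (2 * x) ^+ 2)); first by rewrite expf_neq0.
by rewrite -H /L; field.
Qed.

Let cf (x : C) : {for x, continuous (fun y : C => f 0 (2 * y))}.
Proof.
apply: (@dv_cont _ _ _ (2 * f 1 (2 * x))).
by dv_by ltac:(notypeclasses refine (dv_comp (Hf _ _) _); dv_rec fail); ring.
Qed.

(** Differentiate L_dup twice; P1 is odd and periodic. *)
Lemma P1_halves x : ~ lattice tau (2 * x) ->
  8 * P1 (2 * x) = P1 x + P1 (x + w0) + P1 (x + w1) + P1 (x + w2).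
Proof.
have HP y : f 0 (2 * y) != 0 -> 8 * P (2 * y) = 2 * P y +
  (P (w0 + y) + P (w0 - y)) + (P (w1 + y) + P (w1 - y)) + (P (w2 + y) + P (w2 - y)).
  move=> n; have h : ~ lattice tau (2 * y) by move=> /(f_zeros HS) e; rewrite e eqxx in n.
  have [yl hp hm] := lat_double h.
  apply: oppr_inj; notypeclasses refine (dv_eq_near (cf (x := y)) n L_dup _ _).
    by dv_by ltac:(notypeclasses refine (dv_comp (L_derive HS _) _); [assumption || solve [auto]|dv_rec fail]); ring.
  by dv_by ltac:(notypeclasses refine (dv_comp (L_derive HS _) _); [assumption || solve [auto]|dv_rec fail]); ring.
move=> h; have [xl hp hm] := lat_double h; have n := f_neq0 HS h.
have e i : P1 (half_period i - x) = - P1 (half_period i + x).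
  have -> : half_period i - x = - (x + half_period i) + (half_period i + half_period i) by ring.
  have nl : ~ lattice tau (x + half_period i) by rewrite addrC.
  have nl' : ~ lattice tau (- (x + half_period i)) by move=> /latN; rewrite opprK.
  by rewrite (P1_lat HS nl' (half2_lat i)) (P1_odd HS nl) addrC.
have H : 16 * P1 (2 * x) = 2 * P1 x +
  (P1 (w0 + x) - P1 (w0 - x)) + (P1 (w1 + x) - P1 (w1 - x)) + (P1 (w2 + x) - P1 (w2 - x)).
  notypeclasses refine (dv_eq_near (cf (x := x)) n HP _ _).
    by dv_by ltac:(notypeclasses refine (dv_comp (P_derive HS _) _); [assumption || solve [auto]|dv_rec fail]); ring.
  by dv_by ltac:(notypeclasses refine (dv_comp (P_derive HS _) _); [assumption || solve [auto]|dv_rec fail]); ring.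
apply: (mulfI two); have -> : 2 * (8 * P1 (2 * x)) = 16 * P1 (2 * x) by ring.
by rewrite H !e ![x + _]addrC; ring.
Qed.

End Duplication.

(** * Expansions at the origin *)

Section Laurent.
Variable R : realType.
Local Notation C := R[i].
Variables (tau : C) (f E O : nat -> C -> C).
Hypothesis HS : theta_like tau f E O.
Let Hf := tl_f HS.
Let c0 : f 1 0 != 0. Proof. exact: (f1_neq0 HS). Qed.
Local Notation c := (f 1 0).
Local Notation d := (f 3 0).
Local Notation L := (ell_L f).
Local Notation P := (ell_P f).
Local Notation P1 := (ell_P1 f).
Local Notation a := (ell_a f).

Lemma mvt_pow (F F' : C -> C) (M r : R) k : 0 <= M -> (forall z : C, is_derive z 1 F (F' z)) ->
  F 0 = 0 -> (forall z, nrm z < r -> nrm (F' z) <= M * nrm z ^+ k) ->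
  forall z, nrm z < r -> nrm (F z) <= M * nrm z ^+ k.+1.
Proof.
move=> M0 dF F0 FM z zr; rewrite exprSr mulrA; suff : nrm (F z - F 0) <= M * nrm z ^+ k * nrm (z - 0) by rewrite F0 !subr0.
apply: (mvt_ineq (F' := F')) => t /andP[t1 t2].
rewrite add0r subr0; have tz : nrm (t%:C * z) <= nrm z.
  by rewrite nrmM nrmR (ger0_norm t1) ler_piMl // nrm_ge0.
apply: le_trans (FM _ (le_lt_trans tz zr)) _.
by rewrite ler_wpM2l // lerXn2r // nnegrE nrm_ge0.
Qed.

Let r3 z := (f 3 z - d) / z.
Let r2 z := (f 2 z - d * z) / z ^+ 2.
Let r1 z := (f 1 z - c - d / 2 * z ^+ 2) / z ^+ 3.
Let r0 z := (f 0 z - c * z - d / 6 * z ^+ 3) / z ^+ 4.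

(** The remainders of the expansions of f''', f'', f' and f at 0 are bounded
    because f 4 is, by integrating step by step. *)
Lemma taylor : [/\ bdd r3, bdd r2, bdd r1 & bdd r0].
Proof.
have [r rp Hr] := cont_bound (dv_cont (Hf 4 0)).
set M := nrm (f 4 0) + 1 in Hr; have M0 : 0 <= M by rewrite addr_ge0 // nrm_ge0.
have B (F : C -> C) k : (forall z, nrm z < r -> nrm (F z) <= M * nrm z ^+ k) ->
    bdd (fun z => F z / z ^+ k).
  move=> HF; exists M, r; split=> // z z0 zr; rewrite nrmM nrmV nrmX.
  by rewrite ler_pdivrMr ?HF // exprn_gt0 // nrm_gt0.
have e2 : f 2 0 = 0 by apply: (f_even0 HS).
have e0 : f 0 0 = 0 by apply: (f_even0 HS).
have fl := Hf; have h3 : forall z, nrm z < r -> nrm (f 3 z - d) <= M * nrm z ^+ 1.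
  apply: (mvt_pow (F' := f 4)) => // [z||z zr]; [|by rewrite subrr|].
    by dv_by ltac:(exact: fl); ring.
  by have := Hr z zr; rewrite add0r expr0 mulr1.
have h2 : forall z, nrm z < r -> nrm (f 2 z - d * z) <= M * nrm z ^+ 2.
  apply: (mvt_pow (F' := fun z => f 3 z - d)) => // [z|]; last by rewrite e2 mulr0 subrr.
  by dv_by ltac:(exact: fl); ring.
have h1 : forall z, nrm z < r -> nrm (f 1 z - c - d / 2 * z ^+ 2) <= M * nrm z ^+ 3.
  apply: (mvt_pow (F' := fun z => f 2 z - d * z)) => // [z|]; last by rewrite expr0n mulr0 !subrr.
  by dv_by ltac:(exact: fl); field.
have h0 : forall z, nrm z < r -> nrm (f 0 z - c * z - d / 6 * z ^+ 3) <= M * nrm z ^+ 4.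
  apply: (mvt_pow (F' := fun z => f 1 z - c - d / 2 * z ^+ 2) M0 _ _ h1) => [z|].
    have -> : (fun z => f 0 z - c * z - d / 6 * z ^+ 3) = (fun z => f 0 z - c * z - d / 6 * (z * z ^+ 2)).
      by apply/funext => y; ring.
    by dv_by ltac:(exact: fl); field.
  by rewrite expr0n /= !mulr0 e0 !subrr.
by split; [exact: (B _ 1%N h3)|exact: B h2|exact: B h1|exact: B h0].
Qed.

Let al z := d / 6 + z * r0 z.
Let be z := d / 2 + z * r1 z.
Let u z := c + z * (z * al z).

Let f0E z : z != 0 -> f 0 z = z * u z. Proof. by move=> z0; rewrite /u /al /r0; field. Qed.
Let f1E z : z != 0 -> f 1 z = c + z ^+ 2 * be z. Proof. by move=> z0; rewrite /be /r1; field. Qed.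
Let f2E z : z != 0 -> f 2 z = d * z + z ^+ 2 * r2 z. Proof. by move=> z0; rewrite /r2; field. Qed.
Let f3E z : z != 0 -> f 3 z = d + z * r3 z. Proof. by move=> z0; rewrite /r3; field. Qed.

Let bal : bdd al. Proof. by have [? ? ? ?] := taylor; rewrite /al; bdd_rec. Qed.
Let bbe : bdd be. Proof. by have [? ? ? ?] := taylor; rewrite /be; bdd_rec. Qed.
Let bu : bdd u. Proof. by have h := bal; rewrite /u; bdd_rec. Qed.
Let buV : bdd (fun z => (u z)^-1).
Proof. by apply: bdd_inv => //; have h := bal; bdd_rec. Qed.
Let u_neq0 : exists2 r : R, 0 < r & forall z, z != 0 -> nrm z < r -> u z != 0.
Proof.
have [r r0' H] := f_isolated HS; exists r => // z z0 /(H z z0).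
by rewrite f0E // mulf_eq0 negb_or => /andP[].
Qed.

Lemma laurent_P1 : bdd (fun z => P1 z + 2 / z ^+ 3).
Proof.
have [b3 b2 b1 b0] := taylor; have hal := bal; have hbe := bbe; have hu := bu; have huV := buV.
(* the numerator of P1 z + 2 / z^3, in terms of u = f / z, divided by z^3 *)
pose S z := 6 * c ^+ 2 * (r0 z - r1 z) + 6 * c * z * (al z ^+ 2 - be z ^+ 2) +
  2 * z ^+ 3 * (al z ^+ 3 - be z ^+ 3) - u z ^+ 2 * r3 z
  + 3 * u z * (c + z ^+ 2 * be z) * r2 z
  + d * z * (c * al z + 3 * c * be z + z ^+ 2 * (3 * al z * be z - al z ^+ 2)).
have bS : bdd S.
  rewrite /S; clear -b3 b2 b1 b0 hal hbe hu huV; clearbody r0 r1 r2 r3 al be u; bdd_rec.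
apply: (bdd_ext (F := fun z => S z * (u z)^-1 ^+ 3)); last by bdd_rec.
have [r rp Hr] := u_neq0; exists r => // z z0 /(Hr z z0) uz.
have := c0; have [e de] : exists e, d = 6 * e by exists (d / 6); field.
rewrite /P1 (f0E z0) (f1E z0) (f2E z0) (f3E z0) /S /al /be; move: uz; rewrite /u /al.
move: (r0 z) (r1 z) (r2 z) (r3 z) => R0 R1 R2 R3.
have -> : d / 6 = e by rewrite de; field.
have -> : d / 2 = 3 * e by rewrite de; field.
rewrite de; move: c => k uz k0.
by field; rewrite z0 uz.
Qed.

Lemma laurent_P : bdd (fun z => (P z - z ^- 2 - a) / z).
Proof.
have [b3 b2 b1 b0] := taylor; have hal := bal; have hbe := bbe; have hu := bu; have huV := buV.
(* the numerator of (P z - z^-2 - a) / z over u^2 *)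
pose S z := d / 3 * z * (al z + be z) + (r1 z - r0 z) * (c + z ^+ 2 * be z + u z) - z * al z * d
 - u z * r2 z + d / (3 * c) * (2 * c * z * al z + z ^+ 3 * al z ^+ 2).
have bS : bdd S.
  rewrite /S; clear -b3 b2 b1 b0 hal hbe hu huV; clearbody r0 r1 r2 r3 al be u; bdd_rec.
apply: (bdd_ext (F := fun z => S z * (u z)^-1 ^+ 2)); last by bdd_rec.
have [r rp Hr] := u_neq0; exists r => // z z0 /(Hr z z0) uz.
have := c0; have [e de] : exists e, d = 6 * e by exists (d / 6); field.
rewrite /P /a (f0E z0) (f1E z0) (f2E z0) /S /al /be; move: uz; rewrite /u /al.
move: (r0 z) (r1 z) (r2 z) => R0 R1 R2.
have -> : d / 6 = e by rewrite de; field.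
have -> : d / 2 = 3 * e by rewrite de; field.
rewrite de; move: c => k uz k0.
by field; rewrite z0 uz k0.
Qed.

Lemma laurent_L : bdd (fun z => (L z - z^-1) / z).
Proof.
have hal := bal; have hbe := bbe; have huV := buV.
apply: (bdd_ext (F := fun z => (be z - al z) * (u z)^-1)); last by bdd_rec.
have [r rp Hr] := u_neq0; exists r => // z z0 /(Hr z z0) uz.
have := c0; have [e de] : exists e, d = 6 * e by exists (d / 6); field.
rewrite /L (f0E z0) (f1E z0) /al /be; move: uz; rewrite /u /al.
move: (r0 z) (r1 z) => R0 R1.
have -> : d / 6 = e by rewrite de; field.
have -> : d / 2 = 3 * e by rewrite de; field.
move: c => k uz k0.
by field; rewrite z0 uz.
Qed.

End Laurent.

(** * Sums over the lattice *)

Section LatticeSums.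
Variable R : realType.
Local Notation C := R[i].
Variable tau : C.
Hypothesis t0 : 0 < complex.Im tau.
Local Notation per := (period tau).
Implicit Types (p q : int * int) (z h : C).

Definition period_size p : nat := (`|p.1| + `|p.2|)%N.

Lemma per0 : per (0, 0) = 0.
Proof. by rewrite /period /= !mulr0 addr0. Qed.

Lemma perD p q : per (p.1 + q.1, p.2 + q.2) = per p + per q.
Proof. by rewrite /period /= !intrD; ring. Qed.

(** The imaginary part of a period bounds its second coordinate, and then its
    modulus bounds the first one. *)
Lemma per_lb : exists2 dl : R, 0 < dl & forall p, dl * (period_size p)%:R <= nrm (per p).
Proof.
pose v := complex.Im tau; have v0 : 0 < v := t0.
have k0 : 0 < 1 + (nrm tau + 1) / v.
  by rewrite ltr_pwDl // divr_ge0 ?addr_ge0 ?nrm_ge0 // ltW.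
exists (2 / (1 + (nrm tau + 1) / v)) => [|p]; first by rewrite divr_gt0.
rewrite mulrAC ler_pdivrMr // /period_size natrD !natr_absz.
set m := p.1; set n := p.2; set N := nrm (per p).
have Hn : 2 * (v * `|n%:~R|) <= N.
  apply: le_trans (Im_le _); rewrite /period -/m -/n -!(rmorph_int (real_complex R)).
  rewrite -(rmorph_nat (real_complex R)) /v; case: tau t0 => u v' /= v0'.
  rewrite !(mul0r, mulr0, add0r, addr0) !normrM (gtr0_norm v0') (ger0_norm (x := 2)) //.
  by rewrite mulrA.
have Hm : 2 * `|m%:~R| <= N + 2 * nrm tau * `|n%:~R|.
  have -> : 2 * `|m%:~R| = nrm (2 * m%:~R : C) by rewrite nrmM nrmn nrmz.
  have -> : 2 * nrm tau * `|n%:~R| = nrm (2 * tau * n%:~R) by rewrite !nrmM nrmn nrmz.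
  have -> : 2 * m%:~R = per p - 2 * tau * n%:~R :> C by rewrite /period -/m -/n; ring.
  exact: nrmBD.
have h3 : 2 * `|n%:~R| <= N / v by rewrite ler_pdivlMr //; lra.
have h4 : nrm tau * (2 * `|n%:~R|) <= nrm tau * (N / v) by rewrite ler_wpM2l // nrm_ge0.
have -> : N * (1 + (nrm tau + 1) / v) = N + nrm tau * (N / v) + N / v by ring.
rewrite intr_norm intr_norm in h3 *; lra.
Qed.

(** The distance from z to the lattice is at least s. *)
Definition sep z (s : R) := forall p, s <= nrm (z - per p).

Lemma sepD z h s : sep z s -> nrm h <= s / 2 -> sep (z + h) (s / 2).
Proof.
move=> H hs p; have := nrm_sub (z - per p) (- h); rewrite nrmN opprK => h1.
have := H p; have -> : z + h - per p = z - per p + h by ring.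
lra.
Qed.

(** Few periods are close to z, and s handles these; for the others the modulus
    of the period dominates. The constant k merges the two bounds. *)
Lemma period_dist_ge (rho s : R) : 0 < s -> exists2 k, 0 < k & forall z p, nrm z <= rho ->
  s <= nrm (z - per p) -> k * (period_size p).+1%:R <= nrm (z - per p).
Proof.
move=> s0; have [dl d0 H] := per_lb.
have r0 : 0 <= `|rho| by [].
have k0 : 0 < 1 + (`|rho| + dl) / s.
  by rewrite ltr_pwDl // divr_ge0 ?addr_ge0 // ltW.
exists (dl / (1 + (`|rho| + dl) / s)) => [|z p zr zp]; first by rewrite divr_gt0.
rewrite mulrAC ler_pdivrMr // -natr1.
have := H p; have := nrm_sub (per p) z; rewrite nrmB => h1 h2.
have h3 : (`|rho| + dl) <= nrm (z - per p) * ((`|rho| + dl) / s).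
  by rewrite mulrCA ler_peMr ?addr_ge0 // ?(ltW d0) // ler_pdivlMr ?mul1r.
have := ler_norm rho; lra.
Qed.

Lemma cube_le_q3 (k x : R) n : 0 < k -> k * n.+1%:R <= x -> (x ^+ 3)^-1 <= 6 / k ^+ 3 * q3 R n.
Proof.
move=> k0 kx; have n0 : 0 < n.+1%:R :> R by [].
have x0 : 0 < x by apply: lt_le_trans kx; rewrite mulr_gt0.
apply: (@le_trans _ _ ((k * n.+1%:R) ^+ 3)^-1).
  by rewrite lef_pV2 ?posrE ?exprn_gt0 ?mulr_gt0 // lerXn2r ?nnegrE // ltW // mulr_gt0.
rewrite /q3 exprMn invfM -mulrA [6 * _]mulrCA ler_pM2l ?invr_gt0 ?exprn_gt0 //.
rewrite ler_pdivlMr ?mulr_gt0 // mulrC ler_pdivrMr ?exprn_gt0 //.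
have -> : n.+3%:R = n.+1%:R + 2 :> R by rewrite -natrD addn2.
have -> : n.+2%:R = n.+1%:R + 1 :> R by rewrite natr1.
have : 1 <= n.+1%:R :> R by rewrite ler1n.
move: (n.+1%:R : R) => y y1.
have -> : 6 * y ^+ 3 = y * (y + 1) * (y + 2) + y * (y - 1) * (5 * y + 2) by ring.
by rewrite lerDl !mulr_ge0 //; lra.
Qed.

Lemma absum_cube (K : R) (F : int * int -> C) :
  (forall p, nrm (F p) <= K * q3 R (period_size p)) -> absum F.
Proof.
move=> H; apply: (absum_dom (c := K) (absum_q3 R)) => p.
by rewrite nrmR ger0_norm ?q3_ge0.
Qed.

Lemma sum_cube : exists2 M : R, 0 <= M & forall (K : R) (F : int * int -> C) s, hassum F s ->
  (forall p, nrm (F p) <= K * q3 R (period_size p)) -> nrm s <= K * M.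
Proof.
have [M HM] := absum_q3 R; exists M => [|K F s Fs FK].
  by apply: le_trans (HM fset0); rewrite big_nil.
have K0 : 0 <= K.
  have := FK (0, 0); rewrite /period_size /= => h.
  have : 0 <= K * q3 R 0 by apply: le_trans h; apply: nrm_ge0.
  by rewrite pmulr_lge0 // /q3 invr_gt0 !mulr_gt0.
apply: (hassum_nrm Fs) => A; apply: le_trans (ler_wpM2l K0 (HM A)).
rewrite big_distrr; apply: ler_sum => p _; rewrite [in leRHS]nrmR ger0_norm ?q3_ge0 //; exact: FK.
Qed.

Lemma hassum_single (I : choiceType) (i0 : I) (c : C) : hassum (fun i => if i == i0 then c else 0) c.
Proof.
apply/hassumP => e e0; exists [fset i0]%fset => B; rewrite fsub1set => iB.
rewrite (big_fsetD1 i0) //= eqxx big1_fset; first by rewrite addr0 subrr nrm0.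
by move=> i; rewrite !inE => /andP[/negPf -> _].
Qed.

(** By wp_derive the derivative of wp is -2 cubeQ. *)
Definition cubeQ z := summability.sum (fun p => (z - per p) ^- 3).

Lemma cube_bd (rho s : R) : 0 < s -> exists2 K, 0 <= K & forall z p, nrm z <= rho ->
  s <= nrm (z - per p) -> nrm ((z - per p) ^- 3) <= K * q3 R (period_size p).
Proof.
move=> s0; have [k k0 H] := period_dist_ge rho s0; exists (6 / k ^+ 3).
  by rewrite divr_ge0 // exprn_ge0 // ltW.
by move=> z p zr zp; rewrite nrmV nrmX; apply: cube_le_q3 (H z p zr zp).
Qed.

Lemma cubeQ_hassum z s : 0 < s -> sep z s -> hassum (fun p => (z - per p) ^- 3) (cubeQ z).
Proof.
move=> s0 zs; apply: absum_hassum; have [K _ HK] := cube_bd (nrm z) s0.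
by apply: (absum_cube (K := K)) => p; apply: HK.
Qed.

Lemma cubeQ_bd (rho s : R) : 0 < s ->
  exists M, forall z, nrm z <= rho -> sep z s -> nrm (cubeQ z) <= M.
Proof.
move=> s0; have [K _ HK] := cube_bd rho s0; have [M _ HM] := sum_cube.
by exists (K * M) => z zr zs; apply: HM (cubeQ_hassum s0 zs) _ => p; apply: HK.
Qed.

Lemma cubeQ_per z s q : 0 < s -> sep z s -> cubeQ (z + per q) = cubeQ z.
Proof.
move=> s0 zs; apply: hassum_sum.
apply: (hassum_reindex (h := fun p => (p.1 + q.1, p.2 + q.2))).
  by exists (fun p => (p.1 - q.1, p.2 - q.2)) => -[m n] /=; rewrite ?addrK ?subrK.
apply: eq_hassum (cubeQ_hassum s0 zs) => p; rewrite perD.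
by have -> : z + per q - (per p + per q) = z - per p by ring.
Qed.

Lemma near0_sep : exists2 s : R, 0 < s & forall z p, nrm z < s -> p != (0, 0) -> s <= nrm (z - per p).
Proof.
have [dl d0 H] := per_lb; exists (dl / 2) => [|z [m n] zd p0]; first by rewrite divr_gt0.
have := nrm_sub (per (m, n)) z; rewrite nrmB; have := H (m, n).
suff : dl <= dl * (period_size (m, n))%:R by lra.
rewrite ler_peMr ?(ltW d0) // ler1n /period_size /= lt0n addn_eq0 !absz_eq0.
by apply: contra p0 => /andP[/eqP -> /eqP ->].
Qed.

Lemma near0_sepz (s : R) : (forall z p, nrm z < s -> p != (0, 0) -> s <= nrm (z - per p)) ->
  forall z, z != 0 -> nrm z < s -> sep z (nrm z).
Proof.
move=> H z z0 zs p; have [->|p0] := eqVneq p (0, 0); first by rewrite per0 subr0.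
exact: le_trans (ltW zs) (H z p zs p0).
Qed.

Lemma cubeQ_near0 : bdd (fun z => cubeQ z - z ^- 3).
Proof.
have [s s0 H] := near0_sep; have [K K0 HK] := cube_bd s s0; have [M _ HM] := sum_cube.
exists (K * M), s; split=> // z z0 zs.
have zsep := near0_sepz H z0 zs; have zp : 0 < nrm z by rewrite nrm_gt0.
apply: HM (hassumB (cubeQ_hassum zp zsep) (hassum_single (0, 0) (z ^- 3))) _ => p.
have [->|p0] := eqVneq p (0, 0); first by rewrite per0 subr0 subrr nrm0 mulr_ge0 ?q3_ge0.
by rewrite subr0; apply: HK; [exact: ltW|exact: H].
Qed.

(** The periods congruent to (i, j) modulo 2 contribute the sum at z - i - j tau. *)
Lemma cubeQ_half z s : 0 < s -> sep (2 * z) s ->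
  8 * cubeQ (2 * z) = cubeQ z + cubeQ (z - 1) + cubeQ (z - tau) + cubeQ (z - 1 - tau).
Proof.
move=> s0 zs.
have s2 : 0 < s / 2 by rewrite divr_gt0.
pose e (i j : int) p := (2 * p.1 + i, 2 * p.2 + j).
have eE i j p : 2 * z - per (e i j p) = 2 * (z - i%:~R - tau * j%:~R - per p).
  by rewrite /period /e /= !intrD !intrM; ring.
have zs' i j : sep (z - i%:~R - tau * j%:~R) (s / 2).
  by move=> p; have := zs (e i j p); rewrite eE nrmM nrmn; lra.
have T i j : hassum (fun p => (2 * z - per (e i j p)) ^- 3) (8^-1 * cubeQ (z - i%:~R - tau * j%:~R)).
  apply: eq_hassum (hassumZ 8^-1 (cubeQ_hassum s2 (zs' i j))) => p; rewrite eE.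
  by have -> : 8 = 2 ^+ 3 :> C; [ring|rewrite [in RHS]exprMn [in RHS]invfM].
have inje i j : injective (e i j).
  by move=> [m n] [m' n'] /= [h1 h2]; congr pair; lia.
have H : hassum (fun p => (2 * z - per p) ^- 3)
   (8^-1 * cubeQ (z - 0%:~R - tau * 0%:~R) + 8^-1 * cubeQ (z - 0%:~R - tau * 1%:~R) +
   (8^-1 * cubeQ (z - 1%:~R - tau * 0%:~R) + 8^-1 * cubeQ (z - 1%:~R - tau * 1%:~R))).
  have S i : hassum (fun p => (2 * z - per (2 * p.1 + i, p.2)) ^- 3)
     (8^-1 * cubeQ (z - i%:~R - tau * 0%:~R) + 8^-1 * cubeQ (z - i%:~R - tau * 1%:~R)).
    apply: (@hassum_split _ _ _ _ (fun p => (p.1, 2 * p.2 + 0)) (fun p => (p.1, 2 * p.2 + 1))).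
    - by move=> [m n] [m' n'] /= [h1 h2]; congr pair; lia.
    - by move=> [m n] [m' n'] /= [h1 h2]; congr pair; lia.
    - move=> [m n]; have [h|h] := pselect (exists k, n = 2 * k).
        by left; case: h => k ->; exists (m, k) => /=; rewrite addr0.
      right; exists (m, (n %/ 2)%Z) => /=; congr pair.
      have := divz_eq n 2; have : (n %% 2)%Z = 0 \/ (n %% 2)%Z = 1 by lia.
      by case=> -> e1; [case: h; exists (n %/ 2)%Z|]; lia.
    - by move=> [m n] [m' n'] /= [_]; lia.
    - exact: T.
    - exact: T.
  apply: (@hassum_split _ _ _ _ (fun p => (2 * p.1 + 0, p.2)) (fun p => (2 * p.1 + 1, p.2))).
  - by move=> [m n] [m' n'] /= [h1 h2]; congr pair; lia.
  - by move=> [m n] [m' n'] /= [h1 h2]; congr pair; lia.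
  - move=> [n m]; have [h|h] := pselect (exists k, n = 2 * k).
      by left; case: h => k ->; exists (k, m) => /=; rewrite addr0.
    right; exists ((n %/ 2)%Z, m) => /=; congr pair.
    have := divz_eq n 2; have : (n %% 2)%Z = 0 \/ (n %% 2)%Z = 1 by lia.
    by case=> -> e1; [case: h; exists (n %/ 2)%Z|]; lia.
  - by move=> [m n] [m' n'] /= [h _]; lia.
  - exact: S.
  - exact: S.
rewrite {1}/cubeQ (hassum_sum H) !mulr0 !mulr1 !subr0.
by field.
Qed.

End LatticeSums.

(** * Identification with the Weierstrass functions *)

Section WeierstrassP.
Variable R : realType.
Local Notation C := R[i].
Variable tau : C.
Hypothesis t0 : 0 < complex.Im tau.
Local Notation per := (period tau).
Implicit Types (p q : int * int) (z h : C).

Lemma inv2_sub (x w : C) (y : R) : 0 < y -> y <= nrm x -> y <= nrm w ->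
  nrm (x ^- 2 - w ^- 2) <= 2 * nrm (x + w) * (y ^+ 3)^-1.
Proof.
move=> y0 yx yw; have x0 : 0 < nrm x := lt_le_trans y0 yx; have w0 : 0 < nrm w := lt_le_trans y0 yw.
have x0' : x != 0 by rewrite -nrm_gt0. have w0' : w != 0 by rewrite -nrm_gt0.
have -> : x ^- 2 - w ^- 2 = (x + w) * ((x ^+ 2 * w)^-1 * (w - x) / w).
  by field; rewrite x0' w0'.
have -> : (x ^+ 2 * w)^-1 * (w - x) / w = (x ^+ 2 * w)^-1 - (x * w ^+ 2)^-1.
  by field; rewrite x0' w0'.
have -> : 2 * nrm (x + w) * (y ^+ 3)^-1 = nrm (x + w) * (2 * (y ^+ 3)^-1) by ring.
rewrite nrmM ler_wpM2l ?nrm_ge0 //.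
have H (u v : R) : y <= u -> y <= v -> (u ^+ 2 * v)^-1 <= (y ^+ 3)^-1.
  move=> yu yv; have u0 := lt_le_trans y0 yu; have v0 := lt_le_trans y0 yv.
  rewrite lef_pV2 ?posrE ?mulr_gt0 ?exprn_gt0 // exprSr.
  by rewrite ler_pM ?exprn_ge0 ?(ltW y0) // lerXn2r // nnegrE ltW.
have := H _ _ yx yw; have := H _ _ yw yx.
rewrite -!nrmX -nrmM -nrmV => h1; rewrite -nrmM -nrmV => h2.
have := nrmBD (x ^+ 2 * w)^-1 (x * w ^+ 2)^-1.
rewrite [x * _]mulrC; lra.
Qed.

Lemma inv2_taylor (x h : C) (s : R) : 0 < s -> s <= nrm x -> nrm h <= s / 2 ->
  nrm ((x + h) ^- 2 - x ^- 2 + 2 * x ^- 3 * h) <= (16 / s * nrm (x ^- 3)) * nrm h ^+ 2.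
Proof.
move=> s0 sx hs; have x0 : 0 < nrm x := lt_le_trans s0 sx.
have x0' : x != 0 by rewrite -nrm_gt0.
have xh : nrm x / 2 <= nrm (x + h).
  by have := nrm_sub x (- h); rewrite nrmN opprK; lra.
have xh0 : 0 < nrm (x + h) by apply: lt_le_trans xh; rewrite divr_gt0.
have xh0' : x + h != 0 by rewrite -nrm_gt0.
have -> : (x + h) ^- 2 - x ^- 2 + 2 * x ^- 3 * h = x ^- 3 * (h ^+ 2 * ((3 * x + 2 * h) / (x + h) ^+ 2)).
  by field; rewrite x0' xh0'.
have -> : 16 / s * nrm (x ^- 3) * nrm h ^+ 2 = nrm (x ^- 3) * (16 / s * nrm h ^+ 2) by ring.
rewrite nrmM ler_wpM2l ?nrm_ge0 //.
rewrite nrmM nrmX mulrC ler_wpM2r ?exprn_ge0 ?nrm_ge0 // nrmM nrmV nrmX.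
have h1 : nrm (3 * x + 2 * h) <= 4 * nrm x.
  by have := nrmD (3 * x) (2 * h); rewrite !nrmM !nrmn; lra.
rewrite ler_pdivrMr ?exprn_gt0 //; apply: (le_trans h1).
have h2 : (nrm x / 2) ^+ 2 <= nrm (x + h) ^+ 2 by rewrite lerXn2r // ?nnegrE ?divr_ge0 ?nrm_ge0.
apply: (@le_trans _ _ (16 / s * (nrm x / 2) ^+ 2)); last by rewrite ler_wpM2l // divr_ge0 // ltW.
have -> : 16 / s * (nrm x / 2) ^+ 2 = 4 * nrm x * (nrm x / s).
  by field; rewrite gt_eqF.
by rewrite ler_peMr ?mulr_ge0 ?nrm_ge0 // ler_pdivlMr // mul1r.
Qed.

Definition wp_term z p := if p == (0, 0) then 0 else (z - per p) ^- 2 - per p ^- 2.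

Lemma wp_term_bd (rho s : R) : 0 < s -> exists2 K, 0 <= K & forall z p, nrm z <= rho ->
  (p != (0, 0) -> s <= nrm (z - per p)) -> nrm (wp_term z p) <= nrm z * K * q3 R (period_size p).
Proof.
move=> s0; have [s' s'0 H'] := near0_sep t0.
have [k k0 Hk] := period_dist_ge t0 rho s0; have [k' k'0 Hk'] := period_dist_ge t0 0 s'0.
have kk0 : 0 < Num.min k k' by rewrite lt_min k0.
exists (2 * (6 / Num.min k k' ^+ 3)); first by rewrite mulr_ge0 // divr_ge0 // exprn_ge0 // ltW.
move=> z p zr zp; rewrite /wp_term; case: eqVneq => [_|p0].
  by rewrite nrm0 mulr_ge0 ?q3_ge0 // mulr_ge0 ?nrm_ge0 // mulr_ge0 // divr_ge0 // exprn_ge0 // ltW.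
set y := Num.min k k' * (period_size p).+1%:R.
have y0 : 0 < y by rewrite mulr_gt0.
have h1 : y <= nrm (z - per p).
  by apply: le_trans (Hk z p zr (zp p0)); rewrite ler_wpM2r // ge_min lexx.
have h2 : y <= nrm (per p).
  have := Hk' 0 p; rewrite nrm0 lexx sub0r nrmN => /(_ erefl) hh.
  apply: le_trans (hh _); first by rewrite ler_wpM2r // ge_min lexx orbT.
  by have := H' 0 p; rewrite nrm0 sub0r nrmN; apply.
apply: le_trans (inv2_sub y0 h1 h2) _; rewrite subrK.
have -> : nrm z * (2 * (6 / Num.min k k' ^+ 3)) * q3 R (period_size p) =
   2 * nrm z * (6 / Num.min k k' ^+ 3 * q3 R (period_size p)) by ring.
by rewrite ler_wpM2l ?mulr_ge0 ?nrm_ge0 // cube_le_q3.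
Qed.

Lemma wp_term_hassum z s : 0 < s -> sep tau z s -> hassum (wp_term z) (wp z tau - z ^- 2).
Proof.
move=> s0 zs; have -> : wp z tau - z ^- 2 = summability.sum (wp_term z).
  by rewrite /wp addrC addKr.
apply: absum_hassum; have [K K0 HK] := wp_term_bd (nrm z) s0.
by apply: (absum_cube (K := nrm z * K)) => p; apply: HK => // _; apply: zs.
Qed.

Lemma wp_near0 : bdd (fun z => (wp z tau - z ^- 2) / z).
Proof.
have [s s0 H] := near0_sep t0; have [K K0 HK] := wp_term_bd s s0; have [M M0 HM] := sum_cube R.
exists (K * M), s; split=> // z z0 zs.
have zsep := near0_sepz H z0 zs; have zp : 0 < nrm z by rewrite nrm_gt0.
rewrite nrmM nrmV ler_pdivrMr // [_ * nrm z]mulrC mulrA.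
apply: HM (wp_term_hassum zp zsep) _ => p; apply: HK; first exact: ltW.
exact: H.
Qed.

(** The second-order remainder of each term is dominated by the terms of cubeQ,
    uniformly in the increment. *)
Lemma wp_derive z s : 0 < s -> sep tau z s -> is_derive z 1 (fun y : C => wp y tau) (- 2 * cubeQ tau z).
Proof.
move=> s0 zs; set q := - 2 * cubeQ tau z.
pose L := [the {linear C -> C} of q \*: (idfun : {linear C -> C})].
have LE h : L h = q * h by [].
have [K K0 HK] := cube_bd t0 (nrm z) s0; have [M M0 HM] := sum_cube R.
have s2 : 0 < s / 2 by rewrite divr_gt0.
have [||_ D] := @diff_quad R C (fun y : C => wp y tau) z L (nrm q) (16 / s * K * M) (s / 2) s2.
- by move=> h; rewrite LE nrmM vnrmC.
- move=> h; rewrite vnrmC => hs; rewrite LE /q.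
  have zhs := sepD zs (ltW hs).
  rewrite [h + z]addrC.
  have H1 := hassumB (hassumD (wp_term_hassum s2 zhs) (hassum_single (0, 0) ((z + h) ^- 2)))
    (hassumD (wp_term_hassum s0 zs) (hassum_single (0, 0) (z ^- 2))).
  have H2 := hassumD H1 (hassumZ (2 * h) (cubeQ_hassum t0 s0 zs)).
  rewrite !subrK in H2.
  have -> : wp (z + h) tau - wp z tau - - 2 * cubeQ tau z * h =
    wp (z + h) tau - wp z tau + 2 * h * cubeQ tau z by ring.
  have -> : 16 / s * K * M * nrm h ^+ 2 = (16 / s * nrm h ^+ 2 * K) * M by ring.
  apply: HM H2 _ => p; rewrite /wp_term.
  have := inv2_taylor s0 (zs p) (ltW hs).
  have -> : z - per p + h = z + h - per p by ring.
  have -> : 2 * (z - per p) ^- 3 * h = 2 * h * (z - per p) ^- 3 by ring.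
  move=> hp.
  apply: (@le_trans _ _ (16 / s * nrm ((z - per p) ^- 3) * nrm h ^+ 2)); last first.
    have -> : 16 / s * nrm h ^+ 2 * K * q3 R (period_size p) = 16 / s * (K * q3 R (period_size p)) * nrm h ^+ 2 by ring.
    by rewrite ler_wpM2r ?exprn_ge0 ?nrm_ge0 // ler_wpM2l ?divr_ge0 ?(ltW s0) // HK.
  move: hp; case: eqVneq => [->|_]; first by rewrite per0 !subr0 !add0r.
  apply: le_trans; rewrite le_eqVlt; apply/orP; left; apply/eqP; congr (nrm (_ + _)).
  by ring.
by have := D 1; rewrite LE mulr1.
Qed.

End WeierstrassP.

Section Identification.
Variable R : realType.
Local Notation C := R[i].
Variables (tau : C) (f E O : nat -> C -> C).
Hypothesis HS : theta_like tau f E O.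
Let t0 := tl_im HS.
Let Hf := tl_f HS.
Local Notation L := (ell_L f).
Local Notation P := (ell_P f).
Local Notation P1 := (ell_P1 f).
Local Notation a := (ell_a f).
Local Notation Q := (cubeQ tau).

Lemma lat_sep (z : C) : ~ lattice tau z -> exists2 s : R, 0 < s & sep tau z s.
Proof.
move=> zl; have [s s0 H] := cont_neq0 (dv_cont (Hf 0 z)) (f_neq0 HS zl).
exists s => // p; rewrite leNgt; apply/negP; rewrite nrmB => h.
have := H _ h; rewrite addrC subrK => /eqP; apply.
by apply/(f_zeros HS); exists p.
Qed.

Let T z := P1 z + 2 * Q z.

Lemma T_lat z w : ~ lattice tau z -> lattice tau w -> T (z + w) = T z.
Proof.
move=> zl lw; have [s s0 zs] := lat_sep zl; rewrite /T (P1_lat HS zl lw).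
by case: lw => p _ <-; rewrite (cubeQ_per t0 p s0 zs).
Qed.

Lemma T_half z : ~ lattice tau (2 * z) -> exists w1 w2 w3,
  [/\ ~ lattice tau z, ~ lattice tau (z + w1), ~ lattice tau (z + w2), ~ lattice tau (z + w3) &
  8 * T (2 * z) = T z + T (z + w1) + T (z + w2) + T (z + w3)].
Proof.
move=> zl; have [s s0 zs] := lat_sep zl; have [zl0 hp _] := lat_double zl.
have H := cubeQ_half t0 s0 zs; have H1 := P1_halves HS zl.
exists (half_period tau ord0), (half_period tau (inord 1)), (half_period tau (inord 2));
  split; [by []|by rewrite addrC|by rewrite addrC|by rewrite addrC|].
have e i : Q (z - half_period tau i) = Q (z + half_period tau i).
  have hm : ~ lattice tau (z - half_period tau i).
    move=> h; apply: (hp i); have -> : half_period tau i + z = z - half_period tau i + (half_period tau i + half_period tau i) by ring.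
    by apply: latD => //; apply: half2_lat.
  have [s' s'0 zs'] := lat_sep hm; have [p _ hp'] := half2_lat tau i.
  rewrite -(cubeQ_per t0 p s'0 zs') hp'; congr Q; ring.
have h1 := e ord0; have h2 := e (inord 1); have h3 := e (inord 2).
rewrite /half_period /= ?inordK //= in h1 h2 h3 H1 *.
have h4 : z - 1 - tau = z - (1 + tau) by ring.
rewrite h4 h1 h2 h3 in H.
rewrite /T mulrDr H1 mulrCA H; move: (Q z) (P1 z) => *; ring.
Qed.

(** At a lattice point the poles of P1 and 2 Q cancel. *)
Lemma T_local z0 : exists (d M : R), 0 < d /\
  forall z, ~ lattice tau z -> nrm (z - z0) < d -> nrm (T z) <= M.
Proof.
have [lz0|lz0] := pselect (lattice tau z0).
  have [M [d [d0 H]]] : bdd T.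
    have [Q3 P3] := (cubeQ_near0 t0, laurent_P1 HS).
    have b : bdd (fun z => (P1 z + 2 / z ^+ 3) + 2 * (Q z - z ^- 3)) by bdd_rec.
    apply: bdd_ext b; exists 1 => // z z0' _; rewrite /T; ring.
  exists d, M; split=> // z zl zd.
  have zl' : ~ lattice tau (z - z0) by move=> h; apply: zl; rewrite -(subrK z0 z); apply: latD.
  rewrite -(subrK z0 z) (T_lat zl' lz0) H // subr_eq0; apply/eqP => e.
  by apply: zl; rewrite e.
have [d d0 H] := cont_bound (dv_cont (P1_derive HS lz0)).
have [s s0 zs] := lat_sep lz0; have s2 : 0 < s / 2 by rewrite divr_gt0.
have [M HM] := cubeQ_bd t0 (nrm z0 + d) s2.
exists (Num.min d (s / 2)), (nrm (P1 z0) + 1 + 2 * M); split; first by rewrite lt_min d0.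
move=> z zl; rewrite lt_min => /andP[h1 h2].
have := H _ h1; rewrite addrC subrK => h3.
have := sepD zs (ltW h2); rewrite addrC subrK => h4.
have h5 : nrm z <= nrm z0 + d by have := nrm_sub z z0; lra.
have := HM _ h5 h4; have := nrmD (P1 z) (2 * Q z); rewrite /T [nrm (2 * _)]nrmM nrmn; lra.
Qed.

(** By periodicity it suffices to bound T on a compact parallelogram, where a
    local bound gives a global one. *)
Lemma T_bounded : exists M : R, forall z, ~ lattice tau z -> nrm (T z) <= M.
Proof.
pose g (x : R * R) : C := 2 * x.1%:C + 2 * tau * x.2%:C.
have cK : compact (`[0%R, 1%R]%classic `*` `[0%R, 1%R]%classic : set (R * R)).
  by apply: compact_setX; apply: segment_compact.
move/compact_near_coveringP: cK => /(_ R (pinfty_nbhs R)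
  (fun M x => ~ lattice tau (g x) -> nrm (T (g x)) <= M) _) [].
  move=> x _; have [d [M [d0 H]]] := T_local (g x).
  pose e := d / (2 + 2 * nrm tau).
  have k0 : 0 < 2 + 2 * nrm tau by rewrite ltr_pwDl // mulr_ge0 // nrm_ge0.
  have e0 : 0 < e by rewrite divr_gt0.
  exists (ball x e, [set M' | M <= M']) => /=.
    split; first exact: nbhsx_ballx.
    by apply: nbhs_pinfty_ge; rewrite num_real.
  move=> [y M'] /= [[b1 b2] MM'] yl; apply: le_trans MM'; apply: H => //.
  have -> : g y - g x = - (2 * (x.1 - y.1)%:C + 2 * tau * (x.2 - y.2)%:C).
    by rewrite /g !rmorphB /=; ring.
  rewrite nrmN (le_lt_trans (nrmD _ _)) // !nrmM !nrmn !nrmR.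
  move: b1 b2; rewrite /ball /= => b1 b2.
  have -> : d = 2 * e + 2 * nrm tau * e by rewrite /e -mulrDl mulrC divfK ?gt_eqF.
  have h1 : 2 * `|x.1 - y.1| < 2 * e by rewrite ltr_pM2l.
  have h2 : 2 * nrm tau * `|x.2 - y.2| <= 2 * nrm tau * e.
    by rewrite ler_wpM2l ?mulr_ge0 ?nrm_ge0 // ltW.
  lra.
move=> M0 [_ HM]; exists (M0 + 1) => z zl.
have [w [s [t [lw s01 t01 zE]]]] := lat_reduce t0 z.
have gl : ~ lattice tau (g (s, t)).
  by move=> h; apply: zl; rewrite zE addrC; apply: latD.
have -> : T z = T (g (s, t)) by rewrite zE addrC T_lat.
by apply: HM => //=; rewrite ?ltrDl // /set_itv /= !in_itv /= s01 t01.
Qed.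

(** By T_half a bound M for |T| improves to M / 2, hence to M / 2^n for all n. *)
Lemma P1_cubeQ z : ~ lattice tau z -> P1 z = - 2 * Q z.
Proof.
have [M HM] := T_bounded.
have H n : forall y, ~ lattice tau y -> 2 ^+ n * nrm (T y) <= M.
  elim: n => [|n IH] y yl; first by rewrite mul1r; apply: HM.
  have ey : y = 2 * (y / 2) by field.
  have yl' := yl; rewrite ey in yl'; have [w1 [w2 [w3 [n0 n1 n2 n3 e]]]] := T_half yl'.
  rewrite -ey in e.
  have h : 8 * nrm (T y) <= nrm (T (y / 2)) + nrm (T (y / 2 + w1)) + nrm (T (y / 2 + w2)) + nrm (T (y / 2 + w3)).
    have -> : 8 * nrm (T y) = nrm (8 * T y) by rewrite nrmM nrmn.
    rewrite e; do 2!(rewrite (le_trans (nrmD _ _)) // lerD2r).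
    exact: nrmD.
  have := ler_wpM2l (exprn_ge0 n (ler0n R 2)) h; rewrite !mulrDr exprSr.
  have := IH _ n0; have := IH _ n1; have := IH _ n2; have := IH _ n3; lra.
move=> zl; suff T0 : T z = 0 by move/eqP: T0; rewrite /T addr_eq0 => /eqP ->; ring.
apply/eqP; rewrite -nrm_eq0 eq_le nrm_ge0 andbT leNgt; apply/negP => p.
have M0 : 0 <= M by apply: le_trans (nrm_ge0 _) (HM z zl).
have := H (Num.bound (M / nrm (T z))) z zl.
apply/negP; rewrite -ltNge -ltr_pdivrMr //.
apply: lt_trans (archi_boundP _) _; first by rewrite divr_ge0 // ltW.
by rewrite -natrX ltr_nat ltn_expl.
Qed.

Lemma small_const (F : C -> C) (k : C) : bdd (fun z => F z / z) ->
  (forall z, ~ lattice tau z -> F z = k) -> k = 0.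
Proof.
move=> [M [d [d0 H]]] Fk; have [r r0 Hr] := f_isolated HS.
have M0 : 0 < `|M| + 1 by rewrite ltr_wpDl.
apply/eqP; rewrite -nrm_eq0 eq_le nrm_ge0 andbT leNgt; apply/negP => k0.
pose e := Num.min (Num.min (d / 2) (r / 2)) (nrm k / (`|M| + 1) / 2).
have e0 : 0 < e by rewrite !lt_min !divr_gt0.
have [h1 [h2 h3]] : e <= d / 2 /\ e <= r / 2 /\ e <= nrm k / (`|M| + 1) / 2.
  by rewrite /e !ge_min !lexx /= !orbT.
have ec : nrm e%:C = e by rewrite nrmR gtr0_norm.
have ez : e%:C != 0 by rewrite -nrm_gt0 ec.
have el : ~ lattice tau e%:C.
  by move=> /(f_zeros HS); apply/eqP; apply: Hr; rewrite // ec; lra.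
have := H _ ez; rewrite ec (Fk _ el) nrmM nrmV ec ler_pdivrMr //.
have : (nrm k / (`|M| + 1)) * (`|M| + 1) = nrm k by rewrite divfK ?gt_eqF.
move: h3; set y := nrm k / (`|M| + 1) => h3 h4 h5.
have h6 : e * (`|M| + 1) <= y / 2 * (`|M| + 1) by rewrite ler_wpM2r // ltW.
have h7 : M * e <= `|M| * e by rewrite ler_wpM2r ?ler_norm // ltW.
have := h5 _; nra.
Qed.

(** P - wp has derivative zero off the lattice, and it tends to a at 0. *)
Theorem wp_ell z : ~ lattice tau z -> wp z tau = P z - a.
Proof.
move=> zl; pose F z := P z - wp z tau.
have Fc y : ~ lattice tau y -> F y = F z.
  move=> yl; apply: (const_off_countable (@countable_lat _ tau) _ yl zl) => x xl.
  have [s s0 xs] := lat_sep xl; have dP := P_derive HS xl; have dw := wp_derive t0 s0 xs.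
  by rewrite /F; dv_by ltac:(eassumption); rewrite P1_cubeQ // subrr.
have : F z - a = 0.
  apply: (@small_const (fun z => F z - a)); last by move=> y /Fc ->.
  have [b1 b2] := (laurent_P HS, wp_near0 t0).
  have b : bdd (fun z => (P z - z ^- 2 - a) / z - (wp z tau - z ^- 2) / z) by bdd_rec.
  by apply: bdd_ext b; exists 1 => // y y0 _; rewrite /F; field; rewrite y0.
by rewrite /F => /eqP; rewrite subr_eq0 => /eqP h; rewrite -h; ring.
Qed.

Lemma to0P (F : C -> C) : F z @[z --> (0 : C)^'] --> (0 : C) <->
  forall e : R, 0 < e -> exists2 d : R, 0 < d & forall z, z != 0 -> nrm z < d -> nrm (F z) < e.
Proof.
split=> [/nbhsCP H e /H /nbhs_ballP [d /= /gt0C[d' d0 ->]] hd|H].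
  exists d' => // z z0 zd; have := hd z; rewrite -ball_normE /= sub0r normrN normE ltcR => /(_ zd z0).
  by rewrite sub0r nrmN.
apply/nbhsCP => e /H[d d0 hd]; apply/nbhs_ballP; exists d%:C => /=; first by rewrite ltcR.
move=> z; rewrite -ball_normE /= sub0r normrN normE ltcR => zd z0.
by rewrite sub0r nrmN hd.
Qed.

Lemma bdd_to0 (F : C -> C) : bdd (fun z => F z / z) -> F z @[z --> (0 : C)^'] --> (0 : C).
Proof.
move=> [M [d [d0 H]]]; apply/to0P => e e0.
have M0 : 0 < `|M| + 1 by rewrite ltr_wpDl.
exists (Num.min d (e / (`|M| + 1))); first by rewrite lt_min d0 divr_gt0.
move=> z z0; rewrite lt_min => /andP[zd ze]; have zp : 0 < nrm z by rewrite nrm_gt0.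
have := H z z0 zd; rewrite nrmM nrmV ler_pdivrMr // => h.
rewrite ltr_pdivlMr // in ze.
have : M * nrm z <= `|M| * nrm z by rewrite ler_wpM2r ?ler_norm // ltW.
lra.
Qed.

(** L + a z has the two properties that define the zeta function. Any other such
    function differs from it, off the lattice, by a constant, which is the limit
    0 at the origin. *)
Theorem zeta_ell z : ~ lattice tau z -> weierstrass_zeta z tau = L z + a * z.
Proof.
move=> zl; pose g y := L y + a * y.
have gz : is_weierstrass_zeta tau g.
  split=> [y yl|].
    by rewrite wp_ell //; have dL := L_derive HS yl; rewrite /g; dv_by ltac:(eassumption); ring.
  have b1 := laurent_L HS.
  have b : bdd (fun z => (L z - z^-1) / z + a) by bdd_rec.
  apply: bdd_to0; apply: bdd_ext b; exists 1 => // y y0 _; rewrite /g; by field; rewrite y0.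
rewrite /weierstrass_zeta; set G := [set h | _].
have [h1 h2] : G (xget (fun=> 0) G) by apply: xgetPex; exists g.
move: (xget _ _) h1 h2 => h h1 h2; case: gz => g1 g2.
pose F y := h y - g y.
have Fc y : ~ lattice tau y -> F y = F z.
  move=> yl; apply: (const_off_countable (@countable_lat _ tau) _ yl zl) => x xl.
  have d1 := h1 x xl; have d2 := g1 x xl.
  by rewrite /F; dv_by ltac:(eassumption); rewrite subrr.
suff : F z = 0 by move/eqP; rewrite subr_eq0 => /eqP.
apply/eqP; rewrite -nrm_eq0 eq_le nrm_ge0 andbT leNgt; apply/negP => k0.
have k2 : 0 < nrm (F z) / 2 by rewrite divr_gt0.
have [r1 r10 Hr1] := (to0P _).1 h2 _ k2; have [r2 r20 Hr2] := (to0P _).1 g2 _ k2.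
have [r r0 Hr] := f_isolated HS.
pose e := Num.min (Num.min (r1 / 2) (r2 / 2)) (r / 2).
have e0 : 0 < e by rewrite !lt_min !divr_gt0.
have [e1 [e2 e3]] : e <= r1 / 2 /\ e <= r2 / 2 /\ e <= r / 2.
  by rewrite /e !ge_min !lexx /= !orbT.
have ec : nrm e%:C = e by rewrite nrmR gtr0_norm.
have ez : e%:C != 0 by rewrite -nrm_gt0 ec.
have el : ~ lattice tau e%:C.
  by move=> /(f_zeros HS); apply/eqP; apply: Hr; rewrite // ec; lra.
have a1 : nrm (h e%:C - e%:C^-1) < nrm (F z) / 2 by apply: Hr1; rewrite // ec; lra.
have a2 : nrm (g e%:C - e%:C^-1) < nrm (F z) / 2 by apply: Hr2; rewrite // ec; lra.
have := nrmBD (h e%:C - e%:C^-1) (g e%:C - e%:C^-1).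
have -> : h e%:C - e%:C^-1 - (g e%:C - e%:C^-1) = F e%:C by rewrite /F; ring.
rewrite (Fc _ el); lra.
Qed.

End Identification.

(** * The heat equation *)

Section Heat.
Variable R : realType.
Local Notation C := R[i].
Local Notation pI := (pIR R).
Variables (tau : C) (f E O : nat -> C -> C).
Hypothesis HS : theta_like tau f E O.
Let Hf := tl_f HS.
Let c0 : f 1 0 != 0. Proof. exact: (f1_neq0 HS). Qed.
Local Notation c := (f 1 0).
Local Notation L := (ell_L f).
Local Notation P := (ell_P f).
Local Notation P1 := (ell_P1 f).
Local Notation a := (ell_a f).
Local Notation b := (ell_b f).

Ltac dvz := dv_by ltac:(notypeclasses refine (dv_comp (Hf _ _) _); dv_rec fail).

Lemma hirota4 x : f 0 x * f 4 x - 4 * (f 1 x * f 3 x) + 3 * f 2 x ^+ 2 =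
  - b * f 0 x ^+ 2 - 12 * a * (f 0 x * f 2 x - f 1 x ^+ 2).
Proof.
have c2 : c ^+ 2 != 0 by rewrite expf_neq0.
apply: (mulfI c2); have := hirota HS x; rewrite -mulrA => ->.
by rewrite /ell_a /ell_b; field.
Qed.

Lemma hirota5 x : f 0 x * f 5 x - 3 * (f 1 x * f 4 x) + 2 * (f 2 x * f 3 x) =
  - 2 * b * (f 0 x * f 1 x) - 12 * a * (f 0 x * f 3 x - f 1 x * f 2 x).
Proof. notypeclasses refine (dv_eqfun (z := x) hirota4 _ _); dvz; ring. Qed.

Lemma hirota6 x : f 0 x * f 6 x - 2 * (f 1 x * f 5 x) - f 2 x * f 4 x + 2 * f 3 x ^+ 2 =
  - 2 * b * (f 1 x ^+ 2 + f 0 x * f 2 x) - 12 * a * (f 0 x * f 4 x - f 2 x ^+ 2).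
Proof. notypeclasses refine (dv_eqfun (z := x) hirota5 _ _); dvz; ring. Qed.

Local Notation P2 := (fun x => 6 * P x ^+ 2 - 12 * a * P x + b).

(** In the lemmas heat_L, heat_P and heat_P1 the left side is what the quotient
    rule gives when f k.+2 replaces the tau-derivative of f k. *)
Lemma heat_L x : ~ lattice tau x ->
  (f 3 x * f 0 x - f 1 x * f 2 x) / f 0 x ^+ 2 = - 2 * L x * P x - P1 x.
Proof. by move=> /(f_neq0 HS) nx; rewrite /L /P /P1; field. Qed.

Let solve (u v w : C) : u != 0 -> u * v = w -> v = w / u.
Proof. by move=> u0 <-; rewrite mulrC mulKf. Qed.

Lemma f4E x : ~ lattice tau x -> f 4 x = (4 * (f 1 x * f 3 x) - 3 * f 2 x ^+ 2 - b * f 0 x ^+ 2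
   - 12 * a * (f 0 x * f 2 x - f 1 x ^+ 2)) / f 0 x.
Proof.
move=> /(f_neq0 HS) nx; apply: solve => //.
rewrite -[LHS](addrK (- 4 * (f 1 x * f 3 x) + 3 * f 2 x ^+ 2)).
have -> : f 0 x * f 4 x + (- 4 * (f 1 x * f 3 x) + 3 * f 2 x ^+ 2) =
  f 0 x * f 4 x - 4 * (f 1 x * f 3 x) + 3 * f 2 x ^+ 2 by ring.
rewrite hirota4; ring.
Qed.

Lemma f5E x : ~ lattice tau x -> f 5 x = (3 * (f 1 x * f 4 x) - 2 * (f 2 x * f 3 x)
   - 2 * b * (f 0 x * f 1 x) - 12 * a * (f 0 x * f 3 x - f 1 x * f 2 x)) / f 0 x.
Proof.
move=> /(f_neq0 HS) nx; apply: solve => //.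
rewrite -[LHS](addrK (- 3 * (f 1 x * f 4 x) + 2 * (f 2 x * f 3 x))).
have -> : f 0 x * f 5 x + (- 3 * (f 1 x * f 4 x) + 2 * (f 2 x * f 3 x)) =
  f 0 x * f 5 x - 3 * (f 1 x * f 4 x) + 2 * (f 2 x * f 3 x) by ring.
rewrite hirota5; ring.
Qed.

Lemma f6E x : ~ lattice tau x -> f 6 x = (2 * (f 1 x * f 5 x) + f 2 x * f 4 x - 2 * f 3 x ^+ 2
   - 2 * b * (f 1 x ^+ 2 + f 0 x * f 2 x) - 12 * a * (f 0 x * f 4 x - f 2 x ^+ 2)) / f 0 x.
Proof.
move=> /(f_neq0 HS) nx; apply: solve => //.
rewrite -[LHS](addrK (- 2 * (f 1 x * f 5 x) - f 2 x * f 4 x + 2 * f 3 x ^+ 2)).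
have -> : f 0 x * f 6 x + (- 2 * (f 1 x * f 5 x) - f 2 x * f 4 x + 2 * f 3 x ^+ 2) =
  f 0 x * f 6 x - 2 * (f 1 x * f 5 x) - f 2 x * f 4 x + 2 * f 3 x ^+ 2 by ring.
rewrite hirota6; ring.
Qed.

Lemma heat_P x : ~ lattice tau x ->
  ((2 * f 1 x * f 3 x - f 2 x ^+ 2 - f 0 x * f 4 x) * f 0 x
   - 2 * (f 1 x ^+ 2 - f 0 x * f 2 x) * f 2 x) / f 0 x ^+ 3 =
  - 2 * P x ^+ 2 + 2 * L x * P1 x + P2 x.
Proof.
move=> xl; have nx := f_neq0 HS xl; rewrite (f4E xl) /L /P /P1.
move: a b (f 0 x) (f 1 x) (f 2 x) (f 3 x) nx => A B F0 F1 F2 F3 nx; by field.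
Qed.

Lemma heat_P1 x : ~ lattice tau x ->
  ((3 * (f 1 x * f 2 x ^+ 2 + f 0 x * f 2 x * f 3 x + f 0 x * f 1 x * f 4 x) - 6 * f 1 x ^+ 2 * f 3 x
    - 2 * f 0 x * f 2 x * f 3 x - f 0 x ^+ 2 * f 5 x) * f 0 x
   - 3 * (3 * f 0 x * f 1 x * f 2 x - 2 * f 1 x ^+ 3 - f 0 x ^+ 2 * f 3 x) * f 2 x) / f 0 x ^+ 4 =
  6 * P x * P1 x + 2 * L x * P2 x - 12 * a * P1 x.
Proof.
move=> xl; have nx := f_neq0 HS xl; rewrite (f5E xl) (f4E xl) /L /P /P1.
move: a b (f 0 x) (f 1 x) (f 2 x) (f 3 x) nx => A B F0 F1 F2 F3 nx; by field.
Qed.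

(** The left side is the z-derivative of P1 as the quotient rule gives it. *)
Lemma heat_P2 x : ~ lattice tau x ->
  ((3 * (f 1 x ^+ 2 * f 2 x + f 0 x * f 2 x ^+ 2 + f 0 x * f 1 x * f 3 x) - 6 * f 1 x ^+ 2 * f 2 x
    - 2 * f 0 x * f 1 x * f 3 x - f 0 x ^+ 2 * f 4 x) * f 0 x
   - 3 * (3 * f 0 x * f 1 x * f 2 x - 2 * f 1 x ^+ 3 - f 0 x ^+ 2 * f 3 x) * f 1 x) / f 0 x ^+ 4 = P2 x.
Proof.
move=> xl; have nx := f_neq0 HS xl; rewrite (f4E xl) /P.
move: a b (f 0 x) (f 1 x) (f 2 x) (f 3 x) nx => A B F0 F1 F2 F3 nx; by field.
Qed.

(** The hypothesis is hirota4 differentiated in tau; B stands for pi i times the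
    tau-derivative of b, and it is the only unknown. *)
Lemma heat_b x (B : C) : ~ lattice tau x ->
  f 2 x * f 4 x + f 0 x * f 6 x - 4 * (f 3 x * f 3 x + f 1 x * f 5 x) + 6 * f 2 x * f 4 x
  + B * f 0 x ^+ 2 + 2 * b * f 0 x * f 2 x - 4 * b * (f 0 x * f 2 x - f 1 x ^+ 2)
  + 12 * a * (f 2 x ^+ 2 + f 0 x * f 4 x - 2 * f 1 x * f 3 x) = 0 ->
  B = 6 * P1 x ^+ 2 - 8 * P x * P2 x + 24 * P x ^+ 3 - 24 * a * P x ^+ 2 - 4 * b * P x.
Proof.
move=> xl; have nx := f_neq0 HS xl; rewrite (f6E xl) (f5E xl) (f4E xl) /L /P /P1.
move: a b (f 0 x) (f 1 x) (f 2 x) (f 3 x) nx => A D F0 F1 F2 F3 nx H.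
have n2 : F0 ^+ 2 != 0 by rewrite expf_neq0.
apply: (mulIf n2); apply: subr0_eq; rewrite -[RHS]H; by field.
Qed.

End Heat.

Section ThetaModel.
Variable R : realType.
Local Notation C := R[i].
Local Notation pI := (pIR R).
Implicit Types z tau : C.

Lemma theta1_tildeE z tau : 0 < complex.Im tau -> theta1_tilde z tau = thf 0 z tau.
Proof.
move=> t0; rewrite /theta1_tilde /theta1 /thf -mulrA; congr (_ * _).
set A := cexp _; have A0 : A != 0 by apply: cexp_neq0.
apply: (mulfI (invr_neq0 A0)); rewrite mulKf //.
apply: hassum_sum; apply: eq_hassum (hassumZ A^-1 (thk_hassum true (1 / 2) 0 z t0)) => n.
rewrite tterm0E /sgn mulrCA /A -cexpN -cexpD; congr (_ * cexp _).
by rewrite /lam halfC pIE; field.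
Qed.

Lemma thf_theta_like tau : 0 < complex.Im tau ->
  theta_like tau (fun k z => thf k z tau) (fun k z => thE k z tau) (fun k z => thO k z tau).
Proof.
move=> t0; split=> //.
- by move=> k z; apply: thf_derive.
- by move=> k z; apply: thEO_derive.
- by move=> k z; apply: thEO_derive.
- by move=> x y; apply: thf_add.
- by move=> k z; apply: thf_odd.
- by move=> k z; apply: thf_per1.
- by move=> z; apply: thf_per2.
- exact: thf_neq0.
Qed.

Lemma thf_derive_tau k z tau : 0 < complex.Im tau ->
  is_derive tau 1 (fun t => thf k z t) (pI^-1 * thf k.+2 z tau).
Proof.
move=> t0.
have L1 (h : C) : nrm (idfun h) <= 1 * vnrm h by rewrite mul1r vnrmC.
have L2 (h : C) : nrm ((\0 : {linear C -> C}) h) <= 1 * vnrm h.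
  by rewrite mul1r vnrmC nrm0 nrm_ge0.
have tx : 0 < complex.Im ((idfun : {linear C -> C}) tau + 0) by rewrite addr0.
have [_ /(_ 1)] := @thk_diff R true (1 / 2) C \0 idfun z 0 1 ltr01 L2 L1 k tau tx.
rewrite /= mulr0 add0r mulr1 add0r addr0 => H.
have H' : is_derive tau 1 (fun t => thk true (1 / 2) k z t) (thk true (1 / 2) k.+2 z tau / pI).
  by move: H; congr is_derive; apply/funext => y; rewrite addr0.
by rewrite /thf; dv_by ltac:(exact: H'); ring.
Qed.

(** hirota4 holds at every tau, so its tau-derivative at fixed z vanishes. *)
Lemma b_heat z tau : 0 < complex.Im tau -> ~ lattice tau z ->
  let f k w := thf k w tau in let c := f 1 0 in let P := ell_P f z in let P1 := ell_P1 f z in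
  let a := ell_a f in let b := ell_b f in
  (c * f 7 0 - f 3 0 * f 5 0) / c ^+ 2 - 2 * (c * f 5 0 - f 3 0 ^+ 2) * f 3 0 / c ^+ 3 =
  6 * P1 ^+ 2 - 8 * P * (6 * P ^+ 2 - 12 * a * P + b) + 24 * P ^+ 3 - 24 * a * P ^+ 2 - 4 * b * P.
Proof.
move=> t0 zl f; have HS := thf_theta_like t0.
apply: (heat_b HS zl).
pose N t := thf 0 z t * thf 4 z t - 4 * (thf 1 z t * thf 3 z t) + 3 * thf 2 z t ^+ 2
  + (thf 1 0 t * thf 5 0 t - thf 3 0 t ^+ 2) / thf 1 0 t ^+ 2 * thf 0 z t ^+ 2
  + 12 * (- thf 3 0 t / (3 * thf 1 0 t)) * (thf 0 z t * thf 2 z t - thf 1 z t ^+ 2).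
have N0 : is_derive tau 1 N 0.
  apply: (dv_ext t0 _ (dv_cst 0 _ _)) => h ht.
  have th : 0 < complex.Im (tau + h).
    by rewrite raddfD /=; have := Im_le h; rewrite ler_norml => /andP[h1 _]; lra.
  have := hirota4 (thf_theta_like th) z; rewrite /ell_a /ell_b /N => H.
  apply/esym; rewrite H; ring.
have c0 : thf 1 0 tau != 0 := f1_neq0 HS.
have c2 : thf 1 0 tau ^+ 2 != 0 by rewrite expf_neq0.
have c3 : 3 * thf 1 0 tau != 0 by rewrite mulf_neq0 // pnatr_eq0.
have dt k w := thf_derive_tau k w t0.
have p0 : pI^-1 != 0 by rewrite invr_eq0 pI_neq0.
set X := (X in X = 0).
suff N1 : is_derive tau 1 N (pI^-1 * X).
  by apply: (mulfI p0); rewrite [RHS]mulr0; exact: (dv_unique N1 N0).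
clear N0; rewrite /N; dv_by ltac:(exact: dt).
rewrite /X /ell_a /ell_b /f; move: (pI^-1) => q; by field; rewrite c0.
Qed.

End ThetaModel.

(** * The members of the chain and their derivatives *)

Section Coordinates.
Variable R : realType.
Local Notation C := R[i].
Local Notation pI := (pIR R).
Local Notation V := ('rV[C]_2).

Definition coord2 (j : 'I_2) (x : V) : C := x 0 j.

Lemma coord2_linear j : linear (coord2 j).
Proof. by move=> k x y; rewrite /coord2 !mxE. Qed.

HB.instance Definition _ j := GRing.isLinear.Build C V C _ (coord2 j) (coord2_linear j).

(** The matrix norm is the maximum of the norms of the entries, here accessed
    through its balls. *)
Lemma coord2_le j (x : V) : nrm (coord2 j x) <= vnrm x.
Proof.
apply/ler_addgt0Pr => e e0.
have : ball (0 : V) (vnrm x + e)%:C x.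
  by rewrite mx_norm_ball /ball_ /= sub0r normrN vnrmE ltcR ltrDl.
move=> H; have := (H : _ /\ forall i j, ball ((0 : V) i j) _ (x i j)).2 0 j; rewrite -ball_normE /= mxE sub0r normrN normE ltcR; exact: ltW.
Qed.

Section Rules.
Variable W : normedModType C.
Implicit Types (f g : W -> C) (x : W).

Lemma df_cst (k : C) x : differentiable (fun _ : W => k) x.
Proof. exact: differentiable_cst. Qed.
Lemma dfD f g x : differentiable f x -> differentiable g x -> differentiable (fun y => f y + g y) x.
Proof. exact: differentiableD. Qed.
Lemma dfN f x : differentiable f x -> differentiable (fun y => - f y) x.
Proof. exact: differentiableN. Qed.
Lemma dfM f g x : differentiable f x -> differentiable g x -> differentiable (fun y => f y * g y) x.
Proof. exact: differentiableM. Qed.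
Lemma dfV f x : f x != 0 -> differentiable f x -> differentiable (fun y => (f y)^-1) x.
Proof. by move=> h1 h2; apply: differentiableV. Qed.
Lemma dfX f n x : differentiable f x -> differentiable (fun y => f y ^+ n) x.
Proof.
move=> h; elim: n => [|n IH]; first exact: df_cst.
have -> : (fun y => f y ^+ n.+1) = (fun y => f y * f y ^+ n) by apply/funext => y; rewrite exprS.
exact: dfM.
Qed.
End Rules.

(** The functions f k at x = (z, tau), and at the point (0, tau) of the same fibre. *)
Definition thv k (x : V) : C := thf k (x 0 0) (x 0 1).
Definition th0 k (x : V) : C := thf k 0 (x 0 1).

Lemma thv_diff k (x : V) : 0 < complex.Im (x 0 1) -> differentiable (thv k) x /\
  forall v, is_derive x v (thv k) (thv k.+1 x * v 0 0 + thv k.+2 x * (pI^-1 * v 0 1)).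
Proof.
move=> t0; have L j (h : V) : nrm (coord2 j h) <= 1 * vnrm h by rewrite mul1r coord2_le.
have tx : 0 < complex.Im (coord2 1 x + 0) by rewrite addr0.
have := @thk_diff R true (1 / 2) V (coord2 0) (coord2 1) 0 0 1 ltr01 (L 0) (L 1) k x tx.
have -> : (fun y : V => thk true (1 / 2) k (coord2 0 y + 0) (coord2 1 y + 0)) =
  (fun y => thk true (1 / 2) k (y 0 0) (y 0 1)) by apply/funext => y; rewrite !addr0.
rewrite /= !addr0 => -[H1 H2]; split; first by apply: dfM => //; apply: df_cst.
move=> v; rewrite /thv /thf; have H3 := H2 v; dv_by ltac:(exact: H3); rewrite /coord2; ring.
Qed.

Lemma th0_diff k (x : V) : 0 < complex.Im (x 0 1) -> differentiable (th0 k) x /\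
  forall v, is_derive x v (th0 k) (th0 k.+2 x * (pI^-1 * v 0 1)).
Proof.
move=> t0; have L2 (h : V) : nrm (coord2 1 h) <= 1 * vnrm h by rewrite mul1r coord2_le.
have L1 (h : V) : nrm ((\0 : {linear V -> C}) h) <= 1 * vnrm h by rewrite mul1r nrm0 vnrm_ge0.
have tx : 0 < complex.Im (coord2 1 x + 0) by rewrite addr0.
have := @thk_diff R true (1 / 2) V \0 (coord2 1) 0 0 1 ltr01 L1 L2 k x tx.
have -> : (fun y : V => thk true (1 / 2) k ((\0 : {linear V -> C}) y + 0) (coord2 1 y + 0)) =
  (fun y => thk true (1 / 2) k 0 (y 0 1)) by apply/funext => y; rewrite !addr0.
rewrite /= !addr0 => -[H1 H2]; split; first by apply: dfM => //; apply: df_cst.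
move=> v; rewrite /th0 /thf; have H3 := H2 v; dv_by ltac:(exact: H3); rewrite /coord2; ring.
Qed.

Let q : C := pI^-1.

(** L, P, P', a, b and P'' as functions of x = (z, tau). *)
Definition phiL (x : V) : C := thv 1 x / thv 0 x.
Definition phiP (x : V) : C := (thv 1 x ^+ 2 - thv 0 x * thv 2 x) / thv 0 x ^+ 2.
Definition phiP1 (x : V) : C :=
  (3 * thv 0 x * thv 1 x * thv 2 x - 2 * thv 1 x ^+ 3 - thv 0 x ^+ 2 * thv 3 x) / thv 0 x ^+ 3.
Definition phia (x : V) : C := - th0 3 x / (3 * th0 1 x).
Definition phib (x : V) : C := (th0 1 x * th0 5 x - th0 3 x ^+ 2) / th0 1 x ^+ 2.
Definition phiP2 (x : V) : C := 6 * phiP x ^+ 2 - 12 * phia x * phiP x + phib x.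

Definition regular_point (x : V) := upper_half_plane (x 0 1) /\ ~ lattice (x 0 1) (x 0 0).

Let HS (x : V) (gx : regular_point x) := thf_theta_like gx.1.
Let nz0 (x : V) (gx : regular_point x) : thv 0 x != 0 := f_neq0 (HS gx) gx.2.
Let nz1 (x : V) (gx : regular_point x) : th0 1 x != 0 := f1_neq0 (HS gx).

Ltac df_rec leaf := first
  [ leaf
  | notypeclasses refine (df_cst _ _)
  | notypeclasses refine (dfD _ _); df_rec leaf
  | notypeclasses refine (dfN _); df_rec leaf
  | notypeclasses refine (dfX _ _); df_rec leaf
  | notypeclasses refine (dfM _ _); df_rec leaf
  | notypeclasses refine (dfV _ _); [cbv beta; assumption | df_rec leaf] ].

Local Opaque thv th0.

Lemma phiL_diff x : regular_point x -> differentiable phiL x.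
Proof.
move=> gx; have h := nz0 gx; have dl k := (thv_diff k gx.1).1.
rewrite /phiL; df_rec ltac:(exact: dl).
Qed.

Lemma phiP_diff x : regular_point x -> differentiable phiP x.
Proof.
move=> gx; have h := expf_neq0 2 (nz0 gx); have dl k := (thv_diff k gx.1).1.
rewrite /phiP; df_rec ltac:(exact: dl).
Qed.

Lemma phiP1_diff x : regular_point x -> differentiable phiP1 x.
Proof.
move=> gx; have h := expf_neq0 3 (nz0 gx); have dl k := (thv_diff k gx.1).1.
rewrite /phiP1; df_rec ltac:(exact: dl).
Qed.

Lemma phia_diff x : regular_point x -> differentiable phia x.
Proof.
move=> gx; have dl k := (th0_diff k gx.1).1.
have h : 3 * th0 1 x != 0 by rewrite mulf_neq0 ?pnatr_eq0 // nz1.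
rewrite /phia; df_rec ltac:(exact: dl).
Qed.

Lemma phib_diff x : regular_point x -> differentiable phib x.
Proof.
move=> gx; have h := expf_neq0 2 (nz1 gx); have dl k := (th0_diff k gx.1).1.
rewrite /phib; df_rec ltac:(exact: dl).
Qed.

Local Transparent thv th0.

Lemma theta_grad x v : regular_point x ->
  is_derive x v (thv 0) (thv 0 x * phiL x * v 0 0 + q * (thv 0 x * (phiL x ^+ 2 - phiP x)) * v 0 1).
Proof.
move=> gx; have h := nz0 gx; apply: (dv_eq ((thv_diff 0 gx.1).2 v)).
rewrite /phiL /phiP -/q; by field.
Qed.

Lemma L_grad x v : regular_point x ->
  is_derive x v phiL (- phiP x * v 0 0 + q * (- 2 * phiL x * phiP x - phiP1 x) * v 0 1).
Proof.
move=> gx; have h := nz0 gx; have dl k := (thv_diff k gx.1).2 v.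
have e := heat_L (HS gx) gx.2.
rewrite -[_ - phiP1 x]e; rewrite {1}/phiL; dv_by ltac:(exact: dl).
rewrite /phiP -/q -!/(thv _ x); by field.
Qed.

Lemma P_grad x v : regular_point x ->
  is_derive x v phiP (phiP1 x * v 0 0 + q * (- 2 * phiP x ^+ 2 + 2 * phiL x * phiP1 x + phiP2 x) * v 0 1).
Proof.
move=> gx; have h := nz0 gx; have dl k := (thv_diff k gx.1).2 v.
have h2 : thv 0 x ^+ 2 != 0 by rewrite expf_neq0.
have e := heat_P (HS gx) gx.2.
rewrite -[_ + phiP2 x]e; rewrite {1}/phiP; dv_by ltac:(exact: dl).
rewrite /phiP1 -/q -!/(thv _ x); by field.
Qed.

Lemma P1_grad x v : regular_point x ->
  is_derive x v phiP1 (phiP2 x * v 0 0 +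
    q * (6 * phiP x * phiP1 x + 2 * phiL x * phiP2 x - 12 * phia x * phiP1 x) * v 0 1).
Proof.
move=> gx; have h := nz0 gx; have dl k := (thv_diff k gx.1).2 v.
have h3 : thv 0 x ^+ 3 != 0 by rewrite expf_neq0.
have e := heat_P1 (HS gx) gx.2.
have e2 := heat_P2 (HS gx) gx.2.
rewrite -[_ - 12 * phia x * _]e -[phiP2 x]e2.
have d0 := dvX 2 (dl 0); have d1 := dvX 2 (dl 1).
rewrite {1}/phiP1; dv_by ltac:(first [exact: dl|exact: d0|exact: d1]).
rewrite -/q -!/(thv _ x); by field.
Qed.

Lemma a_grad x v : regular_point x -> is_derive x v phia (q * (- 3^-1 * phib x) * v 0 1).
Proof.
move=> gx; have h := nz1 gx; have dl k := (th0_diff k gx.1).2 v.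
have h3 : 3 * th0 1 x != 0 by rewrite mulf_neq0 // pnatr_eq0.
rewrite {1}/phia; dv_by ltac:(exact: dl).
rewrite /phib -/q; by field.
Qed.

Lemma b_grad x v : regular_point x -> is_derive x v phib (q * (6 * phiP1 x ^+ 2 - 8 * phiP x * phiP2 x
   + 24 * phiP x ^+ 3 - 24 * phia x * phiP x ^+ 2 - 4 * phib x * phiP x) * v 0 1).
Proof.
move=> gx; have h := nz1 gx; have dl k := (th0_diff k gx.1).2 v.
have h2 : th0 1 x ^+ 2 != 0 by rewrite expf_neq0.
have e := b_heat gx.1 gx.2.
rewrite -[_ - 4 * phib x * _]e; rewrite {1}/phib; dv_by ltac:(exact: dl).
rewrite -/q -!/(th0 _ x); by field.
Qed.

End Coordinates.

(** * The Noetherian chain *)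

Section Eval.
Variables (R : realType) (n l : nat) (x : 'rV[R[i]]_n) (v : 'rV[R[i]]_l).
Local Notation C := R[i].
Local Notation ev := (fun P : mpoly (n + l) C => eval2 P x v).

Lemma ev_cst (c : C) : ev (mpolyC (n + l) c) = c.
Proof. exact: mevalC. Qed.
Lemma evD P Q : ev (P + Q) = ev P + ev Q.
Proof. exact: mevalD. Qed.
Lemma evN P : ev (- P) = - ev P.
Proof. exact: mevalN. Qed.
Lemma evM P Q : ev (P * Q) = ev P * ev Q.
Proof. exact: mevalM. Qed.
Lemma evl i : ev (mpolyX C (mnm1 (lshift l i))) = x 0 i.
Proof. by rewrite /eval2 mevalXU row_mxEl. Qed.
Lemma evr i : ev (mpolyX C (mnm1 (rshift n i))) = v 0 i.
Proof. by rewrite /eval2 mevalXU row_mxEr. Qed.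
Definition evE := (ev_cst, evD, evN, evM, evl, evr).
End Eval.

Section Chain.
Variable R : realType.
Local Notation C := R[i].
Local Notation V := ('rV[C]_2).
Local Notation mp := (mpoly (2 + 6) C).

Definition phi (i : 'I_6) : V -> C :=
  nth (fun=> 0) [:: thv 0; @phiL R; @phiP R; @phiP1 R; @phia R; @phib R] i.

Let X (i : 'I_6) : mp := mpolyX C (mnm1 (rshift 2 i)).
Let k (c : C) : mp := mpolyC (2 + 6) c.
Let q := (pIR R)^-1.

Let T := X 0.
Let L := X 1.
Let P := X (inord 2).
Let P1 := X (inord 3).
Let a := X (inord 4).
Let b := X (inord 5).
Let P2 := k 6 * (P * P) - k 12 * a * P + b.

(** The pairs list the z- and the tau-derivative of the members of the chain. *)
Definition chain_grad (i : 'I_6) (j : 'I_2) : mp :=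
  let: (dz, dt) := nth (0, 0) [::
    (T * L, k q * (T * (L * L - P)));
    (- P, k q * (k (-2) * L * P - P1));
    (P1, k q * (k (-2) * (P * P) + k 2 * L * P1 + P2));
    (P2, k q * (k 6 * P * P1 + k 2 * L * P2 - k 12 * a * P1));
    (k 0, k q * (k (- 3^-1) * b));
    (k 0, k q * (k 6 * (P1 * P1) - k 8 * P * P2 + k 24 * (P * P * P)
                  - k 24 * a * (P * P) - k 4 * b * P))] i
  in if j == 0 then dz else dt.

Lemma phi_diff i x : regular_point x -> differentiable (phi i) x.
Proof.
move=> gx; case: i => [[|[|[|[|[|[|//]]]]]] hi]; rewrite /phi /=.
- exact: (thv_diff 0 gx.1).1.
- exact: phiL_diff.
- exact: phiP_diff.
- exact: phiP1_diff.
- exact: phia_diff.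
- exact: phib_diff.
Qed.

Lemma phi_grad i x (v : V) : regular_point x -> is_derive x v (phi i)
  (eval2 (chain_grad i 0) x (\row_m phi m x) * v 0 0 + eval2 (chain_grad i 1) x (\row_m phi m x) * v 0 1).
Proof.
move=> gx; pose ev (p : mp) := eval2 p x (\row_m phi m x).
have eC c : ev (k c) = c by exact: ev_cst.
have eD p r : ev (p + r) = ev p + ev r by exact: evD.
have eN p : ev (- p) = - ev p by exact: evN.
have eM p r : ev (p * r) = ev p * ev r by exact: evM.
have eX i' : ev (X i') = phi i' x by rewrite /ev /X evr mxE.
have eT : ev T = thv 0 x := eX _.
have eL : ev L = phiL x := eX _.
have eP : ev P = phiP x by rewrite eX /phi inordK.
have eP1 : ev P1 = phiP1 x by rewrite eX /phi inordK.
have ea : ev a = phia x by rewrite eX /phi inordK.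
have eb : ev b = phib x by rewrite eX /phi inordK.
have eP2 : ev P2 = phiP2 x by rewrite /P2 !(eD, eN, eM, eC) eP ea eb /phiP2; ring.
rewrite -!/(ev _) /chain_grad; clear eX; clearbody ev P2; clearbody T L P P1 a b k.
have E := (eD, eN, eM, eC, (eT, eL, eP, eP1, ea, eb, eP2)).
case: i => [[|[|[|[|[|[|//]]]]]] hi]; rewrite /phi /= !E.
- by apply: (dv_eq (theta_grad v gx)); rewrite /q; ring.
- by apply: (dv_eq (L_grad v gx)); rewrite /q; ring.
- by apply: (dv_eq (P_grad v gx)); rewrite /q; ring.
- by apply: (dv_eq (P1_grad v gx)); rewrite /q; ring.
- by apply: (dv_eq (a_grad v gx)); rewrite /q; ring.
- by apply: (dv_eq (b_grad v gx)); rewrite /q; ring.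
Qed.

Lemma phi_chain (Omega : set V) : (forall x, Omega x -> regular_point x) -> noetherian_chain Omega phi.
Proof.
move=> Og; split=> [i x /Og|]; first exact: phi_diff.
exists chain_grad => i j x /Og gx.
have [_ ->] := phi_grad i (delta_mx 0 j) gx; rewrite !mxE eqxx /=.
by case: j => [[|[|//]] hj] /=; rewrite ?mulr1 ?mulr0 ?addr0 ?add0r; congr eval2; congr chain_grad; apply: val_inj.
Qed.

Lemma phi_noetherian (Omega : set V) (F : V -> C) (Q : mp) : (forall x, Omega x -> regular_point x) ->
  (forall x, Omega x -> F x = eval2 Q x (\row_m phi m x)) -> noetherian_function Omega F.
Proof. by move=> Og FQ; exists 6%N, phi; split; [exact: phi_chain|exists Q]. Qed.

End Chain.

Theorem mainTheorem4 (R : realType) (Omega : set 'rV[R[i]]_2)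
    (Omega_domain : domain Omega)
    (Omega_compact : compact (closure Omega))
    (Omega_sub : closure Omega `<=`
       [set x : 'rV[R[i]]_2 | upper_half_plane (x 0 1) /\ ~ lattice (x 0 1) (x 0 0)]) :
  [/\ noetherian_function Omega (fun x => theta1_tilde (x 0 0) (x 0 1)),
      noetherian_function Omega (fun x => weierstrass_zeta (x 0 0) (x 0 1)) &
      noetherian_function Omega (fun x => wp (x 0 0) (x 0 1))].
Proof.
have Og x : Omega x -> regular_point x by move=> Ox; apply: Omega_sub; apply: subset_closure.
pose X (i : 'I_6) : mpoly (2 + 6) R[i] := mpolyX _ (mnm1 (rshift 2 i)).
split.
- apply: (phi_noetherian (Q := X 0) Og) => x /Og [t0 xl].
  by rewrite evE mxE theta1_tildeE.
- apply: (phi_noetherian (Q := X 1 + X (inord 4) * mpolyX _ (mnm1 (lshift 6 (0 : 'I_2)))) Og) => x /Og [t0 xl].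
  by rewrite !evE !mxE (zeta_ell (thf_theta_like t0) xl) /phi inordK.
- apply: (phi_noetherian (Q := X (inord 2) - X (inord 4)) Og) => x /Og [t0 xl].
  by rewrite !evE !mxE (wp_ell (thf_theta_like t0) xl) /phi !inordK.
Qed.
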